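(* Let $\rho\in(0,\infty)$ and $r>0$. Let $Y$ be a ball quasi-Banach function space on $\mathbb R^n$ that is $r$-convex with constant one, and put $X=Y^r$ with norm $\|h\|_X=\||h|^{1/r}\|_Y^r$. For $q>0$ and $C>0$ consider the inequality $$\left\|\Big(\sum_{j=1}^N(\mathcal M^{\mathrm{loc}}_{\rho,r} f_j)^q\Big)^{1/q}\right\|_Y\le C\left\|\Big(\sum_{j=1}^N|f_j|^q\Big)^{1/q}\right\|_Y .\qquad(\ast)$$ Say that $(\ast)$ holds uniformly with exponent $q$ and constant $C$ if it holds for every $N\in\mathbb N$ and every finite family $\{f_j\}_{j=1}^N\subset L^r_{\mathrm{loc}}(\mathbb R^n)$ for which the right-hand side is finite ($C$ being independent of $N$ and of the family). (i) The following statements are equivalent. (a) $\mathcal M^{\mathrm{loc}}_\rho:X\to X$ and $\mathcal M^{\mathrm{loc}}_\rho:X'\to X'$ are bounded. (b) There exist $q>r$ and $C>0$ such that $(\ast)$ holds uniformly with exponent $q$ and constant $C$. (c) For every $q>r$ there is $C>0$ such that $(\ast)$ holds uniformly with exponent $q$ and constant $C$. Each of these conditions implies $Y\subset L^r_{\mathrm{loc}}(\mathbb R^n)$. Moreover, for $q>r$, $(\ast)$ holds uniformly with exponent $q$ and constant $C$ if and only if $$\left\|\Big(\sum_{j=1}^N(\mathcal M^{\mathrm{loc}}_\rho h_j)^{q/r}\Big)^{r/q}\right\|_X\le C^r\left\|\Big(\sum_{j=1}^N|h_j|^{q/r}\Big)^{r/q}\right\|_X$$ for every $N\in\mathbb N$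 and every finite family $\{h_j\}_{j=1}^N$ of measurable functions for which the right-hand side is finite. (ii) Let $q>0$ and suppose that there is a finite constant $C$ such that $(\ast)$ holds uniformly with exponent $q$ and constant $C$. Then necessarily $q>r$ and $Y\subset L^r_{\mathrm{loc}}(\mathbb R^n)$. In particular, no such uniform estimate can hold when $0<q\le r$. (iii) Fix $q>r$ and suppose that $(\ast)$ holds uniformly with exponent $q$ and constant $C$. Then, for every sequence $\{f_j\}_{j=1}^\infty$ of measurable functions with $\big(\sum_{j=1}^\infty|f_j|^q\big)^{1/q}\in Y$, $$\left\|\Big(\sum_{j=1}^\infty(\mathcal M^{\mathrm{loc}}_{\rho,r} f_j)^q\Big)^{1/q}\right\|_Y\le C\left\|\Big(\sum_{j=1}^\infty|f_j|^q\Big)^{1/q}\right\|_Y .$$ Conversely, this estimate for all such sequences implies that $(\ast)$ holds uniformly with exponent $q$ and the same constant $C$. (iv) Suppose that $Y\subset L^r_{\mathrm{loc}}(\mathbb R^n)$. The following statements are equivalent, and the constant $C$ may be chosen to be the same in (a)--(c). (a) There is $C>0$ such that $\|\mathcal M^{\mathrm{loc}}_{\rho,r} f\|_Y\le C\|f\|_Y$ for all $f\in Y$. (b) There is $C>0$ such that, for every $N\in\mathbb N$ and every finite family $\{f_j\}_{j=1}^N$ with $\max_{1\le j\le N}|f_j|\in Y$, $\ \big\|\max_{1\le j\le N}\mathcal M^{\mathrm{loc}}_{\rho,r} f_j\big\|_Y\le C\big\|\max_{1\le j\le N}|f_j|\big\|_Y$. (c) There is $C>0$ such that, for every sequence $\{f_j\}_{j=1}^\infty$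 with $\sup_j|f_j|\in Y$, $\ \big\|\sup_j\mathcal M^{\mathrm{loc}}_{\rho,r} f_j\big\|_Y\le C\big\|\sup_j|f_j|\big\|_Y$.
   Context: Functions on $\mathbb R^n$ are identified when equal a.e. (Lebesgue measure). Ball quasi-Banach function space $Y$: a quasi-Banach space of measurable functions on $\mathbb R^n$ such that (1) if $f\in Y$ and $|g|\le|f|$ a.e. with $g$ measurable, then $g\in Y$ and $\|g\|_Y\le\|f\|_Y$; (2) (Fatou) if $f_k\in Y$, $0\le f_k\uparrow f$ a.e. and $\sup_k\|f_k\|_Y<\infty$, then $f\in Y$ and $\|f\|_Y=\sup_k\|f_k\|_Y$; (3) $\mathbf 1_B\in Y$ for every ball $B$. If a (possibly extended-valued) measurable function is not in a space, its (quasi-)norm is taken to be $+\infty$. $Y$ is $r$-convex with constant one if $\big\|(|f|^r+|g|^r)^{1/r}\big\|_Y\le(\|f\|_Y^r+\|g\|_Y^r)^{1/r}$ for all $f,g\in Y$. The space $Y^r=\{h:\ |h|^{1/r}\in Y\}$ has quasi-norm $\|h\|_{Y^r}=\||h|^{1/r}\|_Y^r$, which is a norm when $Y$ is $r$-convex with constant one; then $Y^r$ is a Banach lattice satisfying (1)--(3). Köthe associate space: $X'=\{g \text{ measurable}:\ \|g\|_{X'}:=\sup_{\|f\|_X\le1}\int_{\mathbb R^n}|fg|\,dx<\infty\}$. Local maximal operators: for measurable $f$, $\mathcal M^{\mathrm{loc}}_\rho f(x)=\sup_{Q\ni x,\ \ell(Q)\le\rho}\frac1{|Q|}\int_Q|f|\in[0,\infty]$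 over axis-parallel cubes $Q\subset\mathbb R^n$ of side length $\ell(Q)\le\rho$ containing $x$ (integrals may be $+\infty$), and $\mathcal M^{\mathrm{loc}}_{\rho,r}f=[\mathcal M^{\mathrm{loc}}_\rho(|f|^r)]^{1/r}$. $L^r_{\mathrm{loc}}(\mathbb R^n)$ is the set of measurable $f$ with $|f|^r$ locally integrable. An operator $T$ is bounded on $Z$ if there is $C<\infty$ with $\|Tf\|_Z\le C\|f\|_Z$ for all $f\in Z$. *)

(* Defs.v *)
From HB Require Import structures.
From mathcomp Require Import all_boot all_order all_algebra.
From mathcomp Require Import all_classical all_reals all_analysis.

Set Implicit Arguments.
Unset Strict Implicit.
Unset Printing Implicit Defensive.
Import Order.TTheory GRing.Theory Num.Theory.
Import numFieldNormedType.Exports.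

Local Open Scope classical_set_scope.
Local Open Scope ring_scope.

Section BorelLebesgue.
Context {R : realType}.

Definition tcons n (p : measurableTypeR R * n.-tuple (measurableTypeR R)) :
  n.+1.-tuple (measurableTypeR R) := [tuple of p.1 :: p.2].

Lemma measurable_tcons n : measurable_fun [set: _] (@tcons n).
Proof. by apply: measurable_cons; [exact: measurable_fst|exact: measurable_snd]. Qed.

Definition tuncons n (t : n.+1.-tuple (measurableTypeR R)) :
  measurableTypeR R * n.-tuple (measurableTypeR R) :=
  (tnth t ord0, [tuple of behead t]).

Lemma measurable_tuncons n : measurable_fun [set: _] (@tuncons n).
Proof.
apply/measurable_fun_pairP; split; first exact: measurable_tnth.
exact: measurable_behead.
Qed.

Lemma tconsK n : cancel (@tcons n) (@tuncons n).
Proof. by case=> x t; rewrite /tuncons /tcons/=; congr pair; exact: val_inj. Qed.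

Section step.
Context (n : nat)
  (m : {sigma_finite_measure set (n.-tuple (measurableTypeR R)) -> \bar R}).

Definition lebesgue_succ : set (n.+1.-tuple (measurableTypeR R)) -> \bar R :=
  pushforward (@lebesgue_measure R \x m)%E (@tcons n).

Let lebesgue_succ0 : lebesgue_succ set0 = 0%E.
Proof. by rewrite /lebesgue_succ /pushforward preimage_set0 measure0. Qed.

Let lebesgue_succ_ge0 A : (0 <= lebesgue_succ A)%E.
Proof. by rewrite /lebesgue_succ /pushforward; exact: measure_ge0. Qed.

Let lebesgue_succ_sigma_additive : semi_sigma_additive lebesgue_succ.
Proof.
move=> F mF tF mUF; rewrite /lebesgue_succ /pushforward preimage_bigcup.
apply: measure_semi_sigma_additive.
- by move=> k; rewrite -[X in measurable X]setTI; exact: measurable_tcons.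
- apply/trivIsetP => /= i j _ _ ij; rewrite -preimage_setI.
  by move/trivIsetP : tF => /(_ _ _ _ _ ij) ->//; rewrite preimage_set0.
- rewrite -preimage_bigcup -[X in measurable X]setTI.
  exact: measurable_tcons.
Qed.

HB.instance Definition _ := isMeasure.Build _ _ _ lebesgue_succ
  lebesgue_succ0 lebesgue_succ_ge0 lebesgue_succ_sigma_additive.

Let lebesgue_succ_sigma_finite : sigma_finite setT lebesgue_succ.
Proof.
have /sigma_finiteP[F [TF ndF Foo]] := sigma_finiteT (@lebesgue_measure R).
have /sigma_finiteP[G [TG ndG Goo]] := sigma_finiteT m.
exists (fun k => (@tuncons n) @^-1` (F k `*` G k)).
  apply/esym/seteqP; split => // t _.
  have [i _ Fi] : (\bigcup_k F k) (tuncons t).1 by rewrite -TF.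
  have [j _ Gj] : (\bigcup_k G k) (tuncons t).2 by rewrite -TG.
  exists (maxn i j) => //; split.
  - by move: Fi; exact/subsetPset/ndF/leq_maxl.
  - by move: Gj; exact/subsetPset/ndG/leq_maxr.
move=> k; have [mF Fk] := Foo k; have [mG Gk] := Goo k; split.
  by rewrite -[X in measurable X]setTI; apply: measurable_tuncons => //;
    exact: measurableX.
rewrite /lebesgue_succ /pushforward -comp_preimage.
rewrite (_ : _ \o _ = id) ?preimage_id; last by apply/funext => x; exact: tconsK.
by rewrite product_measure1E// lte_mul_pinfty// ge0_fin_numE.
Qed.

HB.instance Definition _ := Measure_isSigmaFinite.Build _ _ _ lebesgue_succ
  lebesgue_succ_sigma_finite.

End step.

(* Lebesgue measure on the Borel sets of R^n: the n-fold product of the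
   Lebesgue measure of R. *)
Fixpoint borel_lebesgue n :
    {sigma_finite_measure set (n.-tuple (measurableTypeR R)) -> \bar R} :=
  if n is k.+1 then lebesgue_succ (borel_lebesgue k)
  else \d_([tuple] : 0.-tuple (measurableTypeR R)).

End BorelLebesgue.

(* R^n with the sigma-algebra of all Lebesgue measurable sets: the carrier is
   n.-tuple R, and "measurable" means Caratheodory measurable for the outer
   measure induced by borel_lebesgue. *)
Definition Rn (R : realType) n : Type :=
  caratheodory_type ((@borel_lebesgue R n)^*)%mu.

HB.instance Definition _ (R : realType) n := Measurable.on (Rn R n).

Definition lebesgue (R : realType) n : set (Rn R n) -> \bar R :=
  @completed_measure_extension _ _ R (borel_lebesgue n).
Arguments lebesgue {R n}.

HB.instance Definition _ (R : realType) n := Measure.on (@lebesgue R n).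

Section EuclideanSpace.
Context {R : realType} {n : nat}.
Implicit Types (x a : Rn R n) (f : Rn R n -> R).

Definition coord x (i : 'I_n) : R := tnth (x : n.-tuple R) i.

Definition eball x (s : R) : set (Rn R n) :=
  [set y | \sum_(i < n) (coord y i - coord x i) ^+ 2 < s ^+ 2].

(* Open cubes; using closed or half-open ones instead yields the same maximal
   operator below: bounded functions have averages continuous in the cube, and
   the general case follows by truncation. *)
Definition cube a (l : R) : set (Rn R n) :=
  [set y | forall i, coord a i < coord y i < coord a i + l].

Definition average f (Q : set (Rn R n)) : \bar R :=
  ((lebesgue Q)^-1 * \int[lebesgue]_(y in Q) `|(f y)%:E|)%E.

Definition Mloc (rho : R) f x : \bar R :=
  ereal_sup [set v | exists a l,
    [/\ 0 < l, l <= rho, cube a l x & v = average f (cube a l)]].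

Definition Mlocr (rho r : R) f x : \bar R :=
  (Mloc rho (fun y => `|f y| `^ r)%R x `^ r^-1)%E.

Definition Lrloc (r : R) : set (Rn R n -> R) :=
  [set f : Rn R n -> R | measurable_fun setT f /\
    forall x s, 0 < s ->
      (\int[lebesgue]_(y in eball x s) (`|f y| `^ r)%R%:E < +oo)%E].

End EuclideanSpace.

(* A space of functions on R^n together with a functional on it, without any
   axiom. Functions are genuine functions here; identification up to a.e.
   equality is part of the axioms of ball_quasi_banach. *)
Record fspace (R : realType) (n : nat) := FSpace {
  fmem :> (Rn R n -> R) -> Prop ;
  fnorm : (Rn R n -> R) -> R }.

Section FunctionSpaces.
Context {R : realType} {n : nat}.
Implicit Types (Y X Z : fspace R n) (f g h : Rn R n -> R)
  (F : Rn R n -> \bar R).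

(* The (quasi-)norm of an extended-valued function F: the norm of the elements
   of Z equal to F a.e., and +oo (the infimum of the empty set) if there are
   none. Thus F belongs to Z, up to a.e. equality, iff xnorm Z F < +oo. *)
Definition xnorm Z F : \bar R :=
  ereal_inf [set (fnorm Z f)%:E | f in
    [set f | Z f /\ {ae lebesgue, forall x, F x = (f x)%:E}]].

Record ball_quasi_banach Y : Prop := {
  bqb_measurable : forall f, Y f -> measurable_fun setT f ;
  bqb_zero : Y (cst 0) ;
  bqb_add : forall f g, Y f -> Y g -> Y (f \+ g) ;
  bqb_scale : forall (c : R) f, Y f -> Y (fun x => c * f x) ;
  bqb_norm_ge0 : forall f, Y f -> 0 <= fnorm Y f ;
  bqb_norm_eq0 : forall f, Y f ->
    (fnorm Y f = 0 <-> {ae lebesgue, forall x, f x = 0}) ;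
  bqb_normZ : forall (c : R) f, Y f ->
    fnorm Y (fun x => c * f x) = `|c| * fnorm Y f ;
  bqb_quasi_triangle : exists K : R, forall f g, Y f -> Y g ->
    fnorm Y (f \+ g) <= K * (fnorm Y f + fnorm Y g) ;
  bqb_complete : forall f_ : nat -> Rn R n -> R, (forall k, Y (f_ k)) ->
    (forall e : R, 0 < e -> exists k0 : nat, forall k l : nat,
      (k0 <= k)%N -> (k0 <= l)%N -> fnorm Y (f_ k \- f_ l) < e) ->
    exists2 f, Y f & forall e : R, 0 < e -> exists k0 : nat, forall k : nat,
      (k0 <= k)%N -> fnorm Y (f_ k \- f) < e ;
  bqb_lattice : forall f g, Y f -> measurable_fun setT g ->
    {ae lebesgue, forall x, `|g x| <= `|f x|} ->
    Y g /\ fnorm Y g <= fnorm Y f ;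
  (* The right-hand side being finite, the conclusion entails that F is in Y. *)
  bqb_fatou : forall (f_ : nat -> Rn R n -> R) F, (forall k, Y (f_ k)) ->
    {ae lebesgue, forall x,
      [/\ forall k, 0 <= f_ k x, forall k, f_ k x <= f_ k.+1 x
        & (fun k => (f_ k x)%:E) @ \oo --> F x]} ->
    (ereal_sup (range (fun k => (fnorm Y (f_ k))%:E)) < +oo)%E ->
    xnorm Y F = ereal_sup (range (fun k => (fnorm Y (f_ k))%:E)) ;
  bqb_ball : forall (x : Rn R n) (s : R), 0 < s -> Y \1_(eball x s) }.

Definition rconvex1 Y (r : R) : Prop := forall f g, Y f -> Y g ->
  (xnorm Y (fun x => ((`|f x| `^ r + `|g x| `^ r) `^ r^-1)%R%:E) <=
   ((fnorm Y f `^ r + fnorm Y g `^ r) `^ r^-1)%R%:E)%E.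

Definition fpow Y (r : R) : fspace R n := FSpace
  [set h : Rn R n -> R | measurable_fun setT h /\ Y (fun x => `|h x| `^ r^-1)]
  (fun h => fnorm Y (fun x => `|h x| `^ r^-1) `^ r).

Definition kothe_norm X g : \bar R :=
  ereal_sup [set (\int[lebesgue]_x `|(f x * g x)%:E|)%E | f in
    [set f | X f /\ fnorm X f <= 1]].

Definition kothe X : fspace R n := FSpace
  [set g : Rn R n -> R | measurable_fun setT g /\ (kothe_norm X g < +oo)%E]
  (fun g => fine (kothe_norm X g)).

Definition bounded_on Z (T : (Rn R n -> R) -> Rn R n -> \bar R) : Prop :=
  exists C : R, forall f, Z f -> (xnorm Z (T f) <= (C * fnorm Z f)%:E)%E.

Definition lq_sum (q : R) N (F : 'I_N -> Rn R n -> \bar R) (x : Rn R n) :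
  \bar R := ((\sum_(j < N) F j x `^ q) `^ q^-1)%E.

Definition lq_series (q : R) (F : nat -> Rn R n -> \bar R) (x : Rn R n) :
  \bar R := ((\sum_(0 <= j <oo) F j x `^ q) `^ q^-1)%E.

(* For nonnegative F; the value is 0 when N = 0. *)
Definition fin_max N (F : 'I_N -> Rn R n -> \bar R) (x : Rn R n) : \bar R :=
  \big[maxe/0%E]_(j < N) F j x.

Definition seq_sup (F : nat -> Rn R n -> \bar R) (x : Rn R n) : \bar R :=
  ereal_sup (range (fun j => F j x)).

Definition eabs f (x : Rn R n) : \bar R := `|(f x)%:E|%E.

Definition vv_ineq Y (rho r q C : R) : Prop :=
  forall (N : nat) (f : 'I_N -> Rn R n -> R), (forall j, Lrloc r (f j)) ->
  (xnorm Y (lq_sum q (fun j => eabs (f j))) < +oo)%E ->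
  (xnorm Y (lq_sum q (fun j => Mlocr rho r (f j))) <=
     C%:E * xnorm Y (lq_sum q (fun j => eabs (f j))))%E.

Definition vv_ineq_pow X (rho s C : R) : Prop :=
  forall (N : nat) (h : 'I_N -> Rn R n -> R),
  (forall j, measurable_fun setT (h j)) ->
  (xnorm X (lq_sum s (fun j => eabs (h j))) < +oo)%E ->
  (xnorm X (lq_sum s (fun j => Mloc rho (h j))) <=
     C%:E * xnorm X (lq_sum s (fun j => eabs (h j))))%E.

Definition vv_ineq_seq Y (rho r q C : R) : Prop :=
  forall f : nat -> Rn R n -> R, (forall j, measurable_fun setT (f j)) ->
  (xnorm Y (lq_series q (fun j => eabs (f j))) < +oo)%E ->
  (xnorm Y (lq_series q (fun j => Mlocr rho r (f j))) <=
     C%:E * xnorm Y (lq_series q (fun j => eabs (f j))))%E.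

Definition scalar_ineq Y (rho r C : R) : Prop :=
  forall f, Y f -> (xnorm Y (Mlocr rho r f) <= (C * fnorm Y f)%:E)%E.

Definition max_ineq Y (rho r C : R) : Prop :=
  forall (N : nat) (f : 'I_N -> Rn R n -> R),
  (forall j, measurable_fun setT (f j)) ->
  (xnorm Y (fin_max (fun j => eabs (f j))) < +oo)%E ->
  (xnorm Y (fin_max (fun j => Mlocr rho r (f j))) <=
     C%:E * xnorm Y (fin_max (fun j => eabs (f j))))%E.

Definition sup_ineq Y (rho r C : R) : Prop :=
  forall f : nat -> Rn R n -> R, (forall j, measurable_fun setT (f j)) ->
  (xnorm Y (seq_sup (fun j => eabs (f j))) < +oo)%E ->
  (xnorm Y (seq_sup (fun j => Mlocr rho r (f j))) <=
     C%:E * xnorm Y (seq_sup (fun j => eabs (f j))))%E.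

End FunctionSpaces.

(* Main.v *)
(* With X = Y^r, s = q / r and h = |f|^r, the inequality for Y is the bound of
   the local maximal operator M on X(l^s); q > r means s > 1.

   From M bounded on X and X' to the vector-valued bound: a Rubio de Francia
   iteration dominates F = |(h_j)|_s by w0 in X and a dual function v by w1 in
   X', with M w0 <= A w0 and M w1 <= A w1. For such weights every dyadic maximal
   operator satisfies int (M h)^s w0^(1-s) w1 <= K int |h|^s w0^(1-s) w1 when
   |h| <= w0, by a Schur test on the strata between stopping times, where the
   weights decay geometrically. Summing over j and Young's inequality give
   int |(M h_j)|_s v <= K' |F|_X |v|_X', and the Lorentz-Luxemburg theorem
   concludes. The latter is proved by projecting, in L^2, a bounded function of
   bounded support onto the part below it of a ball of X.

   Back from the vector-valued bound, for one s > 1, to M bounded on X': let g_k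
   be the averages, over the stopping cells of level k of h, of f cut to the
   stratum k. Then int f M h <= C int h sum_k g_k, and half of each stopping cell
   lies in its stratum, so that the l^s bound applied to the g_k, cut to the
   strata of depth between mL and (m+1)L, makes the functions
   (sum_k g_k^s 1_{depth >= k + mL})^(1/s) decay geometrically in m in X; hence
   |sum_k g_k|_X <= K |f|_X.

   M is compared with finitely many dyadic operators by the one-third trick, and
   the scale rho is immaterial since M_(3 rho / 2) f <= 4^n M_rho (M_rho f).

   For q <= r the slabs E_j = {j rho / m <= x_1 < (j + 1) rho / m} have
   M 1_{E_j} >= 1 / (i - j + 1) on E_i, i > j, and the harmonic series diverges. *)

From mathcomp Require Import all_boot all_order all_algebra.
From mathcomp Require Import all_classical all_reals all_analysis.
From mathcomp Require Import lra ring zify measurable_realfun.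
Require Import Defs.

Set Implicit Arguments.
Unset Strict Implicit.
Unset Printing Implicit Defensive.
Import Order.TTheory GRing.Theory Num.Theory.
Import numFieldNormedType.Exports.

Local Open Scope classical_set_scope.
Local Open Scope ring_scope.

(** Two mechanisms decide the argument. In the dual bound each use of the vector-valued inequality
    costs a constant C. Spreading every g_k over L consecutive strata makes it reappear L times in
    the l^s norm, which gains L^(1/s), so a large L beats C. There is no such gain for s = infinity,
    where the inequality says no more than the scalar bound. In the weighted bound, w0^(1-s) w1 is
    the A_s weight built from two A_1 weights. One pair serves all the h_j at once, and this is what
    turns a scalar estimate into a vector-valued one. A Schur test with constants would count a
    point of depth n once for each level up to n; so w0 is first multiplied by b^depth, with b > 1
    so close to 1 that the decay of w0 along the strata still wins. The constants agree in the
    statements for families, sequences and powers because these are linked by a cycle of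
    implications that keep C: truncation leads from locally integrable families to arbitrary
    sequences, and these contain the finite families of the power space. *)

Lemma eq_ler (R : realDomainType) (x y : R) : x = y -> x <= y.
Proof. by move->. Qed.

(** * Integrals of nonnegative functions *)

Section IntegralFacts.
Context d (T : measurableType d) (R : realType) (mu : {measure set T -> \bar R}).
Implicit Types (A B : set T) (f g : T -> R).

(** The integral of a nonnegative function is a supremum over the simple functions below it, so
    monotonicity holds for arbitrary functions, measurable or not. *)
Lemma le_integral_ge0 A (f g : T -> \bar R) :
  (forall x, A x -> 0 <= f x)%E -> (forall x, A x -> f x <= g x)%E ->
  (\int[mu]_(x in A) f x <= \int[mu]_(x in A) g x)%E.
Proof.
move=> f0 fg; rewrite ge0_integralE// ge0_integralE; last first.
  by move=> x Ax; exact: le_trans (f0 _ Ax) (fg _ Ax).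
apply: le_ereal_sup => _ [h /= hf <-]; exists h => //= x.
apply: le_trans (hf x) _; rewrite /patch; case: ifPn => // /set_mem Ax.
exact: fg.
Qed.

Lemma integral_restr A (f : T -> R) :
  (\int[mu]_(x in A) (f x)%:E = \int[mu]_x (f x * \1_A x)%:E)%E.
Proof.
rewrite integral_mkcond; apply: eq_integral => x _.
rewrite /patch indicE; case: ifPn => [xA|xA]; first by rewrite mulr1.
by rewrite mulr0.
Qed.

Lemma integral_restr2 A B (f : T -> R) :
  (\int[mu]_(x in A) (f x * \1_B x)%:E = \int[mu]_(x in A `&` B) (f x)%:E)%E.
Proof.
rewrite integral_mkcond [RHS]integral_mkcond; apply: eq_integral => x _.
rewrite /patch in_setI; case: ifPn => //= xA; rewrite indicE.
by case: ifPn => xB; rewrite ?mulr1 ?mulr0.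
Qed.

Lemma le_integral_sub A B (f : T -> \bar R) :
  (forall x, 0 <= f x)%E -> A `<=` B ->
  (\int[mu]_(x in A) f x <= \int[mu]_(x in B) f x)%E.
Proof.
move=> f0 AB; rewrite integral_mkcond [leRHS]integral_mkcond.
apply: le_integral_ge0 => x _; rewrite /patch; first by case: ifPn.
case: ifPn => xA; last by case: ifPn.
by rewrite ifT//; apply/mem_set/AB/set_mem.
Qed.

Lemma measurable_funT_indic A : measurable A -> measurable_fun setT (\1_A : T -> R).
Proof. by move=> mA; exact: measurable_indic. Qed.

Lemma measurable_EFinT f : measurable_fun setT f -> measurable_fun setT (EFin \o f).
Proof. by move=> mf; exact/measurable_EFinP. Qed.

Lemma integralZ A (c : R) f : measurable A -> 0 <= c -> (forall x, 0 <= f x) ->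
  measurable_fun setT f ->
  (\int[mu]_(x in A) (c * f x)%:E = c%:E * \int[mu]_(x in A) (f x)%:E)%E.
Proof.
move=> mA c0 f0 mf; under eq_integral do rewrite EFinM.
rewrite ge0_integralZl_EFin//; first by move=> x _; rewrite lee_fin.
by apply: measurable_funTS; exact: measurable_EFinT.
Qed.

Lemma measurable_absT f : measurable_fun setT f -> measurable_fun setT (fun x => `|f x|).
Proof. by move=> mf; exact: measurableT_comp. Qed.

Lemma measurable_powT (p : R) f : measurable_fun setT f ->
  measurable_fun setT (fun x => f x `^ p).
Proof. by move=> mf; exact: (measurableT_comp (measurable_powR _)). Qed.

Lemma measurable_mulT f g : measurable_fun setT f -> measurable_fun setT g ->
  measurable_fun setT (fun x => f x * g x).
Proof. by move=> mf mg; exact: measurable_funM. Qed.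

Lemma measurable_addT f g : measurable_fun setT f -> measurable_fun setT g ->
  measurable_fun setT (fun x => f x + g x).
Proof. by move=> mf mg; exact: measurable_funD. Qed.

Lemma measurable_subT f g : measurable_fun setT f -> measurable_fun setT g ->
  measurable_fun setT (fun x => f x - g x).
Proof. by move=> mf mg; exact: measurable_funB. Qed.

Lemma measurable_minT f g : measurable_fun setT f -> measurable_fun setT g ->
  measurable_fun setT (fun x => Num.min (f x) (g x)).
Proof. by move=> mf mg; exact: measurable_minr. Qed.

Lemma measurable_scaleT (c : R) f : measurable_fun setT f ->
  measurable_fun setT (fun x => c * f x).
Proof. by move=> mf; exact: measurable_funM. Qed.

Lemma measurable_sumT (J : finType) (f : J -> T -> R) :
  (forall j, measurable_fun setT (f j)) -> measurable_fun setT (fun x => \sum_j f j x).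
Proof. by move=> mf; exact: measurable_sum. Qed.

Lemma measurable_restrT A f : measurable A -> measurable_fun setT f ->
  measurable_fun setT (fun x => f x * \1_A x).
Proof. by move=> mA mf; apply: measurable_funM => //; exact: measurable_funT_indic. Qed.

Lemma le_integral_ae A f g : measurable A -> measurable_fun setT f -> measurable_fun setT g ->
  (forall x, 0 <= f x) -> (forall x, 0 <= g x) -> {ae mu, forall x, f x <= g x} ->
  (\int[mu]_(x in A) (f x)%:E <= \int[mu]_(x in A) (g x)%:E)%E.
Proof.
move=> mA mf mg f0 g0 fg; apply: ae_ge0_le_integral => //.
- by move=> x _; rewrite lee_fin.
- by apply: measurable_funTS; exact: measurable_EFinT.
- by move=> x _; rewrite lee_fin.
- by apply: measurable_funTS; exact: measurable_EFinT.
by apply: filterS fg => x; rewrite lee_fin.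
Qed.

Lemma le_integral_ae_series A f (g : nat -> T -> R) : measurable A ->
  measurable_fun setT f -> (forall k, measurable_fun setT (g k)) ->
  (forall x, 0 <= f x) -> (forall k x, 0 <= g k x) ->
  {ae mu, forall x, (f x)%:E <= \sum_(0 <= k <oo) (g k x)%:E}%E ->
  (\int[mu]_(x in A) (f x)%:E <= \sum_(0 <= k <oo) \int[mu]_(x in A) (g k x)%:E)%E.
Proof.
move=> mA mf mg f0 g0 fg; rewrite -integral_nneseries//.
- apply: ae_ge0_le_integral => //.
  + by move=> x _; rewrite lee_fin.
  + by apply: measurable_funTS; exact: measurable_EFinT.
  + by move=> x _; apply: nneseries_ge0 => k _ _; rewrite lee_fin.
  + apply: ge0_emeasurable_sum => k; first by move=> x _ _; rewrite lee_fin.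
    by move=> _; apply: measurable_funTS; exact: measurable_EFinT.
  + by apply: filterS fg.
- by move=> k; apply: measurable_funTS; exact: measurable_EFinT.
- by move=> k x _; rewrite lee_fin.
Qed.

Lemma integral_sumT (J : finType) A (f : J -> T -> R) : measurable A ->
  (forall j, measurable_fun setT (f j)) -> (forall j x, 0 <= f j x) ->
  (\int[mu]_(x in A) (\sum_j f j x)%:E = \sum_j \int[mu]_(x in A) (f j x)%:E)%E.
Proof.
move=> mA mf f0; rewrite -ge0_integral_sum//.
- by apply: eq_integral => x _; rewrite sumEFin.
- by move=> j; apply: measurable_funTS; exact: measurable_EFinT.
- by move=> j x _; rewrite lee_fin.
Qed.

Lemma integral_addT A f g : measurable A -> measurable_fun setT f -> measurable_fun setT g ->
  (forall x, 0 <= f x) -> (forall x, 0 <= g x) ->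
  (\int[mu]_(x in A) (f x + g x)%:E =
   \int[mu]_(x in A) (f x)%:E + \int[mu]_(x in A) (g x)%:E)%E.
Proof.
move=> mA mf mg f0 g0; rewrite -ge0_integralD//.
- by move=> x _; rewrite lee_fin.
- by apply: measurable_funTS; exact: measurable_EFinT.
- by move=> x _; rewrite lee_fin.
- by apply: measurable_funTS; exact: measurable_EFinT.
Qed.

Lemma emeasurable_ray (f : T -> \bar R) :
  (forall r, measurable [set x | r%:E < f x]%E) -> measurable_fun setT f.
Proof.
move=> H; apply: (measurability _ (ErealGenOInfty.measurableE R)).
move=> _ [_ [r ->] <-]; rewrite setTI (_ : _ @^-1` _ = [set x | r%:E < f x]%E)//.
by apply/seteqP; split=> x /=; rewrite in_itv /= andbT.
Qed.

Lemma measurable_discrete (nu : T -> nat) (phi : nat -> R) :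
  (forall k, measurable [set x | nu x = k]) -> measurable_fun setT (phi \o nu).
Proof.
move=> mnu _ Y mY; rewrite setTI.
rewrite (_ : _ @^-1` _ = \bigcup_(k in phi @^-1` Y) [set x | nu x = k]).
  by apply: bigcup_measurable => k _; exact: mnu.
apply/seteqP; split=> [x Yx|x [k Yk /= ->]//]; by exists (nu x).
Qed.

End IntegralFacts.

(** * Dyadic filtrations and averages over stopping cells *)

Section Dyadic.
Context d (T : measurableType d) (R : realType) (mu : {measure set T -> \bar R}).
Context (I : countType) (pi : nat -> T -> I).
Implicit Types (f g u v w : T -> R) (x y : T) (tau : T -> option nat).

Definition cell k x : set T := [set y | pi k y = pi k x].

(** Cells are fibres of [pi k] with labels in a countable type, so any union of cells is measurable.
    [D] bounds the jump of an average from a cell to its child. *)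
Record filtration (D : R) : Prop := {
  cell_measurable : forall k x, measurable (cell k x);
  cell_gt0 : forall k x, (0 < mu (cell k x))%E;
  cell_lty : forall k x, (mu (cell k x) < +oo)%E;
  cell_refine : forall k x y, pi k.+1 y = pi k.+1 x -> pi k y = pi k x;
  filtration_ge1 : 1 <= D;
  cell_ratio : forall k x, (mu (cell k x) <= D%:E * mu (cell k.+1 x))%E }.

(** Finiteness on the coarsest cells is enough, since they contain all the finer ones. *)
Definition locint f := [/\ measurable_fun setT f, forall x, 0 <= f x &
  forall x, (\int[mu]_(y in cell 0 x) (f y)%:E < +oo)%E].

Definition mass k x : R := fine (mu (cell k x)).

Definition avg k f x : R := fine (\int[mu]_(y in cell k x) (f y)%:E) / mass k x.

(** Whether to stop at level m is decided by the cell of level m alone; [None] means that the point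
    is never stopped. *)
Definition stopping tau := forall x y m,
  tau x = Some m -> pi m y = pi m x -> tau y = Some m.

Definition stopdom tau : set T := [set x | tau x <> None].

Definition stopped tau f x : R := if tau x is Some m then avg m f x else 0.

Context (D : R) (hpi : filtration D).

Let mcell := cell_measurable hpi.
Let D1 := filtration_ge1 hpi.

Lemma cell_refl k x : cell k x x. Proof. by []. Qed.

Lemma cell_le k m x y : (k <= m)%N -> pi m y = pi m x -> pi k y = pi k x.
Proof.
elim: m => [|m ih]; first by rewrite leqn0 => /eqP ->.
rewrite leq_eqVlt => /orP[/eqP -> //|km] /(cell_refine hpi); exact: ih.
Qed.

Lemma cell_sub k m x : (k <= m)%N -> cell m x `<=` cell k x.
Proof. by move=> km y; exact: cell_le. Qed.

Lemma cell_eq k x y : cell k x y -> cell k y = cell k x.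
Proof. by rewrite /cell /= => ->. Qed.

Lemma avg_cell k f x y : cell k x y -> avg k f y = avg k f x.
Proof. by move=> xy; rewrite /avg /mass (cell_eq xy). Qed.

Lemma mass_gt0 k x : 0 < mass k x.
Proof. by rewrite fine_gt0// (cell_gt0 hpi) (cell_lty hpi). Qed.

Lemma massE k x : mu (cell k x) = (mass k x)%:E.
Proof.
rewrite /mass fineK// fin_numE; apply/andP; split.
  by rewrite gt_eqF// (lt_trans _ (cell_gt0 hpi k x)).
by rewrite lt_eqF// (cell_lty hpi).
Qed.

Lemma mass_ratio k x : mass k x <= D * mass k.+1 x.
Proof. by rewrite -lee_fin EFinM -!massE; exact: (cell_ratio hpi). Qed.

Lemma locint_fin k f x : locint f ->
  (\int[mu]_(y in cell k x) (f y)%:E)%E \is a fin_num.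
Proof.
move=> [mf f0 fi]; rewrite ge0_fin_numE.
  by apply: le_lt_trans (fi x); apply: le_integral_sub;
    [move=> y; rewrite lee_fin|exact: cell_sub].
by apply: integral_ge0 => y _; rewrite lee_fin.
Qed.

Lemma avg_mass k f x :
  avg k f x * mass k x = fine (\int[mu]_(y in cell k x) (f y)%:E)%E.
Proof. by rewrite /avg divfK// gt_eqF// mass_gt0. Qed.

Lemma avgE k f x : locint f ->
  (\int[mu]_(y in cell k x) (f y)%:E = (avg k f x * mass k x)%:E)%E.
Proof.
by move=> lf; rewrite /avg divfK ?gt_eqF ?mass_gt0// fineK//; exact: locint_fin.
Qed.

Lemma avg_ge0 k f x : (forall y, 0 <= f y) -> 0 <= avg k f x.
Proof.
move=> f0; rewrite /avg divr_ge0 ?(ltW (mass_gt0 _ _))// fine_ge0//.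
by apply: integral_ge0 => y _; rewrite lee_fin.
Qed.

Lemma locint_le f g : measurable_fun setT f -> (forall x, 0 <= f x) ->
  (forall x, f x <= g x) -> locint g -> locint f.
Proof.
move=> mf f0 fg [mg g0 gi]; split => // x; apply: le_lt_trans (gi x).
by apply: le_integral_ge0 => y _; rewrite lee_fin.
Qed.

Lemma locint_indic f A : measurable A -> locint f -> locint (fun x => f x * \1_A x).
Proof.
move=> mA lf; have [mf f0 fi] := lf; apply: locint_le lf.
- by apply: measurable_funM => //; exact: measurable_funT_indic.
- by move=> x; rewrite mulr_ge0.
- by move=> x; rewrite indicE ler_piMr// lern1 leq_b1.
Qed.

Lemma avg_le k f g x : locint f -> locint g -> (forall y, cell k x y -> f y <= g y) ->
  avg k f x <= avg k g x.
Proof.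
move=> lf lg fg; rewrite -(ler_pM2r (mass_gt0 k x)) -lee_fin -!avgE//.
apply: le_integral_ge0 => y; first by case: lf => _ f0 _; rewrite lee_fin.
by move=> /fg; rewrite lee_fin.
Qed.

Lemma avg_ratio k f x : locint f -> avg k.+1 f x <= D * avg k f x.
Proof.
move=> lf; have f0 : forall y, 0 <= f y by case: lf.
rewrite -(ler_pM2r (mass_gt0 k.+1 x)).
apply: (@le_trans _ _ (avg k f x * mass k x)).
  rewrite -lee_fin -!avgE//; apply: le_integral_sub; last exact: cell_sub.
  by move=> y; rewrite lee_fin.
rewrite (_ : D * avg k f x * mass k.+1 x = avg k f x * (D * mass k.+1 x)); last by ring.
by apply: ler_wpM2l; [exact: avg_ge0|exact: mass_ratio].
Qed.

(** The set is the union of the cells that it contains, and there are countably many cells. *)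
Lemma dyadic_measurable A :
  (forall x, A x -> exists m, cell m x `<=` A) -> measurable A.
Proof.
move=> hA; pose B (p : nat * I) := [set x | pi p.1 x = p.2 /\ cell p.1 x `<=` A].
rewrite (_ : A = \bigcup_p B p); last first.
  apply/seteqP; split=> [x /hA[m xm]|x [[m i] _ [/= _]]]; last exact.
  by exists (m, pi m x).
apply: countable_bigcupT_measurable => // p.
have [[x [xp Bx]]|/forallNP nB] := pselect (exists x, B p x).
  rewrite (_ : B p = cell p.1 x); first exact: mcell.
  apply/seteqP; split=> [y [yp _]|y yp]; first by rewrite /cell /= yp.
  by split; [rewrite -xp|rewrite (cell_eq yp)].
by rewrite (_ : B p = set0)//; apply/seteqP; split=> // y /nB.
Qed.

Lemma stopdom_measurable tau : stopping tau -> measurable (stopdom tau).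
Proof.
move=> st; apply: dyadic_measurable => x; rewrite /stopdom/=.
case E : (tau x) => [m|]// _; exists m => y xy /=.
by rewrite (st _ _ _ E xy).
Qed.

(** A preimage is a union of stopping cells, together with the complement of the domain when the
    target contains 0. *)
Lemma stopping_measurable_fun tau g : stopping tau ->
  (forall x y m, tau x = Some m -> cell m x y -> g y = g x) ->
  (forall x, tau x = None -> g x = 0) -> measurable_fun setT g.
Proof.
move=> st gc g0 _ Y mY; rewrite setTI.
have m1 : measurable (g @^-1` Y `&` stopdom tau).
  apply: dyadic_measurable => x [Yx]; rewrite /stopdom/=.
  case E : (tau x) => [m|]// _; exists m => y xy /=.
  by rewrite /preimage /= (gc _ _ _ E xy) (st _ _ _ E xy).
have m2 := stopdom_measurable st.
rewrite -(setUIDK (g @^-1` Y) (stopdom tau)) setIC.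
apply: measurableU; first by rewrite setIC.
have [Y0|Y0] := pselect (Y 0).
  rewrite (_ : _ `\` _ = ~` stopdom tau); first exact: measurableC.
  apply/seteqP; split=> [x []//|x sx]; split=> //.
  by rewrite /preimage/= g0//; apply: contrapT.
rewrite (_ : _ `\` _ = set0)//; apply/seteqP; split=> // x [Yx sx].
by apply: Y0; rewrite -(g0 x)//; apply: contrapT.
Qed.

Lemma stopped_measurable tau f : stopping tau -> measurable_fun setT (stopped tau f).
Proof.
move=> st; apply: (stopping_measurable_fun st) => [x y m E xy|x E].
  by rewrite /stopped (st _ _ _ E xy) E; exact: avg_cell.
by rewrite /stopped E.
Qed.

(** The domain of [tau] is a countable disjoint union of stopping cells, so a comparison on each of
    them sums up. *)
Lemma stopping_le_integral tau B (f g : T -> R) : stopping tau -> measurable B ->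
  measurable_fun setT f -> measurable_fun setT g ->
  (forall x, 0 <= f x) -> (forall x, 0 <= g x) ->
  (forall x m, B x -> tau x = Some m ->
    \int[mu]_(y in cell m x `&` B) (f y)%:E <= \int[mu]_(y in cell m x `&` B) (g y)%:E)%E ->
  (\int[mu]_(y in stopdom tau `&` B) (f y)%:E <= \int[mu]_(y in stopdom tau `&` B) (g y)%:E)%E.
Proof.
move=> st mB mf mg f0 g0 fg.
(* Code of the stopping cell of x; 0 is reserved for the points that are never stopped, hence the
   successor. *)
pose lab x := if tau x is Some m then (pickle (m, pi m x)).+1 else 0%N.
pose F k := [set x | B x /\ lab x = k.+1].
have FE x m : B x -> tau x = Some m -> F (pickle (m, pi m x)) = cell m x `&` B.
  move=> Bx xm; apply/seteqP; split=> [y|y [xy By]]; last first.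
    by split=> //; rewrite /lab (st _ _ _ xm xy) xy.
  move=> [By]; rewrite /lab; case E : (tau y) => [m'|//] [].
  by move/(pcan_inj pickleK) => [em ep]; subst m'.
have mF k : measurable (F k).
  have [[x [Bx]]|/forallNP nF] := pselect (exists x, F k x).
    rewrite /lab; case E : (tau x) => [m|//] [<-].
    by rewrite FE//; apply: measurableI.
  by rewrite (_ : F k = set0)//; apply/seteqP; split=> // y /nF.
have UF : stopdom tau `&` B = \bigcup_k F k.
  apply/seteqP; split=> [x []|x [k _ [Bx]]].
    rewrite /stopdom /=; case E : (tau x) => [m|//] _ Bx.
    by exists (pickle (m, pi m x)) => //; split=> //; rewrite /lab E.
  by rewrite /lab /stopdom /=; case E : (tau x) => [m|//].
have tF : trivIset setT F.
  apply/trivIsetP => i j _ _ ij; apply/seteqP; split=> // x [[_ xi] [_ xj]].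
  by move: ij; rewrite -eqSS -xi -xj eqxx.
rewrite UF !ge0_integral_bigcup//; first last.
- by move=> x _; rewrite lee_fin.
- by apply: measurable_funTS; exact: measurable_EFinT.
- by move=> x _; rewrite lee_fin.
- by apply: measurable_funTS; exact: measurable_EFinT.
apply: lee_nneseries => [k _ _|k _]; first by apply: integral_ge0 => y _; rewrite lee_fin.
have [[x [Bx]]|/forallNP nF] := pselect (exists x, F k x).
  rewrite /lab; case E : (tau x) => [m|//] [<-].
  by rewrite !FE//; exact: fg.
rewrite (_ : F k = set0) ?integral_set0//.
by apply/seteqP; split=> // y /nF.
Qed.

Lemma stopped_ge0 tau f x : (forall y, 0 <= f y) -> 0 <= stopped tau f x.
Proof. by move=> f0; rewrite /stopped; case: (tau x) => // m; exact: avg_ge0. Qed.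

(** On a stopping cell both integrals equal the product of the two averages and the mass. Exchanging
    u and v gives the converse inequality. *)
Lemma stopped_selfadjoint_le tau u v : stopping tau -> locint u -> locint v ->
  (\int[mu]_y (u y * stopped tau v y)%:E <= \int[mu]_y (stopped tau u y * v y)%:E)%E.
Proof.
move=> st lu lv; have [mu_ u0 _] := lu; have [mv v0 _] := lv.
have S0 := stopped_ge0 tau _ u0; have S1 := stopped_ge0 tau _ v0.
have mS w : measurable_fun setT (stopped tau w) by exact: stopped_measurable.
have dom f g : (\int[mu]_y (f y * stopped tau g y)%:E =
    \int[mu]_(y in stopdom tau `&` setT) (f y * stopped tau g y)%:E)%E.
  rewrite setIT [RHS]integral_mkcond; apply: eq_integral => x _.
  rewrite /patch; case: ifPn => // /negP xs; rewrite /stopped.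
  by case E : (tau x) => [m|]; [exfalso; apply: xs; rewrite inE /stopdom/= E|rewrite mulr0].
rewrite dom; under [leRHS]eq_integral do rewrite mulrC; rewrite dom.
apply: stopping_le_integral; first exact: st.
- exact: measurableT.
- exact: measurable_funM.
- exact: measurable_funM.
- by move=> x; rewrite mulr_ge0.
- by move=> x; rewrite mulr_ge0.
move=> x m _ xm; rewrite setIT.
have aux f g : locint f -> locint g -> (\int[mu]_(y in cell m x) (f y * stopped tau g y)%:E =
    (avg m f x * mass m x * avg m g x)%:E)%E.
  move=> lf lg; have [mf f0 _] := lf; have [mg g0 _] := lg.
  transitivity (\int[mu]_(y in cell m x) (avg m g x * f y)%:E)%E.
    apply: eq_integral => y; rewrite inE => xy.
    by rewrite mulrC /stopped (st _ _ _ xm xy) (avg_cell _ xy).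
  by rewrite integralZ ?avg_ge0// avgE// -EFinM mulrC.
rewrite (aux u v)// (aux v u)// lee_fin le_eqVlt; apply/orP; left.
by apply/eqP; ring.
Qed.

Lemma locint1 : locint (fun=> 1).
Proof.
split=> // x; rewrite (_ : (\int[mu]_(y in cell 0 x) 1%:E)%E = mu (cell 0 x)).
  exact: (cell_lty hpi).
by rewrite integral_cst// mul1e.
Qed.

Lemma avg1 k x : avg k (fun=> 1) x = 1.
Proof.
apply: (mulIf (lt0r_neq0 (mass_gt0 k x))); rewrite mul1r avg_mass.
by rewrite (_ : (\int[mu]_(y in cell k x) 1%:E)%E = mu (cell k x))// integral_cst// mul1e.
Qed.

(** Duality with the indicator [e] of a coarsest cell: the stopped averages of [e] are at most 1 and
    vanish off that cell, since every stopping cell lies in a single coarsest one. *)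
Lemma stopped_locint tau f : stopping tau -> locint f -> locint (stopped tau f).
Proof.
move=> st lf; have [mf f0 fi] := lf; split; first exact: stopped_measurable.
  by move=> x; exact: stopped_ge0.
move=> x; pose e y : R := 1 * \1_(cell 0 x) y.
have le : locint e by apply: locint_indic; [exact: mcell|exact: locint1].
have e0 y : 0 <= e y by case: le.
apply: (@le_lt_trans _ _ (\int[mu]_y (e y * stopped tau f y)%:E)%E).
  rewrite integral_mkcond; apply: le_integral_ge0 => y _.
    by rewrite /patch; case: ifP => // _; rewrite lee_fin stopped_ge0.
  rewrite /patch /e; case: ifPn => xy; first by rewrite indicE xy !mul1r.
  by rewrite lee_fin mulr_ge0// stopped_ge0.
apply: (le_lt_trans (stopped_selfadjoint_le st le lf)).
apply: le_lt_trans (fi x); rewrite [leRHS]integral_mkcond.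
apply: le_integral_ge0 => y _; first by rewrite lee_fin mulr_ge0// stopped_ge0.
have s1 : stopped tau e y <= 1.
  rewrite /stopped; case: (tau y) => [m|]//.
  apply: (@le_trans _ _ (avg m (fun=> 1) y)).
    apply: avg_le => //; first exact: locint1.
    by move=> z _; rewrite /e mul1r indicE lern1 leq_b1.
  by rewrite avg1.
rewrite /patch; case: ifPn => [xy|/negP xy].
  by rewrite lee_fin ler_piMl.
have -> : stopped tau e y = 0; last by rewrite mul0r.
rewrite /stopped; case: (tau y) => [m|]//.
apply: (mulIf (lt0r_neq0 (mass_gt0 m y))); rewrite mul0r avg_mass integral0_eq// => z yz.
rewrite /e mul1r indicE memNset// => xz; apply: xy; rewrite inE /cell /=.
by rewrite -(cell_le (leq0n m) yz).
Qed.

End Dyadic.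

Opaque avg mass.

(** * Stopping times *)

Section Tower.
Context d (T : measurableType d) (R : realType) (mu : {measure set T -> \bar R}).
Context (I : countType) (pi : nat -> T -> I) (D : R).
Implicit Types (f g h : T -> R) (x y : T).
Local Notation avg := (avg mu pi).
Local Notation mass := (mass mu pi).
Local Notation cell := (cell pi).

(* Nested stopping times whose domains at least halve, in measure, inside each
   stopping cell. *)
Record tower (tau : nat -> T -> option nat) : Prop := {
  tower_stopping : forall k, stopping pi (tau k);
  tower_nested : forall k x m, tau k.+1 x = Some m ->
    exists2 j, (j <= m)%N & tau k x = Some j;
  tower_half : forall k x m, tau k x = Some m ->
    (mu (cell m x `&` stopdom (tau k.+1)) <= (2^-1 * mass m x)%:E)%E }.

Context (hpi : filtration mu pi D).
Let D1 := filtration_ge1 hpi.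
Let D0 : 0 < D := lt_le_trans ltr01 D1.

(** Heights are measured relative to the average over the coarsest cell. Where it vanishes no level
    is reached, whereas 0 <= 0 alone would reach all of them. In the factor 2 D, [D] pays for the
    jump at the stopping level and 2 yields the halving. *)
Definition level_reached h k x : pred nat := fun m =>
  (0 < avg 0 h x) && ((2 * D) ^+ k * avg 0 h x <= avg m h x).

Definition level_time h k x : option nat :=
  if pselect (exists m, level_reached h k x m) is left e then Some (ex_minn e)
  else None.

Lemma level_reached_cell h k x y m : cell m x y ->
  level_reached h k y m = level_reached h k x m.
Proof.
move=> xy; rewrite /level_reached (avg_cell _ _ xy).
by rewrite (avg_cell _ _ (cell_sub hpi (leq0n m) xy)).
Qed.

Lemma level_timeP h k x m : level_time h k x = Some m <->
  level_reached h k x m /\ forall j, level_reached h k x j -> (m <= j)%N.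
Proof.
rewrite /level_time; case: pselect => [e|ne]; last first.
  by split => // -[hm _]; exfalso; apply: ne; exists m.
case: ex_minnP => j hj jmin; split => [[<-//]|[hm mmin]].
by congr Some; apply/eqP; rewrite eqn_leq jmin// mmin.
Qed.

Lemma level_time_None h k x : level_time h k x = None ->
  forall m, ~~ level_reached h k x m.
Proof.
rewrite /level_time; case: pselect => // ne _ m; apply/negP => hm.
by apply: ne; exists m.
Qed.

Lemma level_stopping h k : stopping pi (level_time h k).
Proof.
move=> x y m /level_timeP[hm mmin] xy; apply/level_timeP; split.
  by rewrite (level_reached_cell _ _ xy).
move=> j hj; rewrite leqNgt; apply/negP => jm.
have := mmin j; rewrite -(@level_reached_cell h k x y j); last first.
  by apply: (cell_sub hpi (ltnW jm)).
by move=> /(_ hj); rewrite leqNgt jm.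
Qed.

Lemma expD_ge1 k : 1 <= (2 * D) ^+ k.
Proof. by apply: exprn_ege1; move: D1; lra. Qed.

Lemma level_nested h k x m : (forall y, 0 <= h y) -> level_time h k.+1 x = Some m ->
  exists2 j, (j <= m)%N & level_time h k x = Some j.
Proof.
move=> h0 /level_timeP[/andP[p0 hm] mmin].
have km : level_reached h k x m.
  rewrite /level_reached p0 (le_trans _ hm)// ler_pM2r// exprS ler_peMl//.
    by rewrite (le_trans _ (expD_ge1 k)).
  by move: D1; lra.
case E : (level_time h k x) => [j|]; last by have := level_time_None E m; rewrite km.
by exists j => //; move/level_timeP : E => [_]; apply.
Qed.

(** The parent of the stopping cell has not reached the level, and an average grows at most by the
    factor [D] from parent to child. For m = 0 there is no parent and the bound is immediate. *)
Lemma level_avg_le h k x m : locint mu pi h -> level_time h k x = Some m ->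
  avg m h x <= D * ((2 * D) ^+ k * avg 0 h x).
Proof.
move=> lh /level_timeP[/andP[p0 hm] mmin].
case: m hm mmin => [|m] hm mmin.
  apply: (@le_trans _ _ (1 * avg 0 h x)); first by rewrite mul1r.
  rewrite mulrA ler_pM2r//; apply: (le_trans (expD_ge1 k)).
  by rewrite ler_peMl// (le_trans _ (expD_ge1 k)).
apply: (le_trans (avg_ratio hpi _ _ lh)); rewrite ler_pM2l//.
rewrite leNgt; apply/negP => hlt; have := mmin m.
by rewrite /level_reached p0 (ltW hlt)/= => /(_ isT); rewrite ltnn.
Qed.

(** Chebyshev: where the cell is stopped again at level k + 1 the mean of [h] is at least c, while
    over the whole cell it is at most c / 2 by [level_avg_le]. *)
Lemma level_half h k x m : locint mu pi h -> level_time h k x = Some m ->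
  (mu (cell m x `&` stopdom (level_time h k.+1)) <= (2^-1 * mass m x)%:E)%E.
Proof.
move=> lh xm; have [mh h0 _] := lh.
have hm := level_avg_le lh xm.
have [/andP[p0 _] _] := (level_timeP h k x m).1 xm.
pose c := (2 * D) ^+ k.+1 * avg 0 h x.
have c0 : 0 < c by rewrite mulr_gt0// exprn_gt0// mulr_gt0.
have mdom := stopdom_measurable hpi (@level_stopping h k.+1).
have mc := cell_measurable hpi m x.
have : (\int[mu]_(y in stopdom (level_time h k.+1) `&` cell m x) c%:E <=
  \int[mu]_(y in stopdom (level_time h k.+1) `&` cell m x) (h y)%:E)%E.
  apply: (stopping_le_integral hpi (f := fun=> c)) => //.
  - exact: level_stopping.
  - by move=> _; exact: ltW.
  move=> y m' xy ym'; have [j jm' yj] := level_nested h0 ym'.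
  have := level_stopping xm xy; rewrite yj => -[ej]; subst j.
  rewrite (_ : cell m' y `&` cell m x = cell m' y); last first.
    by rewrite setIidl// -(cell_eq xy); exact: (cell_sub hpi).
  rewrite integral_cst; last exact: (cell_measurable hpi).
  rewrite (massE hpi) (avgE hpi)// -EFinM lee_fin ler_pM2r ?(mass_gt0 hpi)//.
  move/level_timeP : ym' => [/andP[_ hy] _]; apply: le_trans hy.
  by rewrite /c (avg_cell _ _ (cell_sub hpi (leq0n m) xy)).
rewrite integral_cst; last exact: measurableI.
move=> /le_trans/(_ (le_integral_sub mu (B := cell m x) _ _)) H.
have {}H : (c%:E * mu (stopdom (level_time h k.+1) `&` cell m x) <=
   (avg m h x * mass m x)%:E)%E.
  by rewrite -(avgE hpi)//; apply: H => // y; rewrite lee_fin.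
rewrite setIC -(@lee_pmul2l _ c%:E)//; apply: (le_trans H).
rewrite -EFinM lee_fin mulrA ler_pM2r ?(mass_gt0 hpi)//.
apply: (le_trans hm); rewrite /c exprS le_eqVlt; apply/orP; left.
by apply/eqP; field.
Qed.

Lemma level_tower h : locint mu pi h -> tower (level_time h).
Proof.
move=> lh; split; first exact: level_stopping.
  by move=> k x m; apply: level_nested; case: lh.
by move=> k x m; exact: level_half.
Qed.

(** Level k + 1 is never reached at x, so every average is below (2 D)^(k+1) times the coarsest one,
    and [avg m h x] is at least (2 D)^k times it. *)
Lemma level_dominates h k x m j : locint mu pi h ->
  level_time h k x = Some m -> level_time h k.+1 x = None ->
  avg j h x <= 2 * D * avg m h x.
Proof.
move=> lh /level_timeP[/andP[p0 hm] _] /level_time_None/(_ j).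
rewrite /level_reached p0/= -ltNge => /ltW/le_trans; apply.
by rewrite exprS -mulrA ler_pM2l// mulr_gt0.
Qed.

Lemma avg0_eq0 h x j : locint mu pi h -> ~~ (0 < avg 0 h x) -> avg j h x <= 0.
Proof.
move=> lh; have [_ h0 _] := lh; rewrite -leNgt => h00.
rewrite -(ler_pM2r (mass_gt0 hpi j x)) mul0r -lee_fin -(avgE hpi)//.
apply: (@le_trans _ _ (\int[mu]_(y in cell 0 x) (h y)%:E)%E).
  by apply: le_integral_sub; [move=> y; rewrite lee_fin|exact: (cell_sub hpi)].
by rewrite (avgE hpi)// lee_fin pmulr_lle0 ?(mass_gt0 hpi).
Qed.

(** Level 0 is reached, and bounded averages cannot reach arbitrarily high levels; hence there is a
    last level reached. *)
Lemma level_exists h x C : locint mu pi h -> 0 < avg 0 h x ->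
  (forall j, avg j h x <= C) ->
  exists2 k, level_time h k x <> None & level_time h k.+1 x = None.
Proof.
move=> lh p0 hC; have [_ h0 _] := lh.
have [k hk] : exists k, level_time h k x = None.
  have [k hk] : exists k : nat, C / avg 0 h x < (2 * D) ^+ k.
    have [k hk] : exists k : nat, C / avg 0 h x < k%:R.
      exists (Num.bound `|C / avg 0 h x|).
      exact: le_lt_trans (ler_norm _) (archi_boundP (normr_ge0 _)).
    exists k; apply: (lt_le_trans hk); apply: (@le_trans _ _ (2 ^+ k)).
      by rewrite -natrX ler_nat ltnW// ltn_expl.
    by apply: lerXn2r; rewrite ?nnegrE//; move: D1; lra.
  exists k; case E : (level_time h k x) => [m|//].
  move/level_timeP : E => [/andP[_ hm] _]; exfalso.
  have := le_trans hm (hC m); rewrite -ler_pdivlMr//.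
  by rewrite leNgt hk.
elim: k hk => [|k ih] hk.
  have := level_time_None hk 0; rewrite /level_reached p0 expr0 mul1r lexx//.
case E : (level_time h k x) => [m|]; last exact: ih.
by exists k => //; rewrite E.
Qed.

End Tower.

(** * Strata and depth in a tower *)

Section TowerStrata.
Context d (T : measurableType d) (R : realType) (mu : {measure set T -> \bar R}).
Context (I : countType) (pi : nat -> T -> I) (D : R).
Context (hpi : filtration mu pi D).
Implicit Types (f g h : T -> R) (x y : T).
Local Notation avg := (avg mu pi).
Local Notation mass := (mass mu pi).
Local Notation cell := (cell pi).
Context (tau : nat -> T -> option nat) (ht : tower mu pi tau).

Definition stratum k : set T := stopdom (tau k) `\` stopdom (tau k.+1).

(* The index of the stratum of x; 0 if x belongs to none. *)
Definition depth x : nat :=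
  if pselect (exists k, `[< tau k.+1 x = None >]) is left e then ex_minn e else 0%N.

Lemma stratum_measurable k : measurable (stratum k).
Proof.
by apply: measurableD; apply: (stopdom_measurable hpi); exact: (tower_stopping ht).
Qed.

Lemma dom_measurable k : measurable (stopdom (tau k)).
Proof. by apply: (stopdom_measurable hpi); exact: (tower_stopping ht). Qed.

Lemma stopdom_le j k x : (j <= k)%N -> stopdom (tau k) x -> stopdom (tau j) x.
Proof.
move=> /subnK <-; elim: (k - j)%N => // i ih; rewrite addSn => H; apply: ih.
move: H; rewrite /stopdom /=; case E : (tau _ x) => [m|//] _.
by have [l _ ->] := tower_nested ht E.
Qed.

Lemma tower_le j k x m : (j <= k)%N -> tau k x = Some m ->
  exists2 l, (l <= m)%N & tau j x = Some l.
Proof.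
move=> /subnK <-; elim: (k - j)%N m => [|i ih] m; first by exists m.
rewrite addSn => H; have [l lm H'] := tower_nested ht H.
by have [l' l'l H''] := ih _ H'; exists l' => //; exact: leq_trans lm.
Qed.

Lemma stratum_disj j k x : stratum j x -> stratum k x -> j = k.
Proof.
wlog jk : j k / (j <= k)%N.
  move=> H hj hk; have [jk|/ltnW kj] := leqP j k; first exact: H.
  by apply/esym/H.
move=> [_ nj] [hk _]; apply/eqP; rewrite eqn_leq jk/= leqNgt; apply/negP => lt.
exact/nj/(stopdom_le lt hk).
Qed.

Lemma depth_stratum k x : stratum k x -> depth x = k.
Proof.
move=> [dk ndk].
have nk : tau k.+1 x = None by apply: contrapT.
rewrite /depth; case: pselect => [e|ne]; last first.
  by exfalso; apply: ne; exists k; apply/asboolP.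
case: ex_minnP => m /asboolP hm mmin.
apply/eqP; rewrite eqn_leq mmin ?andbT; last exact/asboolP.
rewrite leqNgt; apply/negP => mk; exact: (stopdom_le mk dk hm).
Qed.

(** The second alternative covers the points lying in all the domains, where [depth] has its default
    value. *)
Lemma depth_dom k x : stopdom (tau k) x -> (k <= depth x)%N \/ depth x = 0%N.
Proof.
move=> dk; rewrite /depth; case: pselect => [e|ne]; last by right.
case: ex_minnP => m /asboolP hm mmin; left; rewrite leqNgt; apply/negP => mk.
exact: (stopdom_le mk dk hm).
Qed.

Lemma depth_gt0 k x : depth x = k.+1 -> stratum k.+1 x.
Proof.
rewrite /depth; case: pselect => [e|//]; case: ex_minnP => m /asboolP hm mmin mk.
subst m; split; last by rewrite /stopdom/= hm.
by move=> hk; have := mmin k; rewrite ltnn => /(_ (asboolT hk)).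
Qed.

Lemma depth_measurable k : measurable [set x | depth x = k].
Proof.
have mS j : measurable [set x | depth x = j.+1].
  rewrite (_ : [set _ | _] = stratum j.+1); first exact: stratum_measurable.
  by apply/seteqP; split=> x; [exact: depth_gt0|exact: depth_stratum].
case: k => // ; rewrite (_ : [set _ | _] = ~` \bigcup_j [set x | depth x = j.+1]).
  by apply: measurableC; exact: bigcup_measurable.
apply/seteqP; split=> [x /= hx [j _ /= hj]|x hx]; first by move: hj; rewrite hx.
by case E : (depth x) => [|j]//; exfalso; apply: hx; exists j.
Qed.

End TowerStrata.

(** * Series with nonnegative terms *)

Section Series.
Context (R : realType).
Implicit Types (u : nat -> \bar R).

Lemma nneseries_le u (c : \bar R) : (forall k, 0 <= u k)%E ->
  (forall n, \sum_(0 <= k < n) u k <= c)%E -> (\sum_(0 <= k <oo) u k <= c)%E.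
Proof.
move=> u0 uc; apply: lime_le; first exact: is_cvg_nneseries.
by apply: nearW => n; exact: uc.
Qed.

Lemma nneseries_ge_term u k : (forall k, 0 <= u k)%E -> (u k <= \sum_(0 <= k <oo) u k)%E.
Proof.
move=> u0; apply: le_trans (nneseries_lim_ge k.+1 _) => //.
by rewrite big_nat_recr//= leeDr// sume_ge0.
Qed.

Lemma geometric_nneseries (c z : R) : 0 <= c -> 0 <= z < 1 ->
  (\sum_(0 <= k <oo) (c * z ^+ k)%:E <= (c / (1 - z))%:E)%E.
Proof.
move=> c0 /andP[z0 z1]; apply: nneseries_le => [k|n].
  by rewrite lee_fin mulr_ge0// exprn_ge0.
rewrite sumEFin lee_fin -mulr_sumr ler_wpM2l//.
have z10 : 0 < 1 - z by rewrite subr_gt0.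
rewrite -(ler_pM2r z10) mulVf ?gt_eqF// big_mkord mulrC.
rewrite -opprB mulNr -subrX1 opprB.
by rewrite lerBlDr lerDl exprn_ge0.
Qed.

(** A sum of growing powers is comparable with its last term, here of index at most n; the bound is
    uniform in [N]. *)
Lemma geometric_truncated (B : R) n N : 1 < B ->
  \sum_(0 <= k < N) B ^+ k * (k <= n)%N%:R <= B ^+ n * (B / (B - 1)).
Proof.
move=> B1; have B10 : 0 < B - 1 by rewrite subr_gt0.
have B0 : 0 < B by exact: lt_trans B1.
apply: (@le_trans _ _ ((B ^+ minn N n.+1 - 1) / (B - 1))); last first.
  rewrite mulrA ler_pM2r ?invr_gt0// -exprSr lerBlDr.
  apply: (@le_trans _ _ (B ^+ n.+1)); last by rewrite lerDl.
  by apply: ler_weXn2l; [exact: ltW|exact: geq_minr].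
elim: N => [|N ih]; first by rewrite big_geq// min0n expr0 subrr mul0r.
rewrite big_nat_recr//=; have [Nn|nN] := leqP N n.
  rewrite (minn_idPl (leqW Nn)) in ih; rewrite (minn_idPl (Nn : (N.+1 <= n.+1)%N)).
  rewrite mulr1; apply: (le_trans (lerD ih (lexx _))).
  rewrite -{2}(mulfK (lt0r_neq0 B10) (B ^+ N)) -mulrDl ler_pM2r ?invr_gt0//.
  by rewrite exprS; apply: eq_ler; ring.
rewrite mulr0 addr0 (minn_idPr _) ?ltnS 1?ltnW//.
by rewrite (minn_idPr _) in ih.
Qed.

End Series.

(** * Geometric decay of A_1 weights along a tower *)

Section WeightDecay.
Context d (T : measurableType d) (R : realType) (mu : {measure set T -> \bar R}).
Context (I : countType) (pi : nat -> T -> I) (D : R).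
Context (hpi : filtration mu pi D).
Implicit Types (f g h w : T -> R) (x y : T).
Local Notation avg := (avg mu pi).
Local Notation mass := (mass mu pi).
Local Notation cell := (cell pi).

Definition dyadic_A1 (A : R) w := {ae mu, forall x, forall k, avg k w x <= A * w x}.

Context (tau : nat -> T -> option nat) (ht : tower mu pi tau).
Context (w : T -> R) (A : R) (A1 : 1 <= A) (lw : locint mu pi w) (wA : dyadic_A1 A w).

(** At least half of a stopping cell lies outside the next domain, and there [w] is at least its
    average divided by [A]; that part carries a share 1 / (2 A) of the weight. The base [b] exceeds
    1 and still satisfies b theta = (1 + theta) / 2 < 1. *)
Let theta := 1 - (2 * A)^-1.
Let b := (1 + theta) / (2 * theta).

Let theta_bounds : 2^-1 <= theta < 1.
Proof.
have A0 : 0 < A by exact: lt_le_trans A1.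
have : (2 * A)^-1 <= 2^-1 by rewrite lef_pV2 ?posrE//; move: A1; lra.
have : 0 < (2 * A)^-1 by rewrite invr_gt0 mulr_gt0.
by rewrite /theta; lra.
Qed.

Let theta_pos : 0 < theta.
Proof. by have /andP[h _] := theta_bounds; apply: lt_le_trans h; rewrite invr_gt0. Qed.

Lemma decay_base_gt1 : 1 < b.
Proof.
by rewrite /b ltr_pdivlMr ?mulr_gt0// mul1r; have := theta_bounds; lra.
Qed.

Let btheta : b * theta = (1 + theta) / 2.
Proof. by rewrite /b; field; rewrite gt_eqF. Qed.

Let W0 : forall y, 0 <= w y. Proof. by case: lw. Qed.
Let mw : measurable_fun setT w. Proof. by case: lw. Qed.

Lemma weight_decay1 k x m : tau k x = Some m ->
  (\int[mu]_(y in cell m x `&` stopdom (tau k.+1)) (w y)%:E <=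
   theta%:E * \int[mu]_(y in cell m x) (w y)%:E)%E.
Proof.
move=> xm; have mc := cell_measurable hpi m x.
have mdom := dom_measurable hpi ht k.+1.
set dk := stopdom _ in mdom *.
have A0 : 0 < A by exact: lt_le_trans A1.
have mwE (B : set T) : measurable_fun B (EFin \o w).
  by apply: measurable_funTS; exact: measurable_EFinT.
have mIB : measurable (cell m x `&` dk) by exact: measurableI.
have mDB : measurable (cell m x `\` dk) by exact: measurableD.
have H1 : (\int[mu]_(y in cell m x) (w y)%:E =
    \int[mu]_(y in cell m x `&` dk) (w y)%:E + \int[mu]_(y in cell m x `\` dk) (w y)%:E)%E.
  rewrite -{1}(setUIDK (cell m x) dk) ge0_integral_setU//.
  - by move=> y _; rewrite lee_fin.
  - by rewrite disj_set2E setDE setIACA setICr setI0.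
have H2 : ((avg m w x / A)%:E * mu (cell m x `\` dk) <=
    \int[mu]_(y in cell m x `\` dk) (w y)%:E)%E.
  rewrite -integral_cst//; apply: ae_ge0_le_integral => //.
  - by move=> y _; rewrite lee_fin divr_ge0 ?(avg_ge0 hpi)// ltW.
  - by move=> y _; rewrite lee_fin.
  apply: filterS wA => y wy [xy _]; rewrite lee_fin ler_pdivrMr// mulrC.
  by rewrite -(avg_cell _ _ xy).
have H3 : (mu (cell m x) = mu (cell m x `&` dk) + mu (cell m x `\` dk))%E.
  by rewrite addeC; exact: measureDI.
have H4 := tower_half ht xm; rewrite -/dk in H4.
move: H3 H2 H1; rewrite (massE hpi) (avgE hpi)//.
have fI : mu (cell m x `&` dk) \is a fin_num.
  by rewrite ge0_fin_numE// (le_lt_trans H4)// ltry.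
have fD : mu (cell m x `\` dk) \is a fin_num.
  rewrite ge0_fin_numE// (le_lt_trans _ (cell_lty hpi m x))//.
  by apply: le_measure; rewrite ?inE//; exact: subDsetl.
move: H4; rewrite -(fineK fI) -(fineK fD) -EFinM -EFinD.
set p := fine _; set q := fine _; rewrite lee_fin => H4 H3 H2 H1.
have {}H3 := EFin_inj H3.
have fU : (\int[mu]_(y in cell m x `\` dk) (w y)%:E)%E \is a fin_num.
  rewrite ge0_fin_numE; last by apply: integral_ge0 => y _; rewrite lee_fin.
  rewrite (@le_lt_trans _ _ (avg m w x * mass m x)%:E) ?ltry//.
  by rewrite H1 leeDr// integral_ge0// => y _; rewrite lee_fin.
have fV : (\int[mu]_(y in cell m x `&` dk) (w y)%:E)%E \is a fin_num.
  rewrite ge0_fin_numE; last by apply: integral_ge0 => y _; rewrite lee_fin.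
  rewrite (@le_lt_trans _ _ (avg m w x * mass m x)%:E) ?ltry//.
  by rewrite H1 leeDl// integral_ge0// => y _; rewrite lee_fin.
move: H1 H2; rewrite -(fineK fU) -(fineK fV) -EFinD.
set v := fine _; set u := fine _ => H1; have {}H1 := EFin_inj H1.
rewrite -EFinM !lee_fin => H2.
have a0 := avg_ge0 hpi m x W0.
have H5 : avg m w x / A * (2^-1 * mass m x) <= u.
  apply: le_trans H2; apply: ler_wpM2l; last by move: H3 H4; lra.
  by apply: divr_ge0 => //; exact: ltW.
rewrite /theta mulrBl mul1r {1}H1 lerBrDr lerD2l.
by apply: le_trans H5; apply: eq_ler; field; rewrite gt_eqF.
Qed.

(** Iterates [weight_decay1] over the stopping cells of level k + j inside the given cell. *)
Lemma weight_decay k x m j : tau k x = Some m ->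
  (\int[mu]_(y in cell m x `&` stopdom (tau (k + j))) (w y)%:E <=
   (theta ^+ j)%:E * \int[mu]_(y in cell m x) (w y)%:E)%E.
Proof.
move=> xm; elim: j => [|j ih].
  rewrite expr0 mul1e; apply: le_integral_sub; last by move=> y [].
  by move=> y; rewrite lee_fin.
have mc := cell_measurable hpi m x.
have th0 := ltW theta_pos.
rewrite addnS exprS EFinM -muleA; set kj := (k + j)%N.
apply: (@le_trans _ _ (theta%:E * \int[mu]_(y in cell m x `&` stopdom (tau kj)) (w y)%:E)%E); last first.
  by apply: lee_wpmul2l.
have mdom := dom_measurable hpi ht.
rewrite -integralZ//; last exact: measurableI.
rewrite (_ : cell m x `&` stopdom (tau kj.+1) =
  (stopdom (tau kj) `&` cell m x) `&` stopdom (tau kj.+1)); last first.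
  rewrite [in RHS](setIC (stopdom (tau kj))) -setIA; congr (_ `&` _).
  rewrite setIidr// => y; exact: (stopdom_le ht).
rewrite -integral_restr2 [X in (_ <= \int[_]_(_ in X) _)%E]setIC.
apply: (stopping_le_integral hpi (f := fun y => w y * \1_(stopdom (tau kj.+1)) y)
   (g := fun y => theta * w y)) => //.
- exact: (tower_stopping ht).
- by apply: measurable_funM => //; exact: measurable_funT_indic.
- exact: measurable_funM.
- by move=> y; rewrite mulr_ge0.
- by move=> y; rewrite mulr_ge0.
move=> y m' xy ym'.
have [l lm' yl] := tower_le ht (leq_addr j k) ym'.
have := tower_stopping ht xm xy; rewrite yl => -[el]; subst l.
rewrite (_ : cell m' y `&` cell m x = cell m' y); last first.
  by rewrite setIidl// -(cell_eq xy); exact: (cell_sub hpi).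
rewrite integral_restr2 integralZ//; last exact: (cell_measurable hpi).
exact: weight_decay1.
Qed.

(** b^depth is bounded by the sum over j of b^(k+j) on the domain of level k + j. The weight of
    these domains decays like theta^j, which leaves a geometric series of ratio b theta. *)
Lemma weight_depth_integral k x m : tau k x = Some m ->
  (\int[mu]_(y in cell m x) (w y * b ^+ depth tau y)%:E <=
   (b ^+ k / (1 - b * theta) * (avg m w x * mass m x))%:E)%E.
Proof.
move=> xm; have mc := cell_measurable hpi m x.
have b1 := decay_base_gt1; have b0 : 0 < b by exact: lt_trans b1.
have mdom := dom_measurable hpi ht.
have th0 := ltW theta_pos.
pose u j y := w y * (b ^+ (k + j) * \1_(stopdom (tau (k + j))) y).
have u0 j y : 0 <= u j y by rewrite !mulr_ge0// ?exprn_ge0// ltW.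
have mu_ j : measurable_fun setT (u j).
  by do 2 (apply: measurable_funM => //); exact: measurable_funT_indic.
apply: (@le_trans _ _ (\int[mu]_(y in cell m x) (\sum_(0 <= j <oo) (u j y)%:E))%E).
  apply: le_integral_ge0 => y xy; first by rewrite lee_fin mulr_ge0// exprn_ge0// ltW.
  have yk : stopdom (tau k) y by rewrite /stopdom /= (tower_stopping ht xm xy).
  (* j = depth - k works, except where the depth is 0, by default or in fact; there j = 0 does. *)
  have [j hj yj] : exists2 j, (depth tau y <= k + j)%N & stopdom (tau (k + j)) y.
    have [kd|d0] := depth_dom ht yk; last by exists 0%N; rewrite ?addn0 ?d0.
    have [d0|d0] := posnP (depth tau y); first by exists 0%N; rewrite ?addn0 ?d0.
    exists (depth tau y - k)%N; rewrite subnKC//.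
    have : depth tau y = (depth tau y).-1.+1 by rewrite prednK.
    by move=> /depth_gt0[]; rewrite prednK.
  apply: le_trans (nneseries_ge_term j _); last by move=> i; rewrite lee_fin.
  rewrite lee_fin /u indicE mem_set// mulr1 ler_wpM2l//.
  by apply: ler_weXn2l => //; exact: ltW.
rewrite integral_nneseries; first last.
- by move=> j y _; rewrite lee_fin.
- by move=> j; apply: measurable_funTS; exact: measurable_EFinT.
- exact: mc.
apply: (@le_trans _ _ (\sum_(0 <= j <oo)
    (b ^+ k * (avg m w x * mass m x) * (b * theta) ^+ j)%:E)%E).
  apply: lee_nneseries => [j _ _|j _].
    by apply: integral_ge0 => y _; rewrite lee_fin.
  rewrite /u; under eq_integral do rewrite mulrCA.
  rewrite integralZ//; first last.
  - by apply: measurable_funM => //; exact: measurable_funT_indic.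
  - by move=> y; rewrite mulr_ge0.
  - by rewrite exprn_ge0// ltW.
  rewrite integral_restr2.
  apply: (@le_trans _ _ ((b ^+ (k + j))%:E * ((theta ^+ j)%:E * \int[mu]_(y in cell m x) (w y)%:E))%E).
    by apply: lee_wpmul2l; [rewrite lee_fin exprn_ge0// ltW|exact: weight_decay].
  rewrite (avgE hpi)// -!EFinM lee_fin exprD [(b * theta) ^+ j]exprMn.
  by apply: eq_ler; move: (b ^+ k) (b ^+ j) (theta ^+ j) => X Y Z; ring.
have := theta_bounds => hth.
apply: (le_trans (geometric_nneseries _ _)).
- apply: mulr_ge0; first by apply: exprn_ge0; exact: ltW.
  by apply: mulr_ge0; [exact: (avg_ge0 hpi)|exact/ltW/(mass_gt0 hpi)].
- by rewrite btheta; lra.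
by rewrite lee_fin; apply: eq_ler; ring.
Qed.

End WeightDecay.

(** * The weighted bound for the dyadic maximal function *)

Section Young.
Context (R : realType).
Implicit Types (s c f w t : R).

Lemma powR_expr (a p : R) k : 0 <= a -> (a ^+ k) `^ p = (a `^ p) ^+ k.
Proof.
move=> a0; elim: k => [|k ih]; first by rewrite !expr0 powR1.
by rewrite !exprS powRM ?exprn_ge0// ih.
Qed.

Lemma powR_le_root s t (y : R) : 0 < s -> 0 <= t -> t `^ s <= y -> t <= y `^ s^-1.
Proof.
move=> s0 t0 ty; have -> : t = (t `^ s) `^ s^-1.
  by rewrite -powRrM mulfV ?gt_eqF// powRr1.
apply: ge0_ler_powR; rewrite ?nnegrE ?invr_ge0 ?(ltW s0) ?powR_ge0//.
by rewrite (le_trans _ ty)// powR_ge0.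
Qed.

Lemma powR_young s t : 1 < s -> 0 <= t -> t <= t `^ s / s + (1 - s^-1).
Proof.
move=> s1 t0; have s0 : 0 < s by exact: lt_trans s1.
have i1 : 0 < 1 - s^-1 by rewrite subr_gt0 invf_lt1.
have := @conjugate_powR R t 1 s (1 - s^-1)^-1 t0 ler01 s0.
rewrite invr_gt0 i1 invrK powR1 mulr1 mul1r => H; apply: H => //.
by rewrite addrC subrK.
Qed.

Lemma powR_opp_cancel s t : 0 < t -> t `^ (1 - s) * t `^ (s - 1) = 1.
Proof.
move=> t0; rewrite -powRD; last by rewrite (gt_eqF t0) implybT.
by rewrite addrC subrKA subrr powRr0.
Qed.

(** Young's inequality for f / (c w), multiplied by c w. At w = 0 both sides vanish, since f <= w
    and 0 to a nonzero power is 0. *)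
Lemma weighted_young s c f w : 1 < s -> 0 < c -> 0 <= f <= w ->
  f <= s^-1 * (c `^ (1 - s) * (f `^ s * w `^ (1 - s))) + (1 - s^-1) * (c * w).
Proof.
move=> s1 c0 /andP[f0 fw]; have s0 : 0 < s by exact: lt_trans s1.
have i1 : 0 < 1 - s^-1 by rewrite subr_gt0 invf_lt1.
have [ew|w0] := eqVneq w 0.
  rewrite ew in fw *; have f00 : f = 0 by apply/eqP; rewrite eq_le f0 fw.
  by rewrite f00 !mulr0 addr0 powR0 ?gt_eqF// !(mul0r, mulr0).
have {}w0 : 0 < w by rewrite lt_neqAle eq_sym w0 (le_trans f0).
have cw : 0 < c * w by rewrite mulr_gt0.
have cw1 : (c * w)^-1 `^ s * (c * w) = c `^ (1 - s) * w `^ (1 - s).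
  rewrite -powRM ?(ltW c0) ?(ltW w0)// powRB; last by rewrite (gt_eqF cw) implybT.
  rewrite powRr1 ?(ltW cw)// mulrC; congr (_ * _).
  by rewrite -powR_inv1 ?(ltW cw)// -powRrM mulN1r powRN.
have := powR_young s1 (divr_ge0 f0 (ltW cw)).
rewrite -(ler_pM2r cw) divfK ?gt_eqF// => /le_trans; apply.
rewrite mulrDl lerD2r powRM ?invr_ge0// ?(ltW cw)//.
rewrite (_ : _ / s * _ = s^-1 * (f `^ s * ((c * w)^-1 `^ s * (c * w)))); last by ring.
by rewrite cw1; apply: eq_ler; ring.
Qed.

(** The choice c = A / B turns the last term into (1 - 1/s) A, which the left side absorbs. Thus
    Holder's inequality for averages comes out of a pointwise Young inequality. *)
Lemma holder_of_young (s A B P : R) : 1 < s -> 0 <= A <= B -> 0 <= P ->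
  (forall c, 0 < c -> A <= s^-1 * (c `^ (1 - s) * P) + (1 - s^-1) * (c * B)) ->
  A `^ s <= B `^ (s - 1) * P.
Proof.
move=> s1 /andP[A0 AB] P0 H; have s0 : 0 < s by exact: lt_trans s1.
have [->|An0] := eqVneq A 0.
  by rewrite powR0 ?gt_eqF// mulr_ge0// powR_ge0.
have {A0}An0 : 0 < A by rewrite lt_neqAle eq_sym An0.
have B0 : 0 < B by exact: lt_le_trans AB.
have c0 : 0 < A / B by rewrite divr_gt0.
have := H _ c0; rewrite divfK ?gt_eqF// mulrBl mul1r => H1.
have {H1}H1 : A <= (A / B) `^ (1 - s) * P.
  by rewrite -(@ler_pM2l _ s^-1) ?invr_gt0//; move: H1; lra.
have H2 : (A / B) `^ (s - 1) * A <= P.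
  have -> : P = (A / B) `^ (s - 1) * ((A / B) `^ (1 - s) * P).
    by rewrite mulrA [X in _ = X * _]mulrC powR_opp_cancel// mul1r.
  by apply: ler_wpM2l => //; exact: powR_ge0.
have H3 : (A / B) `^ (s - 1) * B `^ (s - 1) = A `^ (s - 1).
  by rewrite -powRM ?divfK ?gt_eqF// ?(ltW c0) ?(ltW B0).
rewrite -mulr_powRB1 ?(ltW An0)// -H3.
rewrite (_ : A * _ = B `^ (s - 1) * ((A / B) `^ (s - 1) * A)); last by ring.
by apply: ler_wpM2l => //; exact: powR_ge0.
Qed.

(** For positive f and w the quotient of the two sides is (f / w)^(s-1) <= 1. *)
Lemma powR_weight_le s f w : 1 < s -> 0 <= f <= w -> f `^ s * w `^ (1 - s) <= f.
Proof.
move=> s1 /andP[f0 fw]; have s0 : 0 < s by exact: lt_trans s1.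
have [->|w0] := eqVneq w 0.
  by rewrite powR0 ?mulr0// subr_eq0 lt_eqF.
have {}w0 : 0 < w by rewrite lt_neqAle eq_sym w0 (le_trans f0).
rewrite -mulr_powRB1// -mulrA ler_piMr//.
rewrite -[leRHS](powR_opp_cancel s w0) [leRHS]mulrC; apply: ler_wpM2r; first exact: powR_ge0.
by apply: ge0_ler_powR; rewrite ?nnegrE ?subr_ge0 ?(ltW s1) ?(ltW w0).
Qed.

End Young.

Section Weighted.
Context d (T : measurableType d) (R : realType) (mu : {measure set T -> \bar R}).
Context (I : countType) (pi : nat -> T -> I) (D : R).
Context (hpi : filtration mu pi D).
Implicit Types (f g h w : T -> R) (x y : T).
Local Notation avg := (avg mu pi).
Local Notation mass := (mass mu pi).
Local Notation cell := (cell pi).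

(* g is at most the dyadic maximal function of f. *)
Definition le_dyadic_max f g :=
  {ae mu, forall x, forall c, (forall k, avg k f x <= c) -> g x <= c}.

(** [B] bounds the mean of [W] on the cell. Young's inequality is integrated with a free parameter
    c, over which [holder_of_young] then optimizes. *)
Lemma stopped_holder s (B : R) f W m x : 1 < s -> locint mu pi f ->
  measurable_fun setT W -> (forall y, f y <= W y) ->
  (\int[mu]_(y in cell m x) (W y)%:E <= (B * mass m x)%:E)%E ->
  (avg m f x) `^ s <= B `^ (s - 1) * avg m (fun y => f y `^ s * W y `^ (1 - s)) x.
Proof.
move=> s1 lf mW fW hB; have [mf f0 _] := lf.
have mx := mass_gt0 hpi m x; have mc := cell_measurable hpi m x.
have lP : locint mu pi (fun y => f y `^ s * W y `^ (1 - s)).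
  apply: (locint_le _ _ _ lf) => [|y|y].
  - by apply: measurable_funM; exact: (measurableT_comp (measurable_powR _)).
  - by rewrite mulr_ge0 ?powR_ge0.
  - by apply: powR_weight_le => //; rewrite f0 fW.
have [mP P0 _] := lP.
have i1 : 0 < 1 - s^-1 by rewrite subr_gt0 invf_lt1// (lt_trans ltr01).
have si : 0 < s^-1 by rewrite invr_gt0 (lt_trans ltr01).
apply: holder_of_young => //.
- rewrite (avg_ge0 hpi)//= -(ler_pM2r mx) -lee_fin -(avgE hpi)//.
  apply: le_trans hB; apply: le_integral_ge0 => y _; rewrite lee_fin//.
- exact: (avg_ge0 hpi).
move=> c c0; rewrite -(ler_pM2r mx) -lee_fin -(avgE hpi)//.
have W0 y : 0 <= W y by exact: le_trans (f0 y) (fW y).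
have c1 : 0 <= s^-1 * c `^ (1 - s) by rewrite mulr_ge0 ?powR_ge0// ltW.
have c2 : 0 <= (1 - s^-1) * c by apply: mulr_ge0; exact: ltW.
apply: (@le_trans _ _ (\int[mu]_(y in cell m x) ((s^-1 * c `^ (1 - s) * (f y `^ s * W y `^ (1 - s)))%:E
    + ((1 - s^-1) * c * W y)%:E))%E).
  apply: le_integral_ge0 => y _; first by rewrite lee_fin.
  rewrite -EFinD lee_fin -!mulrA; apply: weighted_young => //.
  by rewrite f0 fW.
rewrite ge0_integralD//; first last.
- by apply: measurable_funTS; apply: measurable_EFinT; apply: measurable_funM.
- by move=> y _; rewrite lee_fin mulr_ge0.
- by apply: measurable_funTS; apply: measurable_EFinT; apply: measurable_funM.
- by move=> y _; rewrite lee_fin mulr_ge0.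
rewrite !integralZ// (avgE hpi)//.
apply: (@le_trans _ _ ((s^-1 * c `^ (1 - s))%:E * (avg m (fun y => f y `^ s * W y `^ (1 - s)) x * mass m x)%:E
   + ((1 - s^-1) * c)%:E * (B * mass m x)%:E)%E).
  by rewrite leeD2l// lee_wpmul2l.
by rewrite -!EFinM -EFinD lee_fin; apply: eq_ler; ring.
Qed.

(** On the stratum k, [g] is at most 2 D times the stopped average of [f]. Holder's inequality with
    W = w0 b^depth costs a factor B^k and leaves Phi = f^s w0^(1-s) B^(-depth). Once the averaging
    has been moved onto [w1], a point of depth n collects the powers B^k with k <= n, whose sum is
    comparable to B^n and cancels against Phi. *)
Theorem dyadic_weighted_max (s A0 A1 : R) : 1 < s -> 1 <= A0 -> 0 <= A1 ->
  exists2 K : R, 0 <= K & forall w0 w1 f g,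
    locint mu pi w0 -> locint mu pi w1 ->
    dyadic_A1 mu pi A0 w0 -> dyadic_A1 mu pi A1 w1 ->
    measurable_fun setT f -> (forall x, 0 <= f x <= w0 x) ->
    measurable_fun setT g -> (forall x, 0 <= g x) -> le_dyadic_max f g ->
    (\int[mu]_x (g x `^ s * w0 x `^ (1 - s) * w1 x)%:E <=
     K%:E * \int[mu]_x (f x `^ s * w0 x `^ (1 - s) * w1 x)%:E)%E.
Proof.
move=> s1 A01 A10; pose theta := 1 - (2 * A0)^-1.
pose b := (1 + theta) / (2 * theta); pose C0 := A0 / (1 - b * theta).
pose B := b `^ (s - 1).
have b1 : 1 < b := decay_base_gt1 A01.
have b0 : 0 < b := lt_trans ltr01 b1.
have s0 : 0 < s := lt_trans ltr01 s1.
have s10 : 0 < s - 1 by rewrite subr_gt0.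
have bt : b * theta < 1.
  have : 0 < (2 * A0)^-1 by rewrite invr_gt0; move: A01; lra.
  have : (2 * A0)^-1 <= 2^-1 by rewrite lef_pV2 ?posrE; move: A01; lra.
  move=> h1 h2; rewrite /b -mulrA (mulrC _ theta) invfM mulrA.
  have t0 : theta != 0 by rewrite gt_eqF// /theta; lra.
  rewrite (_ : _ * _ = (1 + theta) / 2); first by rewrite /theta; lra.
  by field.
have C00 : 0 <= C0.
  by apply: divr_ge0; [exact: le_trans A01|rewrite subr_ge0 ltW].
have B1 : 1 < B.
  have -> : 1 = 1 `^ (s - 1) :> R by rewrite powR1.
  by apply: gt0_ltr_powR; rewrite ?nnegrE// ltW.
have B0 : 0 < B := lt_trans ltr01 B1.
have B10 : 0 < B - 1 by rewrite subr_gt0.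
have C0E : C0 = A0 / (1 - b * theta) by [].
have BE : B = b `^ (s - 1) by [].
have bE : b = (1 + theta) / (2 * theta) by [].
have thetaE : theta = 1 - (2 * A0)^-1 by [].
clearbody B C0 b theta.
pose K1 := (2 * D) `^ s * C0 `^ (s - 1) * A1.
have K10 : 0 <= K1 by rewrite !mulr_ge0 ?powR_ge0.
have K1E : K1 = (2 * D) `^ s * C0 `^ (s - 1) * A1 by [].
clearbody K1.
exists (K1 * (B / (B - 1))); first by rewrite mulr_ge0// divr_ge0// ltW.
have Bk k : 0 <= B ^+ k by rewrite exprn_ge0// ltW.
have Cs : 0 <= C0 `^ (s - 1) by exact: powR_ge0.
move=> w0 w1 f g lw0 lw1 hw0 hw1 mf fw mg g0 gf.
have f0 x : 0 <= f x by have /andP[] := fw x.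
have fw0 x : f x <= w0 x by have /andP[] := fw x.
have lf : locint mu pi f by exact: (locint_le _ _ _ lw0).
have [mw0 w00 _] := lw0; have [mw1 w10 _] := lw1.
pose tau := level_time mu pi D f.
have ht : tower mu pi tau := level_tower hpi lf.
have st k : stopping pi (tau k) by exact: (tower_stopping ht).
have mdom := dom_measurable hpi ht.
have mstr := stratum_measurable hpi ht.
pose W x := w0 x * b ^+ depth tau x.
have mW : measurable_fun setT W.
  apply: measurable_funM => //.
  exact: (@measurable_discrete _ _ _ (depth tau) (fun k => b ^+ k) (depth_measurable hpi ht)).
have fW x : f x <= W x.
  by apply: (le_trans (fw0 x)); rewrite ler_peMr// exprn_ege1// ltW.
have W0 x : 0 <= W x := le_trans (f0 x) (fW x).
pose Phi x := f x `^ s * W x `^ (1 - s).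
have Phi0 x : 0 <= Phi x by rewrite mulr_ge0 ?powR_ge0.
have mPhi : measurable_fun setT Phi.
  by apply: measurable_funM; exact: (measurableT_comp (measurable_powR _)).
have lPhi : locint mu pi Phi.
  apply: (locint_le _ _ _ lf) => // x.
  by apply: powR_weight_le => //; rewrite f0 fW.
(* The mean of [W] over the stopping cell is at most C0 b^k w0(x); raised to the power s - 1 it
   cancels w0^(1-s) up to C0^(s-1) B^k. *)
have stopped_f k x : stratum tau k x -> (forall j, avg j w0 x <= A0 * w0 x) ->
    stopped mu pi (tau k) f x `^ s * w0 x `^ (1 - s) <=
    C0 `^ (s - 1) * B ^+ k * stopped mu pi (tau k) Phi x.
  move=> [xk _] hx; move: xk; rewrite /stopdom /= /stopped.
  case E : (tau k x) => [m|//] _.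
  have H1 := weight_depth_integral hpi ht A01 lw0 hw0 E.
  rewrite -thetaE -bE mulrA in H1.
  have H2 := stopped_holder s1 lf mW fW H1.
  have P0 := avg_ge0 hpi m x Phi0.
  apply: (@le_trans _ _ ((C0 * b ^+ k * w0 x) `^ (s - 1) * avg m Phi x * w0 x `^ (1 - s))).
    apply: ler_wpM2r; first exact: powR_ge0.
    apply: (le_trans H2); apply: ler_wpM2r; first exact: P0.
    have bk : 0 <= b ^+ k by rewrite exprn_ge0// ltW.
    have c0 : 0 <= b ^+ k / (1 - b * theta) by apply: divr_ge0 => //; rewrite subr_ge0 ltW.
    apply: ge0_ler_powR; rewrite ?nnegrE ?(ltW s10)//.
    - by apply: mulr_ge0 => //; exact: (avg_ge0 hpi).
    - by apply: mulr_ge0 => //; exact: mulr_ge0.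
    rewrite (_ : C0 * _ * _ = b ^+ k / (1 - b * theta) * (A0 * w0 x)); last by rewrite C0E; ring.
    exact: ler_wpM2l.
  have [w0x|w0x] := eqVneq (w0 x) 0.
    rewrite w0x powR0 ?mulr0 ?subr_eq0 ?lt_eqF//.
    by apply: mulr_ge0 => //; exact: mulr_ge0.
  have {}w0x : 0 < w0 x by rewrite lt_neqAle eq_sym w0x w00.
  have bk : 0 <= b ^+ k by rewrite exprn_ge0// ltW.
  rewrite powRM ?mulr_ge0// powRM//.
  rewrite (_ : (b ^+ k) `^ (s - 1) = B ^+ k); last first.
    by rewrite BE powR_expr// ltW.
  rewrite (_ : _ * _ * _ * _ * _ = C0 `^ (s - 1) * B ^+ k * avg m Phi x *
     (w0 x `^ (1 - s) * w0 x `^ (s - 1))); last by ring.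
  by rewrite powR_opp_cancel// mulr1.
pose u k x := w1 x * \1_(stratum tau k) x.
have lu k : locint mu pi (u k) by exact: locint_indic.
have u0 k x : 0 <= u k x by case: (lu k).
have muk k : measurable_fun setT (u k) by case: (lu k).
have mst k h : measurable_fun setT (stopped mu pi (tau k) h).
  exact (stopped_measurable hpi h (st k)).
have st0 k x : 0 <= stopped mu pi (tau k) Phi x by exact: (stopped_ge0 hpi).
pose c k := (2 * D) `^ s * (C0 `^ (s - 1) * B ^+ k).
have c0 k : 0 <= c k by rewrite !mulr_ge0 ?powR_ge0// exprn_ge0// ltW.
have t0 k x : 0 <= c k * (u k x * stopped mu pi (tau k) Phi x).
  by apply: mulr_ge0 => //; exact: mulr_ge0.
have good : {ae mu, forall x, [/\ forall j, avg j f x <= A0 * w0 x,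
    forall j, avg j w0 x <= A0 * w0 x, forall j, avg j w1 x <= A1 * w1 x &
    forall c', (forall k, avg k f x <= c') -> g x <= c']}.
  apply: (filterS3 _ _ hw0 hw1 gf) => x h1 h2 h3; split => // j.
  by apply: le_trans (h1 j); apply: (avg_le hpi).
(* At a point of the stratum k the term of index k alone bounds the left side. *)
apply: (@le_trans _ _ (\int[mu]_x (\sum_(0 <= k <oo)
    (c k * (u k x * stopped mu pi (tau k) Phi x))%:E))%E).
  apply: ae_ge0_le_integral => //.
  - by move=> x _; rewrite lee_fin !mulr_ge0 ?powR_ge0.
  - by apply: measurable_EFinT; do 2 (apply: measurable_funM => //);
      exact: (measurableT_comp (measurable_powR _)).
  - by move=> x _; apply: nneseries_ge0 => k _ _; rewrite lee_fin t0.
  - apply: ge0_emeasurable_sum => k; first by move=> x _ _; rewrite lee_fin t0.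
    by move=> _; apply: measurable_EFinT; do 2 apply: measurable_funM => //.
  apply: filterS good => x [h1 h2 h3 h4] _.
  have [p0|np0] := boolP (0 < avg 0 f x); last first.
    have gx : g x = 0.
      by apply/eqP; rewrite eq_le g0 andbT; apply: h4 => k; exact: (avg0_eq0 hpi).
    rewrite gx powR0 ?gt_eqF// !mul0r.
    by apply: nneseries_ge0 => k _ _; rewrite lee_fin t0.
  have [k xk nxk] := level_exists hpi lf p0 h1.
  have xs : stratum tau k x by split => //; rewrite /stopdom /= /tau nxk.
  apply: le_trans (nneseries_ge_term k _); last first.
    by move=> j; rewrite lee_fin t0.
  rewrite lee_fin /u indicE mem_set// mulr1.
  rewrite [leRHS](_ : _ = w1 x * ((2 * D) `^ s * (C0 `^ (s - 1) * B ^+ k * stopped mu pi (tau k) Phi x))); last by rewrite /c; ring.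
  rewrite mulrC; apply: ler_wpM2l => //.
  apply: le_trans (ler_wpM2l (powR_ge0 _ _) (stopped_f k x xs h2)).
  rewrite mulrA; apply: ler_wpM2r; first exact: powR_ge0.
  have D0 : 0 <= 2 * D by have := filtration_ge1 hpi; lra.
  rewrite -powRM//; last exact: (stopped_ge0 hpi).
  apply: ge0_ler_powR; rewrite ?nnegrE ?(ltW s0)//.
    by apply: mulr_ge0 => //; exact: (stopped_ge0 hpi).
  rewrite /stopped; case E : (tau k x) => [m|]; last by move: xk; rewrite -/tau E.
  by apply: h4 => j; exact: (level_dominates hpi j lf E nxk).
rewrite integral_nneseries//; first last.
- by move=> k x _; rewrite lee_fin t0.
- by move=> k; apply: measurable_EFinT; do 2 apply: measurable_funM => //.
have PhiE x k : stratum tau k x -> Phi x = f x `^ s * w0 x `^ (1 - s) * (B ^+ k)^-1.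
  move=> /(depth_stratum ht) E; rewrite /Phi /W E powRM ?exprn_ge0 ?(ltW b0)//.
  rewrite mulrA; congr (_ * _); rewrite -opprB powRN; congr (_^-1).
  by rewrite BE powR_expr// ltW.
have wP k x : 0 <= w1 x * \1_(stopdom (tau k)) x * Phi x.
  by apply: mulr_ge0 => //; apply: mulr_ge0.
pose v k x := K1 * B ^+ k * (w1 x * \1_(stopdom (tau k)) x * Phi x).
have v0 k x : 0 <= v k x.
  by apply: mulr_ge0 => //; exact: mulr_ge0.
have mv k : measurable_fun setT (v k).
  apply: measurable_funM => //; apply: measurable_funM => //; apply: measurable_funM => //.
(* Self-adjointness moves the average from [Phi] to [w1] cut to the stratum, where the A_1 condition
   bounds it by A1 w1 on the domain of level k. *)
apply: (@le_trans _ _ (\sum_(0 <= k <oo) \int[mu]_x (v k x)%:E)%E).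
  apply: lee_nneseries => [k _ _|k _].
    by apply: integral_ge0 => x _; rewrite lee_fin t0.
  rewrite integralZ//; first last.
  - exact: measurable_funM.
  - by move=> x; rewrite mulr_ge0.
  apply: (@le_trans _ _ ((c k)%:E * \int[mu]_x (A1 * (w1 x * \1_(stopdom (tau k)) x * Phi x))%:E)%E); last first.
    rewrite -integralZ//.
    - apply: le_integral_ge0 => x _; first by rewrite lee_fin; apply: mulr_ge0 => //; exact: mulr_ge0.
      by rewrite lee_fin /v /c K1E; apply: eq_ler; ring.
    - by move=> x; exact: mulr_ge0.
    - apply: measurable_funM => //; apply: measurable_funM => //; apply: measurable_funM => //.
  apply: lee_wpmul2l; first by rewrite lee_fin.
  apply: (le_trans (stopped_selfadjoint_le hpi (st k) (lu k) lPhi)).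
  apply: ae_ge0_le_integral => //.
  - by move=> x _; rewrite lee_fin mulr_ge0//; exact: (stopped_ge0 hpi).
  - by apply: measurable_EFinT; exact: measurable_funM.
  - by move=> x _; rewrite lee_fin mulr_ge0.
  - apply: measurable_EFinT; apply: measurable_funM => //; apply: measurable_funM => //; apply: measurable_funM => //.
  apply: filterS good => x [h1 h2 h3 h4] _; rewrite lee_fin mulrA; apply: ler_wpM2r => //.
  rewrite /stopped; case E : (tau k x) => [m|]; last by rewrite !mulr_ge0.
  rewrite indicE mem_set /stopdom/= ?E// mulr1; apply: le_trans (h3 m).
  apply: (avg_le hpi) => // y _.
  by rewrite /u indicE ler_piMr// lern1 leq_b1.
rewrite -integral_nneseries//; first last.
- by move=> k x _; rewrite lee_fin.
- by move=> k; exact: measurable_EFinT.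
rewrite -integralZ//; first last.
- by do 2 (apply: measurable_funM => //); exact: (measurableT_comp (measurable_powR _)).
- by move=> x; rewrite !mulr_ge0 ?powR_ge0.
- by rewrite mulr_ge0// divr_ge0// ltW.
apply: ae_ge0_le_integral => //.
- by move=> x _; apply: nneseries_ge0 => k _ _; rewrite lee_fin.
- by apply: ge0_emeasurable_sum => k; [move=> x _ _; rewrite lee_fin|move=> _; exact: measurable_EFinT].
- move=> x _; rewrite lee_fin mulr_ge0//; first by rewrite mulr_ge0// divr_ge0// ltW.
  by rewrite !mulr_ge0 ?powR_ge0.
- by apply: measurable_EFinT; do 3 (apply: measurable_funM => //);
    exact: (measurableT_comp (measurable_powR _)).
apply: filterS good => x [h1 h2 h3 h4] _.
have R0 : 0 <= K1 * (B / (B - 1)) * (f x `^ s * w0 x `^ (1 - s) * w1 x).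
  apply: mulr_ge0; first by rewrite mulr_ge0// divr_ge0// ltW.
  by rewrite !mulr_ge0 ?powR_ge0.
apply: nneseries_le => [k|N]; first by rewrite lee_fin.
rewrite sumEFin lee_fin.
have [p0|np0] := boolP (0 < avg 0 f x); last first.
  rewrite big1 // => k _; rewrite /v indicE memNset ?mulr0 ?mul0r ?mulr0//.
  rewrite /stopdom /= => H; apply: H.
  case E : (tau k x) => [m|//]; move: E => /(level_timeP mu pi)[/andP[]].
  by rewrite (negbTE np0).
have [n xn nxn] := level_exists hpi lf p0 h1.
have xs : stratum tau n x by split => //; rewrite /stopdom /= /tau nxn.
have Bn : 0 < B ^+ n by rewrite exprn_gt0.
(* A point of the stratum n lies only in domains of level k <= n. *)
apply: (@le_trans _ _ (\sum_(0 <= k < N) K1 * w1 x * Phi x * (B ^+ k * (k <= n)%N%:R))).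
  apply: ler_sum => k _; rewrite /v.
  rewrite [leRHS](_ : _ = K1 * B ^+ k * (w1 x * (k <= n)%N%:R * Phi x)); last by ring.
  apply: ler_wpM2l; first by rewrite mulr_ge0// exprn_ge0// ltW.
  apply: ler_wpM2r => //; apply: ler_wpM2l => //.
  rewrite indicE ler_nat; case: (boolP (x \in _)) => // /set_mem xk; rewrite lt0b.
  rewrite leqNgt; apply/negP => nk.
  have := stopdom_le ht nk xk; rewrite /stopdom /= /tau nxn; exact.
rewrite -mulr_sumr.
apply: (le_trans (ler_wpM2l _ (geometric_truncated n N B1))).
  by apply: mulr_ge0 => //; exact: mulr_ge0.
rewrite (PhiE x n xs); apply: eq_ler; field.
by rewrite (gt_eqF B10) (gt_eqF Bn).
Qed.

End Weighted.

(** * Duality for the dyadic maximal function *)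

Section Counting.

(** On the indices counted, k is determined by the remainder of p - k modulo L. *)
Lemma count_divn_le (p L m N : nat) : (0 < L)%N ->
  (\sum_(k < N) ((k <= p) && ((p - k) %/ L == m) : bool) <= L)%N.
Proof.
move=> L0; pose A := [set k : 'I_N | (k <= p)%N && (((p - k) %/ L)%N == m)]%SET.
have -> : (\sum_(k < N) ((k <= p) && ((p - k) %/ L == m) : bool) = #|A|)%N.
  rewrite -sum1_card [RHS]big_mkcond /=; apply: eq_bigr => k _; rewrite inE.
  by case: (_ && _).
pose h (k : 'I_N) : 'I_L := Ordinal (ltn_pmod (p - k) L0).
have hinj : {in A &, injective h}.
  move=> i j; rewrite !inE => /andP[ip /eqP iL] /andP[jp /eqP jL] [] hij.
  apply: val_inj => /=; have := divn_eq (p - i) L; have := divn_eq (p - j) L.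
  by rewrite iL jL hij => <-; lia.
rewrite -(card_in_imset hinj) -[leqRHS]card_ord; exact: max_card.
Qed.

(** To be used at a point of depth p, where the k-th function is at most [a m] for m = (p - k) / L;
    the term [a N] covers the quotients beyond the range of m. *)
Lemma sum_count_divn_le (R : realType) (p L N : nat) (a : nat -> R) : (0 < L)%N ->
  (forall m, 0 <= a m) ->
  \sum_(k < N) (\sum_(m < N) ((k <= p)%N && ((p - k) %/ L == m)%N)%:R * a m + a N) <=
  L%:R * \sum_(m < N) a m + N%:R * a N.
Proof.
move=> L0 a0; rewrite big_split /=; apply: lerD; last first.
  by rewrite sumr_const card_ord mulr_natl.
rewrite exchange_big /= mulr_sumr; apply: ler_sum => m _.
rewrite -mulr_suml; apply: ler_wpM2r => //.
rewrite -natr_sum ler_nat; exact: count_divn_le.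
Qed.

End Counting.

(** * Finite l^s norms *)

Section LrNorm.
Context (R : realType) (J : finType).
Implicit Types (a b : J -> R) (s : R).

Definition lsnorm s a : R := (\sum_j a j `^ s) `^ s^-1.

Lemma lsnorm_ge0 s a : 0 <= lsnorm s a. Proof. exact: powR_ge0. Qed.

Lemma lsnorm_pow s a : 0 < s -> lsnorm s a `^ s = \sum_j a j `^ s.
Proof.
move=> s0; rewrite /lsnorm -powRrM mulVf ?gt_eqF// powRr1//.
by apply: sumr_ge0 => j _; exact: powR_ge0.
Qed.

Lemma le_lsnorm_pow (J' : finType) s a (b : J' -> R) : 0 < s ->
  \sum_j a j `^ s <= \sum_j b j `^ s ->
  lsnorm s a <= (\sum_j b j `^ s) `^ s^-1.
Proof.
move=> s0 ab; apply: ge0_ler_powR; rewrite ?nnegrE ?invr_ge0 ?(ltW s0)//;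
  by apply: sumr_ge0 => j _; exact: powR_ge0.
Qed.

Lemma le_lsnorm s a b : 0 < s -> (forall j, 0 <= a j <= b j) -> lsnorm s a <= lsnorm s b.
Proof.
move=> s0 ab; apply: le_lsnorm_pow => //; apply: ler_sum => j _.
have /andP[a0 lab] := ab j.
by apply: ge0_ler_powR; rewrite ?nnegrE ?(ltW s0)// (le_trans a0).
Qed.

Lemma lsnorm_ge s a j : 0 < s -> (forall j, 0 <= a j) -> a j <= lsnorm s a.
Proof.
move=> s0 a0; rewrite -[leLHS]powRr1// -(mulfV (lt0r_neq0 s0)) powRrM.
apply: ge0_ler_powR; rewrite ?nnegrE ?invr_ge0 ?(ltW s0) ?powR_ge0//.
  by apply: sumr_ge0 => i _; exact: powR_ge0.
rewrite (bigD1 j)//= lerDl; apply: sumr_ge0 => i _; exact: powR_ge0.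
Qed.

Lemma lsnorm_le_pow s a (t : R) : 0 < s -> 0 <= t ->
  \sum_j a j `^ s <= t `^ s -> lsnorm s a <= t.
Proof.
move=> s0 t0 h; rewrite -[leRHS]powRr1// -(mulfV (lt0r_neq0 s0)) powRrM.
apply: ge0_ler_powR; rewrite ?nnegrE ?invr_ge0 ?(ltW s0) ?powR_ge0//.
by apply: sumr_ge0 => j _; exact: powR_ge0.
Qed.

Lemma lsnormZ s (c : R) a : 0 < s -> 0 <= c -> (forall j, 0 <= a j) ->
  lsnorm s (fun j => c * a j) = c * lsnorm s a.
Proof.
move=> s0 c0 a0; rewrite /lsnorm.
under eq_bigr do rewrite powRM//.
rewrite -mulr_sumr powRM ?powR_ge0//; last first.
  by apply: sumr_ge0 => j _; exact: powR_ge0.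
by rewrite -powRrM mulfV ?gt_eqF// powRr1.
Qed.

Lemma measurable_lsnorm d (T : measurableType d) s (u : J -> T -> R) :
  (forall j, measurable_fun setT (u j)) ->
  measurable_fun setT (fun x => lsnorm s (fun j => u j x)).
Proof.
move=> mu; apply: (measurableT_comp (measurable_powR _)).
by apply: measurable_sum => j; exact: (measurableT_comp (measurable_powR _)).
Qed.

End LrNorm.

Section DyadicDual.
Context d (T : measurableType d) (R : realType) (mu : {measure set T -> \bar R}).
Context (I : countType) (pi : nat -> T -> I) (D : R).
Context (hpi : filtration mu pi D).
Implicit Types (f g h u v w : T -> R) (x y : T).
Local Notation avg := (avg mu pi).
Local Notation mass := (mass mu pi).
Local Notation cell := (cell pi).

(* Bd u c stands for: u belongs to the function space and its norm is at most c. *)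
Record norm_bound (Bd : (T -> R) -> R -> Prop) : Prop := {
  nb_mono : forall u v c c', Bd v c -> measurable_fun setT u ->
    (forall x, 0 <= u x <= v x) -> c <= c' -> Bd u c';
  nb_add : forall u v c c', Bd u c -> Bd v c' -> Bd (fun x => u x + v x) (c + c');
  nb_scale : forall t u c, 0 <= t -> Bd u c -> Bd (fun x => t * u x) (t * c) }.

(** The [v j] are arbitrary functions below the dyadic maximal ones, which admits stopped averages
    cut to a domain; the index type is any finite type, which admits pairs of a level and a
    stratum. *)
Definition vv_bound (Bd : (T -> R) -> R -> Prop) (s C : R) :=
  forall (J : finType) (u v : J -> T -> R) c,
  (forall j, locint mu pi (u j)) ->
  (forall j, measurable_fun setT (v j)) -> (forall j x, 0 <= v j x) ->
  (forall j, le_dyadic_max mu pi (u j) (v j)) ->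
  Bd (fun x => lsnorm s (fun j => u j x)) c ->
  Bd (fun x => lsnorm s (fun j => v j x)) (C * c).

Lemma exists_stratum (tau : nat -> T -> option nat) k x :
  tau 0%N x <> None -> tau k x = None -> exists j, stratum tau j x.
Proof.
move=> t0; elim: k => [|k ih] // tk.
case E : (tau k x) => [m|]; last exact: ih.
by exists k; split; rewrite /stopdom /= ?E ?tk.
Qed.

Section tower_facts.
Context (tau : nat -> T -> option nat) (ht : tower mu pi tau).

(** The weight decay for w = 1 and A = 1: inside a stopping cell the measure of the domains is
    halved at each level. *)
Lemma tower_negligible : mu.-negligible (\bigcap_k stopdom (tau k)).
Proof.
have mdom := dom_measurable hpi ht.
have mN : measurable (\bigcap_k stopdom (tau k)) by exact: bigcap_measurable.
apply/(negligibleP _ mN).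
set N := \bigcap_k _ in mN *.
have l1 := locint1 hpi.
have a1 : dyadic_A1 mu pi 1 (fun=> 1).
  by apply: aeW => x k; rewrite mulr1 (avg1 hpi).
have H k x m : tau k x = Some m -> mu (cell m x `&` N) = 0.
  move=> xm; apply/eqP; rewrite eq_le measure_ge0 andbT.
  have mI : measurable (cell m x `&` N).
    by apply: measurableI => //; exact: (cell_measurable hpi).
  have Hj j : (mu (cell m x `&` N) <= (mass m x * (2^-1) ^+ j)%:E)%E.
    have := weight_decay hpi ht (lexx _) l1 a1 j xm.
    have e1 (E : set T) : measurable E -> (\int[mu]_(y in E) 1%:E)%E = mu E.
      by move=> mE; rewrite integral_cst// mul1e.
    have mIj : measurable (cell m x `&` stopdom (tau (k + j))).
      by apply: measurableI => //; exact: (cell_measurable hpi).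
    rewrite (e1 _ mIj) (e1 _ (cell_measurable hpi m x)) (massE hpi) -EFinM.
    rewrite (_ : 1 - (2 * 1)^-1 = 2^-1) 1?mulrC; last by field.
    apply: le_trans; apply: le_measure; rewrite ?inE//.
    by apply: setIS => y; apply.
  have fN : mu (cell m x `&` N) \is a fin_num.
    by rewrite ge0_fin_numE// (le_lt_trans (Hj 0%N))// ltry.
  move: Hj; rewrite -(fineK fN) => Hj; rewrite lee_fin.
  have m0 := mass_gt0 hpi m x.
  have cv : (fun j => mass m x * (2^-1 : R) ^+ j) @ \oo --> (0 : R).
    rewrite -(mulr0 (mass m x)); apply: cvgMl_tmp; apply: cvg_expr.
    by rewrite ger0_norm ?invr_ge0// invf_lt1// ltr1n.
  apply: (ler_cvg_to (cvg_cst _) cv).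
  by apply: nearW => j; rewrite -lee_fin.
have stt : stopping pi (tau 0%N) by exact: (tower_stopping ht).
have : (\int[mu]_(y in stopdom (tau 0%N) `&` setT) (\1_N y)%:E <=
    \int[mu]_(y in stopdom (tau 0%N) `&` setT) (cst (0 : R) y)%:E)%E.
  apply: (stopping_le_integral hpi (f := \1_N) (g := cst 0)) => //.
  move=> x m _ xm; rewrite !setIT integral_indic//; last exact: (cell_measurable hpi).
  by rewrite setIC (H _ _ _ xm) integral_ge0.
rewrite !setIT (_ : (\int[mu]_(y in stopdom (tau 0%N)) (cst (0 : R) y)%:E)%E = 0%E); last first.
  by rewrite integral0_eq.
rewrite integral_indic// setIidl; last by move=> y; apply.
by move=> G; apply/eqP; rewrite eq_le measure_ge0 andbT.
Qed.

Let P k f := stopped mu pi (tau k) f.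

(* Half of each stopping cell of level q lies in the stratum q, so that the
   dyadic maximal function recovers there any function constant on the cell. *)
Lemma stratum_recovers k q f x : (k <= q)%N -> locint mu pi f -> stopdom (tau q) x ->
  exists m, P k f x <= 2 * avg m (fun y => P k f y * \1_(stratum tau q) y) x.
Proof.
move=> kq lf; rewrite {1}/stopdom /=; case E : (tau q x) => [m|//] _; exists m.
have [l lm xl] := tower_le ht kq E.
have stk : stopping pi (tau k) by exact: (tower_stopping ht).
have stq : stopping pi (tau q) by exact: (tower_stopping ht).
have f0 : forall y, 0 <= f y by case: lf.
have mc := cell_measurable hpi m x.
have mq := stratum_measurable hpi ht q.
have Pc y : cell m x y -> P k f y = P k f x.
  move=> xy; have lxy := cell_sub hpi lm xy.
  by rewrite /P /stopped (stk _ _ _ xl lxy) xl; exact: avg_cell.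
have P0 : 0 <= P k f x by exact: (stopped_ge0 hpi).
have mx := mass_gt0 hpi m x.
have e1 : (\int[mu]_(y in cell m x) (P k f y * \1_(stratum tau q) y)%:E =
    (P k f x)%:E * mu (cell m x `&` stratum tau q))%E.
  transitivity (\int[mu]_(y in cell m x) (P k f x * \1_(stratum tau q) y)%:E)%E.
    by apply: eq_integral => y; rewrite inE => xy; rewrite Pc.
  rewrite integralZ//.
  by rewrite integral_indic// setIC.
have e2 : (mu (cell m x) = mu (cell m x `&` stopdom (tau q.+1)) + mu (cell m x `&` stratum tau q))%E.
  have -> : cell m x `&` stratum tau q = cell m x `\` stopdom (tau q.+1).
    rewrite /stratum setDE setIA setDE; congr (_ `&` _); apply: setIidl.
    by move=> y xy; rewrite /stopdom /= (stq _ _ _ E xy).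
  rewrite addeC; apply: measureDI => //; exact: (dom_measurable hpi ht).
have e3 := tower_half ht E.
have fI : mu (cell m x `&` stratum tau q) \is a fin_num.
  rewrite ge0_fin_numE// (le_lt_trans _ (cell_lty hpi m x))//.
  by apply: le_measure; rewrite ?inE//; exact: measurableI.
have fD : mu (cell m x `&` stopdom (tau q.+1)) \is a fin_num.
  by rewrite ge0_fin_numE// (le_lt_trans e3)// ltry.
move: e1 e2 e3; rewrite (massE hpi) -(fineK fI) -(fineK fD) -EFinM -EFinD lee_fin.
set p := fine _; set r := fine _ => e1 e2; have {}e2 := EFin_inj e2; move=> e3.
rewrite -(ler_pM2r mx) -mulrA.
have -> : avg m (fun y => P k f y * \1_(stratum tau q) y) x * mass m x = P k f x * p.
  by rewrite (avg_mass hpi) e1.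
rewrite mulrCA; apply: ler_wpM2l => //; move: e2 e3; lra.
Qed.

(** [S m] is the l^s norm of the g_k cut to the domains of level k + m L. Cut instead to the L
    strata that follow, the g_k have l^s norm at most [S m], while each of these L pieces recovers
    half of g_k on the domain of level k + (m + 1) L. Hence L^(1/s) / 2 times S (m + 1) is bounded
    by C times the bound for S m, and L > (4 C)^s makes the bounds halve. *)
Lemma stopped_strata_sum_bound Bd s C N f c : norm_bound Bd -> 1 < s -> 1 <= C ->
  vv_bound Bd s C -> locint mu pi f -> Bd f c -> 0 <= c ->
  let L := Num.bound ((4 * C) `^ s) in
  Bd (fun x => \sum_(k < N) P k (fun y => f y * \1_(stratum tau k) y) x)
     ((2 * L%:R + 1) * C * c).
Proof.
move=> nb s1 C1 vv lf fc c0 L.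
have s0 : 0 < s by exact: lt_trans s1.
have C0 : 0 < C by exact: lt_le_trans C1.
have L0 : (4 * C) `^ s < L%:R by apply: archi_boundP; exact: powR_ge0.
have Lp : (0 < L)%N by rewrite -(ltr0n R) (le_lt_trans _ L0)// powR_ge0.
clearbody L.
have LR : 0 < L%:R :> R by rewrite ltr0n.
have mstr := stratum_measurable hpi ht.
have mdom := dom_measurable hpi ht.
have st k : stopping pi (tau k) by exact: (tower_stopping ht).
pose u k y := f y * \1_(stratum tau k) y.
have lu k : locint mu pi (u k) by exact: locint_indic.
have u0 k x : 0 <= u k x by case: (lu k).
pose g k := P k (u k).
have g0 k x : 0 <= g k x by exact: (stopped_ge0 hpi).
have mg k : measurable_fun setT (g k) by exact: (stopped_measurable hpi).
have ind0 (A : set T) x : 0 <= \1_A x :> R by rewrite indicE ler0n.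
pose S m x := lsnorm s (fun k : 'I_N => g k x * \1_(stopdom (tau (k + m * L))) x).
have gd0 k m x : 0 <= g k x * \1_(stopdom (tau (k + m * L))) x by exact: mulr_ge0.
have mS m : measurable_fun setT (S m).
  by apply: measurable_lsnorm => k; apply: measurable_funM => //.
have gdom k x : ~ stopdom (tau k) x -> g k x = 0.
  by move=> nk; rewrite /g /P /stopped; case E : (tau k x) nk => // nk; exfalso; apply: nk; rewrite /stopdom /= E.
have gE k x : g k x = g k x * \1_(stopdom (tau k)) x.
  have [xk|nxk] := pselect (stopdom (tau k) x).
    by rewrite indicE mem_set// mulr1.
  by rewrite gdom// mul0r.
have f0 x : 0 <= f x by case: lf.
(* The strata are disjoint, so the l^s norm of the pieces of [f] is at most [f]. *)
have S0 : Bd (S 0%N) (C * c).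
  apply: (nb_mono nb (v := fun x => lsnorm s (fun k : 'I_N => g k x)) (c := C * c)) => //; last first.
    move=> x; rewrite lsnorm_ge0 /=; apply: le_lsnorm => // k.
    by rewrite gd0 /= ler_piMr// indicE lern1 leq_b1.
  apply: (vv _ (fun k : 'I_N => u k)) => //.
    move=> k; apply: aeW => x c' hc; rewrite /g /P /stopped.
    by case: (tau k x) => [m|]//; apply: le_trans (hc 0%N); exact: (avg_ge0 hpi).
  apply: (nb_mono nb (v := f) (c := c)) => //.
    by apply: measurable_lsnorm => k; case: (lu k).
  move=> x; rewrite lsnorm_ge0 /=; apply: lsnorm_le_pow => //.
  have [[j xj]|/forallNP nx] := pselect (exists j, stratum tau j x); last first.
    rewrite big1 ?powR_ge0// => k _; rewrite /u indicE memNset ?mulr0 ?powR0 ?gt_eqF//; exact: nx.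
  have [jN|Nj] := ltnP j N; last first.
    rewrite big1 ?powR_ge0// => k _; rewrite /u indicE memNset ?mulr0 ?powR0 ?gt_eqF// => xk.
    by have := stratum_disj ht xj xk => ej; move: Nj; rewrite ej leqNgt ltn_ord.
  rewrite (bigD1 (Ordinal jN))//= big1 ?addr0; last first.
    move=> k kj; rewrite /u indicE memNset ?mulr0 ?powR0 ?gt_eqF// => xk.
    move: kj; rewrite -val_eqE /= => /eqP; apply; exact: (stratum_disj ht xk xj).
  by rewrite /u indicE mem_set// mulr1.
have Sstep m c' : Bd (S m) c' -> 0 <= c' -> Bd (S m.+1) (c' / 2).
  move=> Bm c'0.
  pose q (kl : 'I_N * 'I_L) := (kl.1 + m * L + kl.2)%N.
  pose uu (kl : 'I_N * 'I_L) y := g kl.1 y * \1_(stratum tau (q kl)) y.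
  pose vvv (kl : 'I_N * 'I_L) y := 2^-1 * (g kl.1 y * \1_(stopdom (tau (kl.1 + m.+1 * L))) y).
  have guu kl x : 0 <= uu kl x by exact: mulr_ge0.
  have muu kl : measurable_fun setT (uu kl).
    by apply: measurable_funM => //.
  have key : Bd (fun x => lsnorm s (fun kl => vvv kl x)) (C * c').
    apply: (vv _ uu) => //.
    - by move=> kl; apply: locint_indic => //; exact: (stopped_locint hpi).
    - move=> kl; by do 2 (apply: measurable_funM => //).
    - by move=> kl x; rewrite /vvv !mulr_ge0// invr_ge0.
    - move=> kl; apply: aeW => x c1 hc; rewrite /vvv indicE.
      have c10 : 0 <= c1 by apply: le_trans (hc 0%N); exact: (avg_ge0 hpi).
      case: (boolP (x \in _)) => [/set_mem xd|_]; last by rewrite mulr0 mulr0.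
      have qd : stopdom (tau (q kl)) x.
        apply: (stopdom_le ht _ xd); by rewrite /q mulSn [(L + _)%N]addnC addnA leq_add2l ltnW.
      have kq : (kl.1 <= q kl)%N by rewrite /q -addnA leq_addr.
      have [j hj] := stratum_recovers kq (lu kl.1) qd.
      rewrite mulr1 mulrC ler_pdivrMr// mulrC; apply: (le_trans hj).
      by rewrite ler_pM2l//; exact: hc.
    - apply: (nb_mono nb (v := S m) (c := c')) => //.
        by apply: measurable_lsnorm.
      move=> x; rewrite lsnorm_ge0 /=; apply: le_lsnorm_pow => //.
      rewrite -(pair_bigA _ (fun k l => uu (k, l) x `^ s))/=.
      apply: ler_sum => k _.
      have [[j xj]|/forallNP nx] := pselect (exists l : 'I_L, stratum tau (q (k, l)) x); last first.
        rewrite big1 ?powR_ge0// => l _; rewrite /uu indicE memNset ?mulr0 ?powR0 ?gt_eqF//; exact: nx.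
      rewrite (bigD1 j)//= big1 ?addr0; last first.
        move=> l lj; rewrite /uu indicE memNset ?mulr0 ?powR0 ?gt_eqF// => xl.
        move: lj; rewrite -val_eqE /= => /eqP; apply.
        have := stratum_disj ht xl xj; rewrite /q /=; lia.
      rewrite /uu [in leLHS]indicE mem_set// mulr1 indicE mem_set ?mulr1//.
      have [xd _] := xj; apply: (stopdom_le ht _ xd); rewrite /q /=; lia.
  have lam0 : 0 < L%:R `^ s^-1 :> R by exact: powR_gt0.
  (* The L equal copies of g_k contribute a factor L to the sum of the powers s. *)
  have SE x : S m.+1 x = 2 / L%:R `^ s^-1 * lsnorm s (fun kl => vvv kl x).
    rewrite /lsnorm -(pair_bigA _ (fun k l => vvv (k, l) x `^ s))/=.
    rewrite (eq_bigr (fun k : 'I_N => L%:R * (2^-1 `^ s * (g k x * \1_(stopdom (tau (k + m.+1 * L))) x) `^ s))); last first.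
      move=> k _; rewrite /vvv /= sumr_const card_ord [X in X *+ L]powRM ?invr_ge0//.
      by rewrite mulr_natl.
    rewrite -!mulr_sumr powRM ?mulr_ge0 ?powR_ge0//; last first.
      by apply: sumr_ge0 => k _; exact: powR_ge0.
    rewrite powRM ?powR_ge0//; last by apply: sumr_ge0 => k _; exact: powR_ge0.
    rewrite -powRrM mulfV ?gt_eqF// powRr1 ?invr_ge0//.
    by rewrite /S /lsnorm; field; rewrite gt_eqF.
  have h4 : 4 * C <= L%:R `^ s^-1.
    by apply: powR_le_root => //; [rewrite mulr_ge0// ltW|exact: ltW].
  have t0 : 0 <= 2 / L%:R `^ s^-1 by apply: divr_ge0 => //; exact: ltW.
  apply: (nb_mono nb (nb_scale nb t0 key)) => //.
    by move=> x; rewrite lsnorm_ge0 /= SE.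
  rewrite (_ : _ * _ = (4 * C * c' / 2) / L%:R `^ s^-1); last by field; rewrite gt_eqF.
  by rewrite ler_pdivrMr//; have := ler_wpM2l c'0 h4; lra.
have Sm m : Bd (S m) (C * c / 2 ^+ m).
  elim: m => [|m ih]; first by rewrite expr0 divr1.
  have := Sstep _ _ ih; rewrite exprSr invfM mulrA; apply.
  by rewrite !mulr_ge0// ?(ltW C0)// invr_ge0 exprn_ge0.
have sumS M : Bd (fun x => \sum_(m < M) S m x) (2 * C * c).
  apply: (nb_mono nb (v := fun x => \sum_(m < M) S m x) (c := \sum_(m < M) C * c / 2 ^+ m)).
  - elim: M => [|M ih].
      apply: (nb_mono nb (nb_scale nb (lexx 0) (Sm 0%N))).
      + exact: measurable_sum.
      + by move=> x; rewrite big_ord0 mul0r lexx.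
      + by rewrite big_ord0 mul0r.
    under eq_fun do rewrite big_ord_recr /=.
    rewrite big_ord_recr /=; exact: (nb_add nb ih (Sm M)).
  - exact: measurable_sum.
  - by move=> x; rewrite lexx andbT; apply: sumr_ge0 => m _; exact: lsnorm_ge0.
  have h2 : \sum_(m < M) C * c / 2 ^+ m = 2 * C * c * (1 - (2 ^+ M)^-1).
    elim: M => [|M ih]; first by rewrite big_ord0 expr0 invr1 subrr mulr0.
    by rewrite big_ord_recr /= ih exprS; field; rewrite expf_neq0.
  rewrite h2 ler_piMr ?gerBl ?invr_ge0 ?exprn_ge0//.
  by rewrite !mulr_ge0// ltW.
(* The term N S_N covers the points lying in all the domains and the indices k with depth - k >= N
   L. Its bound N C c / 2^N is at most C c. *)
have HN : Bd (fun x => L%:R * \sum_(m < N) S m x + N%:R * S N x)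
    (L%:R * (2 * C * c) + N%:R * (C * c / 2 ^+ N)).
  by apply: (nb_add nb); apply: (nb_scale nb).
apply: (nb_mono nb HN).
- by apply: measurable_sum => k; exact: mg.
- move=> x; apply/andP; split; first by apply: sumr_ge0 => k _; exact: g0.
  have SN0 m : 0 <= S m x by exact: lsnorm_ge0.
  have gS (k : 'I_N) m : stopdom (tau (k + m * L)) x -> g k x <= S m x.
    move=> xd; have := @lsnorm_ge _ _ s (fun k : 'I_N => g k x * \1_(stopdom (tau (k + m * L))) x) k s0.
    move=> /(_ (fun k => gd0 k m x)); rewrite indicE mem_set// mulr1; exact.
  have [xall|/existsNP[j xj]] := pselect (forall j, stopdom (tau j) x).
    apply: (@le_trans _ _ (N%:R * S N x)); last first.
      by rewrite lerDr mulr_ge0//; apply: sumr_ge0.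
    rewrite mulr_natl -[in leRHS](card_ord N) -sumr_const; apply: ler_sum => k _.
    exact: gS.
  have [x0|x0] := pselect (stopdom (tau 0%N) x); last first.
    rewrite big1; first by rewrite addr_ge0 ?mulr_ge0//; apply: sumr_ge0.
    by move=> k _; apply: gdom => xk; apply: x0; exact: (stopdom_le ht (leq0n k) xk).
  have [p [xp nxp]] : exists p, stratum tau p x.
    by apply: (exists_stratum x0 (k := j)); apply: contrapT.
  have domE i : stopdom (tau i) x -> (i <= p)%N.
    move=> xi; rewrite leqNgt; apply/negP => pi_; exact/nxp/(stopdom_le ht pi_ xi).
  apply: (@le_trans _ _ (\sum_(k < N) (\sum_(m < N) ((k <= p)%N && ((p - k) %/ L == m)%N)%:R * S m x + S N x))).
    apply: ler_sum => k _; rewrite -[leLHS]/(g k x).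
    have s00 : 0 <= \sum_(m < N) ((k <= p)%N && ((p - k) %/ L == m)%N)%:R * S m x.
      by apply: sumr_ge0 => m _; rewrite mulr_ge0.
    have [kp|pk] := leqP k p; last first.
      rewrite gdom ?addr_ge0//; last by move=> /domE; rewrite leqNgt pk.
      by apply: sumr_ge0 => m _; rewrite mulr_ge0.
    have [qN|Nq] := ltnP ((p - k) %/ L) N.
      rewrite (bigD1 (Ordinal qN))//= eqxx mul1r -addrA ler_wpDr//.
        by apply: addr_ge0 => //; apply: sumr_ge0 => m _; rewrite mulr_ge0.
      apply: gS; apply: (stopdom_le ht _ xp).
      have := leq_divM (p - k) L; lia.
    rewrite ler_wpDl//; first by apply: sumr_ge0 => m _; rewrite mulr_ge0.
    apply: gS; apply: (stopdom_le ht _ xp).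
    have := leq_divM (p - k) L; have := leq_mul Nq (leqnn L); lia.
  exact: (@sum_count_divn_le _ p L N (fun m => S m x)).
have N2 : N%:R <= 2 ^+ N :> R by rewrite -natrX ler_nat ltnW// ltn_expl.
have : N%:R * (C * c / 2 ^+ N) <= C * c.
  rewrite mulrA ler_pdivrMr ?exprn_gt0// mulrC; apply: ler_wpM2l => //.
  by rewrite mulr_ge0// ltW.
by lra.
Qed.

End tower_facts.

(** [H] is any bound for the pairings of [h] with functions of norm at most K c, so that no dual
    norm has to be mentioned. The stopping times of [h] linearize its maximal function, after which
    the averaging can be moved to [f]. *)
Theorem dyadic_dual_bound Bd s C : norm_bound Bd -> 1 < s -> 1 <= C ->
  vv_bound Bd s C -> exists2 K : R, 0 <= K &
  forall f h v c (H : \bar R), locint mu pi f -> locint mu pi h ->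
  measurable_fun setT v -> (forall x, 0 <= v x) -> le_dyadic_max mu pi h v ->
  Bd f c -> 0 <= c ->
  (forall G : T -> R, measurable_fun setT G -> (forall x, 0 <= G x) -> Bd G (K * c) ->
    (\int[mu]_x (h x * G x)%:E <= H)%E) ->
  (\int[mu]_x (f x * v x)%:E <= (2 * D)%:E * H)%E.
Proof.
move=> nb s1 C1 vv; pose L := Num.bound ((4 * C) `^ s).
exists ((2 * L%:R + 1) * C).
  by rewrite mulr_ge0 ?addr_ge0 ?mulr_ge0// (le_trans _ C1).
move=> f h v c H lf lh mv v0 hv fc c0 HH.
have [mf f0 _] := lf; have [mh h0 _] := lh.
pose tau := level_time mu pi D h.
have ht : tower mu pi tau := level_tower hpi lh.
have st k : stopping pi (tau k) by exact: (tower_stopping ht).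
have mstr := stratum_measurable hpi ht.
have D0 : 0 <= 2 * D by have := filtration_ge1 hpi; lra.
pose u k y := f y * \1_(stratum tau k) y.
have lu k : locint mu pi (u k) by exact: locint_indic.
have u0 k x : 0 <= u k x by case: (lu k).
have muk k : measurable_fun setT (u k) by case: (lu k).
pose P k w := stopped mu pi (tau k) w.
have P0 k w x : (forall y, 0 <= w y) -> 0 <= P k w x by exact: (stopped_ge0 hpi).
have mP k w : measurable_fun setT (P k w) by exact: (stopped_measurable hpi).
have uP0 k x : 0 <= u k x * P k h x by apply: mulr_ge0 => //; exact: P0.
apply: (@le_trans _ _ (\int[mu]_x (\sum_(0 <= k <oo) (2 * D * (u k x * P k h x))%:E))%E).
  apply: ae_ge0_le_integral => //.
  - by move=> x _; rewrite lee_fin mulr_ge0.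
  - by apply: measurable_EFinT; exact: measurable_funM.
  - by move=> x _; apply: nneseries_ge0 => k _ _; rewrite lee_fin mulr_ge0.
  - apply: ge0_emeasurable_sum => k; first by move=> x _ _; rewrite lee_fin mulr_ge0.
    by move=> _; apply: measurable_EFinT; do 2 apply: measurable_funM => //.
  (* Off the null intersection of all the domains, every point of the domain of level 0 lies in a
     stratum. *)
  have tn : {ae mu, forall x, ~ (\bigcap_k stopdom (tau k)) x}.
    have [A [mA A0 AN]] := tower_negligible ht.
    by exists A; split => // x /contrapT; exact: AN.
  apply: filterS2 tn hv => x xn hx _.
  have [p0|np0] := boolP (0 < avg 0 h x); last first.
    have -> : v x = 0.
      by apply/eqP; rewrite eq_le v0 andbT; apply: hx => k; exact: (avg0_eq0 hpi).
    by rewrite mulr0; apply: nneseries_ge0 => k _ _; rewrite lee_fin mulr_ge0.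
  have x0 : tau 0%N x <> None.
    move=> /level_time_None/(_ 0%N).
    by rewrite /level_reached p0 expr0 mul1r lexx.
  have [j xj] : exists j, tau j x = None.
    apply: contrapT => /forallNP nj; apply: xn => k _; exact: nj.
  have [k xk] := exists_stratum x0 xj.
  apply: le_trans (nneseries_ge_term k _); last first.
    by move=> i; rewrite lee_fin mulr_ge0.
  rewrite lee_fin /u indicE mem_set// mulr1 mulrCA; apply: ler_wpM2l => //.
  have [xk1 xk2] := xk; move: xk1; rewrite /stopdom /= /P /stopped.
  case E : (tau k x) => [m|//] _; apply: hx => i.
  by apply: (level_dominates hpi i lh E); exact: contrapT.
rewrite integral_nneseries//; first last.
- by move=> k x _; rewrite lee_fin mulr_ge0.
- by move=> k; apply: measurable_EFinT; do 2 apply: measurable_funM => //.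
apply: nneseries_le => [k|N].
  by apply: integral_ge0 => x _; rewrite lee_fin mulr_ge0.
(* After self-adjointness, [G] is what [h] is paired with; a partial sum of the series involves
   finitely many strata. *)
pose G x := \sum_(k < N) P k (u k) x.
apply: (@le_trans _ _ ((2 * D)%:E * \int[mu]_x (h x * G x)%:E)%E); last first.
  apply: lee_wpmul2l; first by rewrite lee_fin.
  apply: HH.
  - by apply: measurable_sum => k; exact: mP.
  - by move=> x; apply: sumr_ge0 => k _; exact: P0.
  - exact: (stopped_strata_sum_bound ht N nb s1 C1 vv lf fc c0).
have hP0 k x : 0 <= h x * P k (u k) x by apply: mulr_ge0 => //; exact: P0.
rewrite /G; under [X in (_ <= _ * X)%E]eq_integral do rewrite mulr_sumr -sumEFin.
rewrite ge0_integral_sum//; first last.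
- by move=> k x _; rewrite lee_fin.
- by move=> k; apply: measurable_EFinT; apply: measurable_funM => //; exact: mP.
rewrite ge0_sume_distrr; last by move=> k _; apply: integral_ge0 => x _; rewrite lee_fin.
rewrite big_mkord; apply: lee_sum => k _.
rewrite integralZ//; last by apply: measurable_funM => //; exact: mP.
apply: lee_wpmul2l; first by rewrite lee_fin.
apply: (le_trans (stopped_selfadjoint_le hpi (st k) (lu k) lh)).
apply: le_integral_ge0 => x _; first by rewrite lee_fin mulrC; exact: hP0.
by rewrite lee_fin mulrC.
Qed.

(** Real-valued, hence 0 by convention where the supremum is infinite; for a function satisfying
    [locint] this is a null set, by [avg_bounded_ae]. *)
Definition dymax f x : R := fine (ereal_sup (range (fun k => (avg k f x)%:E))).

Lemma avg_measurable k f : measurable_fun setT (avg k f).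
Proof.
have st : stopping pi (fun=> Some k) by move=> x y m.
exact: (stopped_measurable hpi f st).
Qed.

Lemma dymax_measurable f : measurable_fun setT (dymax f).
Proof.
apply: (measurableT_comp (fine_measurable measurableT)).
have := @measurable_fun_esups _ T R setT (fun k x => (avg k f x)%:E).
move=> /(_ (fun k => measurable_EFinT (avg_measurable k f)) 0%N).
congr (measurable_fun _ _); apply/funext => x; rewrite /esups; congr ereal_sup.
by apply/seteqP; split=> [_ [k _ <-]|_ [k _ <-]]; exists k.
Qed.

Lemma dymax_ge0 f x : (forall y, 0 <= f y) -> 0 <= dymax f x.
Proof.
move=> f0; apply: fine_ge0; apply: le_ereal_sup_tmp; exists (avg 0 f x)%:E; first by exists 0%N.
by rewrite lee_fin (avg_ge0 hpi).
Qed.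

Lemma dymax_le f x c : (forall k, avg k f x <= c) -> dymax f x <= c.
Proof.
move=> hc; rewrite /dymax.
have H1 : (ereal_sup (range (fun k => (avg k f x)%:E)) <= c%:E)%E.
  by apply: ge_ereal_sup => _ [k _ <-]; rewrite lee_fin.
have H2 : ((avg 0 f x)%:E <= ereal_sup (range (fun k => (avg k f x)%:E)))%E.
  by apply: ereal_sup_ubound; exists 0%N.
move: H1 H2; case: (ereal_sup _) => [t|//|//] /=; by rewrite lee_fin.
Qed.

Lemma le_dyadic_max_dymax f : le_dyadic_max mu pi f (dymax f).
Proof. by apply: aeW => x c; exact: dymax_le. Qed.

Lemma avg_le_dymax f x c : (forall k, avg k f x <= c) -> forall k, avg k f x <= dymax f x.
Proof.
move=> hc k; rewrite /dymax.
have H1 : (ereal_sup (range (fun k => (avg k f x)%:E)) <= c%:E)%E.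
  by apply: ge_ereal_sup => _ [j _ <-]; rewrite lee_fin.
have H2 : ((avg k f x)%:E <= ereal_sup (range (fun k => (avg k f x)%:E)))%E.
  by apply: ereal_sup_ubound; exists k.
move: H1 H2; case: (ereal_sup _) => [t|//|//] /= _; by rewrite lee_fin.
Qed.

(** Outside the null intersection of the level domains there is a last level reached, and it
    dominates all the averages. *)
Lemma avg_bounded_ae h : locint mu pi h ->
  {ae mu, forall x, exists c, forall k, avg k h x <= c}.
Proof.
move=> lh; have ht := level_tower hpi lh.
have [A [mA A0 AN]] := tower_negligible ht.
exists A; split => // x nx; apply: AN => k _; apply: contrapT => nk; apply: nx.
have [p0|np0] := boolP (0 < avg 0 h x); last first.
  by exists 0 => i; exact: (avg0_eq0 hpi).
have x0 : level_time mu pi D h 0%N x <> None.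
  move=> /level_time_None/(_ 0%N).
  by rewrite /level_reached p0 expr0 mul1r lexx.
have nk' : level_time mu pi D h k x = None by exact: contrapT.
have [j [xj1 xj2]] := exists_stratum x0 nk'.
move: xj1; rewrite /stopdom /=; case E : (level_time _ _ _ _ j x) => [m|//] _.
exists (2 * D * avg m h x) => i.
by apply: (level_dominates hpi i lh E); exact: contrapT.
Qed.

Lemma avg_le_dymax_ae h : locint mu pi h ->
  {ae mu, forall x, forall k, avg k h x <= dymax h x}.
Proof.
by move=> /avg_bounded_ae; apply: filterS => x [c hc]; exact: avg_le_dymax hc.
Qed.

End DyadicDual.

(** * Cubes and grids *)

Section Boxes.
Context {R : realType}.

Lemma tuple_measurable_coord n (i : 'I_n) (A : set R) : measurable A ->
  measurable [set t : n.-tuple (measurableTypeR R) | A (tnth t i)].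
Proof.
move=> mA; have := @measurable_tnth _ (measurableTypeR R) n i measurableT A mA.
by rewrite setTI.
Qed.

Lemma borel_box_measurable n (A : 'I_n -> set R) : (forall i, measurable (A i)) ->
  measurable [set t : n.-tuple (measurableTypeR R) | forall i, A i (tnth t i)].
Proof.
move=> mA.
rewrite (_ : [set _ | _] = \bigcap_(i in [set: 'I_n]) [set t | A i (tnth t i)]).
  apply: fin_bigcap_measurable => // i _; exact: tuple_measurable_coord.
by apply/seteqP; split=> [t tA i _|t tA i]; exact: tA.
Qed.

Lemma borel_lebesgue_box n (A : 'I_n -> set R) : (forall i, measurable (A i)) ->
  (forall i, lebesgue_measure (A i) < +oo)%E ->
  borel_lebesgue n [set t : n.-tuple (measurableTypeR R) | forall i, A i (tnth t i)] =
  (\prod_(i < n) fine (lebesgue_measure (A i)))%:E.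
Proof.
elim: n A => [|n ih] A mA fA.
  rewrite big_ord0 /= diracE mem_set// => -[]//.
have mA' i : measurable (A (lift ord0 i)) by [].
rewrite big_ord_recl /= /lebesgue_succ /pushforward.
pose A' (i : 'I_n) : set R := A (lift ord0 i).
rewrite (_ : _ @^-1` _ = A ord0 `*` [set t : n.-tuple (measurableTypeR R) | forall i, A' i (tnth t i)]).
  have mB := @borel_box_measurable n A' mA'.
  rewrite product_measure1E; [|exact: (mA ord0)|exact: mB].
  by rewrite (ih A' mA' (fun i => fA _)) EFinM fineK// ge0_fin_numE.
apply/seteqP; split=> [[x t] /= H|[x t] /= [xA tA] i].
  split; first exact: (H ord0).
  move=> i; have := H (lift ord0 i).
  by rewrite (tnth_nth x) /= (tnth_nth x).
have [j ->|->] := unliftP ord0 i; last exact: xA.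
by have := tA j; rewrite /A' (tnth_nth x) => h; rewrite (tnth_nth x).
Qed.

Context {n : nat}.

Lemma Rn_measurable_borel (A : set (n.-tuple (measurableTypeR R))) :
  measurable A -> measurable (A : set (Rn R n)).
Proof.
move=> mA; apply: (@sub_caratheodory _ _ _ (@borel_lebesgue R n)).
exact: sub_sigma_algebra.
Qed.

Lemma lebesgue_borel (A : set (n.-tuple (measurableTypeR R))) :
  measurable A -> lebesgue (A : set (Rn R n)) = borel_lebesgue n A.
Proof. by move=> mA; rewrite /lebesgue /completed_measure_extension measurable_mu_extE. Qed.

Definition box (A : 'I_n -> set R) : set (Rn R n) := [set x | forall i, A i (coord x i)].

Lemma box_measurable (A : 'I_n -> set R) : (forall i, measurable (A i)) -> measurable (box A).
Proof. by move=> mA; apply: Rn_measurable_borel; exact: borel_box_measurable. Qed.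

Lemma lebesgue_box (A : 'I_n -> set R) : (forall i, measurable (A i)) ->
  (forall i, lebesgue_measure (A i) < +oo)%E ->
  lebesgue (box A) = (\prod_(i < n) fine (lebesgue_measure (A i)))%:E.
Proof.
by move=> mA fA; rewrite lebesgue_borel ?borel_lebesgue_box//; exact: borel_box_measurable.
Qed.

Lemma coord_measurable (i : 'I_n) (A : set R) : measurable A ->
  measurable [set x : Rn R n | A (coord x i)].
Proof. by move=> mA; apply: Rn_measurable_borel; exact: tuple_measurable_coord. Qed.

Lemma cubeE (a : Rn R n) (l : R) :
  cube a l = box (fun i => `]coord a i, coord a i + l[%classic).
Proof.
by apply/seteqP; split=> x xa i; have := xa i; rewrite /= in_itv.
Qed.

Lemma cube_measurable (a : Rn R n) l : measurable (cube a l).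
Proof. by rewrite cubeE; apply: box_measurable => i; exact: measurable_itv. Qed.

Lemma lebesgue_itvoo_fin (u l : R) : 0 <= l ->
  lebesgue_measure `]u, u + l[%classic = l%:E.
Proof.
move=> l0; rewrite lebesgue_measure_itv /= lte_fin ltrDl.
move: l0; rewrite le_eqVlt => /orP[/eqP <-|->]; first by rewrite ltxx.
by rewrite -EFinB addrC addKr.
Qed.

Lemma lebesgue_itvco_fin (u l : R) : 0 <= l ->
  lebesgue_measure `[u, u + l[%classic = l%:E.
Proof.
move=> l0; rewrite lebesgue_measure_itv /= lte_fin ltrDl.
move: l0; rewrite le_eqVlt => /orP[/eqP <-|->]; first by rewrite ltxx.
by rewrite -EFinB addrC addKr.
Qed.

Lemma lebesgue_cube (a : Rn R n) l : 0 <= l -> lebesgue (cube a l) = (l ^+ n)%:E.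
Proof.
move=> l0; rewrite cubeE lebesgue_box => [|i|i]; last first.
- by rewrite lebesgue_itvoo_fin// ltry.
- exact: measurable_itv.
congr EFin; rewrite (eq_bigr (fun=> l)) ?prodr_const ?card_ord// => i _.
by rewrite lebesgue_itvoo_fin.
Qed.

End Boxes.

(** The floor of 2 u + c is 2 floor(u) + c or one more, so it determines the floor of u. This is how
    a child cell determines its parent. *)
Lemma floor_half (R : realType) (u v : R) (c : int) :
  Num.floor (2 * u + c%:~R) = Num.floor (2 * v + c%:~R) -> Num.floor u = Num.floor v.
Proof.
have H (w : R) : (2 * Num.floor w + c <= Num.floor (2 * w + c%:~R) <= 2 * Num.floor w + c + 1)%R.
  have /andP[w1 w2] := floor_itv w; rewrite intrD in w2.
  have /andP[p1 p2] := floor_itv (2 * w + c%:~R); rewrite intrD in p2.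
  apply/andP; split.
    by rewrite floor_ge_int intrD intrM; lra.
  by rewrite -ltzD1 -(ltr_int R) !intrD intrM; lra.
by have := H u; have := H v; lia.
Qed.

Section Grid.
Context {R : realType} {n : nat}.
Variables (L : R) (alpha : {ffun 'I_n -> bool}).
Hypothesis L0 : 0 < L.

Definition gside k : R := L / 2 ^+ k.

Definition gshift k (i : 'I_n) : R := (alpha i)%:R * (-1) ^+ k / 3.

(* Index of the level k cell containing x. The shift by a third of the side
   length alternates in sign so that the grids of successive levels are nested. *)
Definition gidx k (x : Rn R n) : {ffun 'I_n -> int} :=
  [ffun i => Num.floor (coord x i / gside k - gshift k i)].

Lemma gside_gt0 k : 0 < gside k.
Proof. by rewrite divr_gt0// exprn_gt0. Qed.

Definition glow k (x : Rn R n) (i : 'I_n) : R :=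
  ((gidx k x i)%:~R + gshift k i) * gside k.

Lemma gidx_eq k x y : gidx k y = gidx k x <->
  forall i, glow k x i <= coord y i < glow k x i + gside k.
Proof.
have s0 := gside_gt0 k.
have H i m : (Num.floor (coord y i / gside k - gshift k i) = m) <->
    ((m%:~R + gshift k i) * gside k <= coord y i < (m%:~R + gshift k i) * gside k + gside k).
  have E : (Num.floor (coord y i / gside k - gshift k i) == m) =
      ((m%:~R + gshift k i) * gside k <= coord y i < (m%:~R + gshift k i) * gside k + gside k).
    rewrite floor_eq lerBrDr ler_pdivlMr// ltrBlDr ltr_pdivrMr//.
    by rewrite intrD; congr (_ && (_ < _)); ring.
  by split => [/eqP|h]; [rewrite E|apply/eqP; rewrite E].
split => [e i|h]; first by apply/H; have /ffunP/(_ i) := e; rewrite ffunE.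
by apply/ffunP => i; rewrite [LHS]ffunE; apply/H; exact: h.
Qed.

Lemma gcellE k x : cell gidx k x =
  box (fun i => `[glow k x i, glow k x i + gside k[%classic).
Proof.
apply/seteqP; split => y.
  by move=> /gidx_eq h i /=; rewrite in_itv /=; exact: h.
by move=> h; apply/gidx_eq => i; have := h i; rewrite /= in_itv.
Qed.

Lemma gcell_measurable k x : measurable (cell gidx k x).
Proof. by rewrite gcellE; apply: box_measurable => i; exact: measurable_itv. Qed.

Lemma lebesgue_gcell k x : lebesgue (cell gidx k x) = (gside k ^+ n)%:E.
Proof.
have s0 := ltW (gside_gt0 k).
rewrite gcellE lebesgue_box => [|i|i]; last first.
- by rewrite lebesgue_itvco_fin// ltry.
- exact: measurable_itv.
congr EFin; rewrite (eq_bigr (fun=> gside k)) ?prodr_const ?card_ord// => i _.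
by rewrite lebesgue_itvco_fin.
Qed.

Lemma gsideS k : gside k = 2 * gside k.+1.
Proof. by rewrite /gside exprS; field; rewrite expf_neq0. Qed.

Lemma grid_filtration : filtration lebesgue gidx (2 ^+ n).
Proof.
split.
- exact: gcell_measurable.
- move=> k x; suff : (0 < (gside k ^+ n)%:E)%E by rewrite -(lebesgue_gcell k x).
  by rewrite lte_fin exprn_gt0// gside_gt0.
- move=> k x; suff : ((gside k ^+ n)%:E < +oo)%E by rewrite -(lebesgue_gcell k x).
  exact: ltry.
- move=> k x y /ffunP e; apply/ffunP => i; have := e i; rewrite !ffunE.
  have s0 := gside_gt0 k.+1.
  (* Doubling a shift by a third gives two thirds, which is minus a third up to an integer: hence
     the alternating sign. *)
  have aux z : z / gside k.+1 - gshift k.+1 i =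
      2 * (z / gside k - gshift k i) + ((alpha i)%:Z * (-1) ^+ k)%:~R.
    rewrite (gsideS k) /gshift exprS intrM rmorphXn /= rmorphN1 -pmulrn.
    by field; rewrite gt_eqF.
  by rewrite !aux => /floor_half.
- by apply: exprn_ege1; lra.
- move=> k x; suff : ((gside k ^+ n)%:E <= (2 ^+ n)%:E * (gside k.+1 ^+ n)%:E)%E.
    by rewrite -(lebesgue_gcell k x) -(lebesgue_gcell k.+1 x).
  by rewrite -EFinM lee_fin gsideS exprMn.
Qed.

(** Doubling the side leaves room for a half-open cell inside an open cube. *)
Lemma gcell_sub_cube k x : exists a, cube a (2 * gside k) x /\
  cell gidx k x `<=` cube a (2 * gside k).
Proof.
pose a : Rn R n := [tuple glow k x i - gside k / 2 | i < n].
have aE i : coord a i = glow k x i - gside k / 2 by rewrite /coord tnth_mktuple.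
have s0 := gside_gt0 k.
have H y : cell gidx k x y -> cube a (2 * gside k) y.
  by move=> /gidx_eq h i; rewrite aE; have := h i; lra.
by exists a; split => //; apply: H.
Qed.

End Grid.

(** If the interval, of length at most 1/3, contains an integer, then a translation by a third in
    either direction makes it avoid the integers. *)
Lemma third_trick (R : realType) (u v e : R) : v <= u + 3^-1 -> e = 3^-1 \/ e = - 3^-1 ->
  exists b : bool, forall y z : R, u < y < v -> u < z < v ->
    Num.floor (y - b%:R * e) = Num.floor (z - b%:R * e).
Proof.
move=> uv he; pose m := Num.floor u + 1.
have := floor_itv u; rewrite -/m => /andP[um1 um].
have mE : m%:~R = (Num.floor u)%:~R + 1 :> R by rewrite /m intrD.
have [vm|mv] := leP v m%:~R.
  exists false => y z /andP[uy yv] /andP[uz zv].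
  rewrite !mul0r !subr0.
  by rewrite (@floor_def _ y (m - 1)) ?(@floor_def _ z (m - 1))// subrK;
    rewrite intrB mE; lra.
exists true; case: he => -> y z /andP[uy yv] /andP[uz zv]; rewrite !mul1r.
  by rewrite (@floor_def _ _ (m - 1)) ?(@floor_def _ _ (m - 1))// subrK;
    rewrite intrB mE; lra.
by rewrite (@floor_def _ _ m) ?(@floor_def _ _ m)// intrD mE; lra.
Qed.

(** * The local maximal operator and its dyadic counterparts *)

Section LocalMaximal.
Context {R : realType} {n : nat}.
Implicit Types (f g h : Rn R n -> R) (x a : Rn R n) (rho l : R).

Lemma averageE f a l : 0 < l -> average f (cube a l) =
  ((l ^+ n)^-1%:E * \int[lebesgue]_(y in cube a l) `|f y|%:E)%E.
Proof.
move=> l0; have ln0 : 0 < l ^+ n by rewrite exprn_gt0.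
by rewrite /average lebesgue_cube ?(ltW l0)// inver gt_eqF.
Qed.

Lemma Mloc_ge rho f x a l : 0 < l -> l <= rho -> cube a l x ->
  (\int[lebesgue]_(y in cube a l) `|f y|%:E <= (l ^+ n)%:E * Mloc rho f x)%E.
Proof.
move=> l0 lr xa; have ln0 : 0 < l ^+ n by rewrite exprn_gt0.
rewrite -lee_pdivrMl// -averageE//; apply: ereal_sup_ubound.
by exists a, l.
Qed.

Lemma Mloc_le rho f x (v : \bar R) :
  (forall a l, 0 < l -> l <= rho -> cube a l x ->
    (\int[lebesgue]_(y in cube a l) `|f y|%:E <= (l ^+ n)%:E * v)%E) ->
  (Mloc rho f x <= v)%E.
Proof.
move=> H; apply: ge_ereal_sup => _ [a [l [l0 lr xa ->]]].
by rewrite averageE// lee_pdivrMl ?exprn_gt0//; exact: H.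
Qed.

Lemma center_cube x l : 0 < l -> exists a, cube a l x.
Proof.
move=> l0; exists [tuple coord x i - l / 2 | i < n] => i.
by rewrite /coord tnth_mktuple; lra.
Qed.

Lemma Mloc_ge0 rho f x : 0 < rho -> (0 <= Mloc rho f x)%E.
Proof.
move=> r0; have [a xa] := center_cube x r0.
rewrite -(@lee_pmul2l _ (rho ^+ n)%:E) ?lte_fin ?exprn_gt0//.
apply: le_trans (Mloc_ge f r0 (lexx _) xa); rewrite mule0.
by apply: integral_ge0 => y _; rewrite lee_fin.
Qed.

Lemma le_Mloc rho f g x : measurable_fun setT f -> measurable_fun setT g ->
  {ae lebesgue, forall y, `|f y| <= `|g y|} -> (Mloc rho f x <= Mloc rho g x)%E.
Proof.
move=> mf mg fg; apply: Mloc_le => a l l0 lr xa; apply: le_trans (Mloc_ge g l0 lr xa).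
apply: le_integral_ae (fg) => [|||y|y].
- exact: cube_measurable.
- exact: measurable_absT mf.
- exact: measurable_absT mg.
- exact: normr_ge0.
- exact: normr_ge0.
Qed.

Lemma MlocZ rho f x (c : R) : measurable_fun setT f -> 0 < rho ->
  (Mloc rho (fun y => (c * f y)%R) x <= `|c|%:E * Mloc rho f x)%E.
Proof.
move=> mf r0; apply: Mloc_le => a l l0 lr xa; rewrite muleCA.
have H := Mloc_ge f l0 lr xa.
apply: (@le_trans _ _ (`|c|%:E * \int[lebesgue]_(y in cube a l) `|f y|%:E)%E); last first.
  by apply: lee_wpmul2l H; rewrite lee_fin.
have mc := cube_measurable a l.
rewrite -(integralZ lebesgue mc (normr_ge0 c) (fun y => normr_ge0 (f y)) (measurable_absT mf)).
by apply: le_integral_ge0 => y _; rewrite lee_fin ?normrM.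
Qed.

Lemma Mloc_series rho f (g : nat -> Rn R n -> R) x : measurable_fun setT f ->
  (forall k, measurable_fun setT (g k)) ->
  {ae lebesgue, forall y, `|f y|%:E <= \sum_(0 <= k <oo) `|g k y|%:E}%E -> 0 < rho ->
  (Mloc rho f x <= \sum_(0 <= k <oo) Mloc rho (g k) x)%E.
Proof.
move=> mf mg fg r0; apply: Mloc_le => a l l0 lr xa.
have mc := cube_measurable a l.
apply: (le_trans (le_integral_ae_series mc (measurable_absT mf) (fun k => measurable_absT (mg k))
  (fun y => normr_ge0 _) (fun k y => normr_ge0 _) fg)).
have l1 : (0 <= (l ^+ n)%:E)%E by rewrite lee_fin exprn_ge0// ltW.
rewrite -nneseriesZl//; last by move=> k _; exact: Mloc_ge0.
apply: lee_nneseries => [k _ _|k _]; last exact: Mloc_ge.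
by apply: integral_ge0 => y _; rewrite lee_fin.
Qed.

(* A cube of side 3t is covered by its 2^n corner subcubes of side 2t, all of
   which contain the central subcube of side t. *)
Lemma Mloc_enlarge rho f g x : 0 < rho -> measurable_fun setT f -> measurable_fun setT g ->
  {ae lebesgue, forall y, Mloc rho f y <= (g y)%:E}%E ->
  (Mloc (3 / 2 * rho) f x <= (4 ^+ n)%:E * Mloc rho g x)%E.
Proof.
move=> r0 mf mg fg; apply: Mloc_le => a l l0 lr xa.
pose t := l / 3; have lt3 : l = 3 * t by rewrite /t; field.
have t0 : 0 < t by rewrite divr_gt0.
have t20 : 0 < 2 * t by rewrite mulr_gt0.
have t2r : 2 * t <= rho by move: lr; rewrite lt3; lra.
pose ac : Rn R n := [tuple coord a i + t | i < n].
pose as_ (s : {ffun 'I_n -> bool}) : Rn R n := [tuple coord a i + (s i)%:R * t | i < n].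
have acE i : coord ac i = coord a i + t by rewrite /coord tnth_mktuple.
have asE s i : coord (as_ s) i = coord a i + (s i)%:R * t by rewrite /coord tnth_mktuple.
have cover y : cube a l y -> exists s, cube (as_ s) (2 * t) y.
  move=> ya; exists [ffun i => coord a i + 2 * t <= coord y i] => i.
  rewrite asE ffunE; have := ya i; rewrite lt3.
  by have [h1|h1] := leP (coord a i + 2 * t) (coord y i) => /andP[h2 h3]; rewrite ?mul1r ?mul0r;
    apply/andP; split; move: h1 h2 h3; lra.
have center s y : cube ac t y -> cube (as_ s) (2 * t) y.
  move=> yc i; have := yc i; rewrite asE acE.
  by case: (s i) => /= /andP[h2 h3]; apply/andP; split; lra.
have [tau xt] := cover _ xa.
have tn0 : 0 < t ^+ n by rewrite exprn_gt0.
have t2n0 : 0 < (2 * t) ^+ n by rewrite exprn_gt0.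
have M0 : (0 <= Mloc rho g x)%E by exact: Mloc_ge0.
(* For y in the central cube the integral over the corner is at most (2 t)^n M f(y). Integrating
   over y, and bounding the integral of g by M g at x, which lies in the corner [tau], gives (2
   t)^(2 n) / t^n = 4^n t^n. *)
have corner s : (\int[lebesgue]_(y in cube (as_ s) (2 * t)) `|f y|%:E <=
    (4 ^+ n * t ^+ n)%:E * Mloc rho g x)%E.
  have tE : (0 < (t ^+ n)%:E)%E by rewrite lte_fin.
  have t2E : (0 <= ((2 * t) ^+ n)%:E)%E by rewrite lee_fin ltW.
  rewrite -(@lee_pmul2r _ (t ^+ n)%:E) => [||]; [|by []|exact: tE].
  apply: (@le_trans _ _ (((2 * t) ^+ n)%:E * (((2 * t) ^+ n)%:E * Mloc rho g x))%E); last first.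
    rewrite (muleAC _ (Mloc rho g x)) muleA -!EFinM; apply: (lee_wpmul2r M0).
    by rewrite lee_fin -!exprMn; apply: eq_ler; congr (_ ^+ n); ring.
  have mct := cube_measurable ac t.
  set I0 := (X in (X * _)%E).
  have I00 : (0 <= I0)%E by apply: integral_ge0 => z _; rewrite lee_fin.
  apply: (@le_trans _ _ (((2 * t) ^+ n)%:E * \int[lebesgue]_(y in cube ac t) `|g y|%:E)%E); last first.
    apply: (lee_wpmul2l t2E).
    apply: le_trans (Mloc_ge g t20 t2r xt).
    by apply: le_integral_sub; [move=> y; rewrite lee_fin|exact: center].
  rewrite -(lebesgue_cube ac (ltW t0)) -(integral_cst lebesgue mct).
  rewrite -(integralZ lebesgue mct (ltW t2n0) (fun y => normr_ge0 (g y)) (measurable_absT mg)).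
  apply: (ae_ge0_le_integral mct).
  - by move=> y _; exact: I00.
  - exact: measurable_cst.
  - by move=> y _; rewrite lee_fin mulr_ge0// ltW.
  - by apply: measurable_funTS; apply: measurable_EFinT; apply: measurable_scaleT; exact: measurable_absT mg.
  apply: filterS fg => y hy yc.
  apply: (le_trans (Mloc_ge f t20 t2r (center s _ yc))).
  rewrite EFinM; apply: (lee_wpmul2l t2E).
  by apply: (le_trans hy); rewrite lee_fin ler_norm.
have mcs s : measurable (cube (as_ s) (2 * t) : set (Rn R n)) by exact: cube_measurable.
apply: (@le_trans _ _ (\sum_(s : {ffun 'I_n -> bool}) \int[lebesgue]_(y in cube (as_ s) (2 * t)) `|f y|%:E)%E).
  have -> : (\sum_(s : {ffun 'I_n -> bool}) \int[lebesgue]_(y in cube (as_ s) (2 * t)) `|f y|%:E =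
      \sum_(s : {ffun 'I_n -> bool}) \int[lebesgue]_y (`|f y| * \1_(cube (as_ s) (2 * t)) y)%:E)%E.
    by apply: eq_bigr => s _; exact: integral_restr.
  have i0 s y : 0 <= \1_(cube (as_ s) (2 * t)) y :> R by rewrite indicE ler0n.
  rewrite -(integral_sumT lebesgue measurableT
     (fun s => measurable_restrT (mcs s) (measurable_absT mf))
     (fun s y => mulr_ge0 (normr_ge0 _) (i0 s y))).
  rewrite integral_restr; apply: le_integral_ge0 => y _.
    by rewrite lee_fin mulr_ge0// indicE ler0n.
  rewrite lee_fin [in leLHS]indicE; case: (boolP (y \in _)) => [/set_mem ya|_]; last first.
    by rewrite mulr0; apply: sumr_ge0 => s _; rewrite mulr_ge0.
  have [s ys] := cover _ ya; rewrite (bigD1 s)//= [in leRHS]indicE mem_set//.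
  by rewrite lerDl sumr_ge0// => s' _; rewrite mulr_ge0.
apply: (@le_trans _ _ (\sum_(s : {ffun 'I_n -> bool}) ((4 ^+ n * t ^+ n)%:E * Mloc rho g x))%E).
  by apply: lee_sum => s _; exact: corner.
rewrite -ge0_sume_distrl; last by move=> s _; rewrite lee_fin mulr_ge0 ?exprn_ge0// ltW.
rewrite muleA; apply: lee_wpmul2r => //.
have -> : (\sum_(s : {ffun 'I_n -> bool}) (4 ^+ n * t ^+ n)%:E)%E = (2 ^+ n * (4 ^+ n * t ^+ n))%:E :> \bar R.
  rewrite sumEFin; congr EFin.
  by rewrite big_const card_ffun card_bool card_ord iter_addr_0 -[LHS]mulr_natl natrX.
(* The number 2^n of corners is absorbed by (3 t)^n / t^n = 3^n. *)
rewrite -EFinM lee_fin -!exprMn lt3; apply: lerXn2r; rewrite ?nnegrE ?mulr_ge0 ?(ltW t0)//; move: t0; lra.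
Qed.

(** Local integrability of a signed function, tested on cubes of every size; it implies [locint] of
    |f| for each grid. *)
Definition lint f := measurable_fun setT f /\
  forall a l, 0 < l -> (\int[lebesgue]_(y in cube a l) `|f y|%:E < +oo)%E.

Lemma lint_locint f L alpha : 0 < L -> lint f ->
  locint lebesgue (gidx L alpha) (fun x => `|f x|).
Proof.
move=> L0 [mf lf]; split; [exact: measurable_absT mf|by move=> x; exact: normr_ge0|move=> x].
have [a [_ sub]] := gcell_sub_cube alpha L0 0 x.
have s0 : 0 < 2 * gside L 0 by rewrite mulr_gt0// gside_gt0.
apply: (le_lt_trans _ (lf a _ s0)).
by apply: le_integral_sub; [move=> y; rewrite lee_fin|exact: sub].
Qed.

(** A cell lies in an open cube of twice its side, whence 2^n and the condition on the scales. *)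
Lemma avg_le_Mloc f L alpha rho k x : 0 < L -> 2 * L <= rho -> lint f ->
  ((avg lebesgue (gidx L alpha) k (fun y => `|f y|%R) x)%:E <= (2 ^+ n)%:E * Mloc rho f x)%E.
Proof.
move=> L0 Lr lf; have hpi := grid_filtration alpha L0.
have s0 := gside_gt0 L0 k.
have [a [xa sub]] := gcell_sub_cube alpha L0 k x.
have sr : 2 * gside L k <= rho.
  apply: le_trans Lr; rewrite ler_pM2l// /gside ler_pdivrMr ?exprn_gt0//.
  by rewrite ler_peMr ?(ltW L0)// exprn_ege1// ler1n.
rewrite -(@lee_pmul2r _ (gside L k ^+ n)%:E) ?lte_fin ?exprn_gt0// -EFinM.
have mE : mass lebesgue (gidx L alpha) k x = gside L k ^+ n.
  apply: EFin_inj; rewrite -(massE hpi); exact: lebesgue_gcell.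
rewrite -mE -(avgE hpi k x (lint_locint alpha L0 lf)).
apply: (@le_trans _ _ (\int[lebesgue]_(y in cube a (2 * gside L k)) `|f y|%:E)%E).
  by apply: le_integral_sub; [move=> y; rewrite lee_fin|exact: sub].
apply: (le_trans (Mloc_ge f _ sr xa)); first by rewrite mulr_gt0.
by rewrite mE exprMn EFinM muleAC.
Qed.

Lemma gside_small L l : 0 < L -> 0 < l -> exists k, gside L k < l.
Proof.
move=> L0 l0; exists (Num.bound (L / l)).
rewrite /gside ltr_pdivrMr ?exprn_gt0// mulrC -ltr_pdivrMr//.
apply: (lt_le_trans (archi_boundP _)); first by rewrite divr_ge0// ltW.
by rewrite -natrX ler_nat ltnW// ltn_expl.
Qed.

(** A cube of side l <= L / 3 lies in a cell, of side between 3 l and 6 l, of one of the 2^n grids.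
    The hypothesis on the averages excludes the points where some [dymax] takes its default
    value. *)
Lemma Mloc_le_dymax f L x : 0 < L -> lint f ->
  (forall (alpha : {ffun 'I_n -> bool}) k, avg lebesgue (gidx L alpha) k (fun y => `|f y|) x <=
     dymax lebesgue (gidx L alpha) (fun y => `|f y|) x) ->
  (Mloc (L / 3) f x <= (6 ^+ n * \sum_(alpha : {ffun 'I_n -> bool})
     dymax lebesgue (gidx L alpha) (fun y => `|f y|) x)%:E)%E.
Proof.
move=> L0 lf hx; apply: Mloc_le => a l l0 lr xa.
have [k [sk1 sk2]] : exists k, 3 * l <= gside L k /\ gside L k < 6 * l.
  have [j hj] : exists j, gside L j < 3 * l by apply: gside_small; rewrite ?mulr_gt0.
  (* Going back from a level of side below 3 l, the first level met with side at least 3 l has side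
     below 6 l. *)
  elim: j hj => [|j ih] hj.
    by move: hj; rewrite /gside expr0 divr1; move: lr; lra.
  have [?|?] := leP (3 * l) (gside L j); last exact: ih.
  by exists j; split => //; rewrite gsideS; move: hj; lra.
have s0 := gside_gt0 L0 k.
have third (i : 'I_n) := @third_trick R (coord a i / gside L k)
   ((coord a i + l) / gside L k) ((-1) ^+ k / 3).
have H (i : 'I_n) : exists b : bool, forall y z : R,
    coord a i / gside L k < y < (coord a i + l) / gside L k ->
    coord a i / gside L k < z < (coord a i + l) / gside L k ->
    Num.floor (y - b%:R * ((-1) ^+ k / 3)) = Num.floor (z - b%:R * ((-1) ^+ k / 3)).
  apply: third; first by rewrite mulrDl lerD2l ler_pdivrMr//; move: sk1; lra.
  by rewrite -signr_odd; case: (odd k); rewrite ?expr1 ?expr0 ?mulN1r ?mul1r; [right|left].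
have [b hb] := fin_all_exists H.
pose alpha : {ffun 'I_n -> bool} := [ffun i => b i].
have hsub : cube a l `<=` cell (gidx L alpha) k x.
  move=> y ya; apply/ffunP => i; rewrite !ffunE /gshift ffunE -!mulrA.
  by apply: hb; rewrite !ltr_pM2r ?invr_gt0//.
have lac := lint_locint alpha L0 lf.
have hpi := grid_filtration alpha L0.
have mE : mass lebesgue (gidx L alpha) k x = gside L k ^+ n.
  apply: EFin_inj; rewrite -(massE hpi); exact: lebesgue_gcell.
apply: (@le_trans _ _ (\int[lebesgue]_(y in cell (gidx L alpha) k x) `|f y|%:E)%E).
  by apply: le_integral_sub; [move=> y; rewrite lee_fin|exact: hsub].
rewrite (avgE hpi k x lac) mE -EFinM lee_fin.
have d0 al : 0 <= dymax lebesgue (gidx L al) (fun y => `|f y|) x.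
  exact: (dymax_ge0 (grid_filtration al L0)).
apply: (@le_trans _ _ (dymax lebesgue (gidx L alpha) (fun y => `|f y|) x * (6 * l) ^+ n)).
  apply: ler_pM => //; first exact: (avg_ge0 hpi).
  - by rewrite exprn_ge0// ltW.
  - apply: lerXn2r; rewrite ?nnegrE ?(ltW s0) ?(ltW sk2)// mulr_ge0// ltW//.
rewrite exprMn mulrCA mulrA mulrC; apply: ler_wpM2l; first by rewrite exprn_ge0// ltW.
apply: ler_wpM2l; first by rewrite exprn_ge0.
by rewrite (bigD1 alpha)//= lerDl sumr_ge0.
Qed.

(** A superlevel set is a union of open cubes, and each point of such a cube has a small dyadic cell
    inside it, so [dyadic_measurable] applies. *)
Lemma Mloc_measurable rho f : measurable_fun setT (Mloc rho f).
Proof.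
pose al : {ffun 'I_n -> bool} := [ffun=> false].
have hpi := @grid_filtration R n 1 al ltr01.
apply: emeasurable_ray => r; apply: (dyadic_measurable hpi) => x /=.
move=> /ereal_sup_gt[_ [a [l [l0 lr xa ->]]] rx].
have /fin_all_exists[kk hk] (i : 'I_n) : exists k,
    gside 1 k < coord x i - coord a i /\ gside 1 k < coord a i + l - coord x i.
  have /andP[h1 h2] := xa i.
  have [|k1 hk1] := @gside_small 1 (coord x i - coord a i) ltr01; first by rewrite subr_gt0.
  have [|k2 hk2] := @gside_small 1 (coord a i + l - coord x i) ltr01; first by rewrite subr_gt0.
  have mono j k : (j <= k)%N -> gside 1 k <= gside 1 j :> R.
    move=> jk; rewrite /gside !div1r lef_pV2 ?posrE ?exprn_gt0//.
    by apply: ler_weXn2l => //; rewrite ler1n.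
  exists (maxn k1 k2); split.
    exact: le_lt_trans (mono _ _ (leq_maxl _ _)) hk1.
  exact: le_lt_trans (mono _ _ (leq_maxr _ _)) hk2.
pose k := \max_i kk i.
have mono j : (j <= k)%N -> gside 1 k <= gside 1 j :> R.
  move=> jk; rewrite /gside !div1r lef_pV2 ?posrE ?exprn_gt0//.
  by apply: ler_weXn2l => //; rewrite ler1n.
exists k => y xy /=.
apply: (lt_le_trans rx); apply: ereal_sup_ubound; exists a, l; split => // i.
have [h1 h2] := hk i; have h3 := mono _ (leq_bigmax i : (kk i <= k)%N).
have /(gidx_eq al ltr01)/(_ i) /andP[y1 y2] := xy.
have /(gidx_eq al ltr01)/(_ i) /andP[x1 x2] := cell_refl (gidx 1 al) k x.
by apply/andP; split; lra.
Qed.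

End LocalMaximal.

(** * Function spaces *)

Section LatticeSpace.
Context {R : realType} {n : nat}.
Implicit Types (Y Z : fspace R n) (f g h : Rn R n -> R) (F G : Rn R n -> \bar R).

(** What [Y], its powers and their associate spaces have in common. The Fatou property is phrased
    with a supremum and an explicit bound, the form in which it passes to powers and duals. *)
Record fatou_lattice Z : Prop := {
  fl_measurable : forall f, Z f -> measurable_fun setT f ;
  fl_zero : Z (cst 0) ;
  fl_ge0 : forall f, Z f -> 0 <= fnorm Z f ;
  fl_scale : forall (c : R) f, Z f -> Z (fun x => c * f x) ;
  fl_normZ : forall (c : R) f, Z f ->
    fnorm Z (fun x => c * f x) = `|c| * fnorm Z f ;
  fl_lattice : forall f g, Z f -> measurable_fun setT g ->
    {ae lebesgue, forall x, `|g x| <= `|f x|} ->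
    Z g /\ fnorm Z g <= fnorm Z f ;
  fl_fatou : forall (f_ : nat -> Rn R n -> R) F (c : R), (forall k, Z (f_ k)) ->
    (forall k, fnorm Z (f_ k) <= c) ->
    {ae lebesgue, forall x,
      [/\ forall k, 0 <= f_ k x, forall k, f_ k x <= f_ k.+1 x
        & F x = ereal_sup (range (fun k => (f_ k x)%:E))]} ->
    (xnorm Z F <= c%:E)%E }.

(** Kept apart from [fatou_lattice] because a quasi-norm such as that of [Y] may fail it. *)
Definition triangle Z := forall f g, Z f -> Z g ->
  Z (fun x => f x + g x) /\ fnorm Z (fun x => f x + g x) <= fnorm Z f + fnorm Z g.

Lemma xnorm_le_mem Z f F : Z f -> {ae lebesgue, forall x, F x = (f x)%:E} ->
  (xnorm Z F <= (fnorm Z f)%:E)%E.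
Proof. by move=> Zf Ff; apply: ereal_inf_lbound; exists f. Qed.

Lemma xnorm_congr Z F G : {ae lebesgue, forall x, F x = G x} -> xnorm Z F = xnorm Z G.
Proof.
move=> FG; congr ereal_inf; apply/seteqP; split => v [f [Zf fF] <-]; exists f => //; split => //.
  by apply: filterS2 FG fF => x -> ->.
by apply: filterS2 FG fF => x -> ->.
Qed.

Lemma fatou_lattice_bqb Y : ball_quasi_banach Y -> fatou_lattice Y.
Proof.
move=> bY; split.
- exact: bqb_measurable bY.
- exact: bqb_zero bY.
- exact: bqb_norm_ge0 bY.
- exact: bqb_scale bY.
- exact: bqb_normZ bY.
- exact: bqb_lattice bY.
- move=> f_ F c Zf fc fF; rewrite (@bqb_fatou _ _ _ bY f_ F Zf).
  + by apply: ge_ereal_sup => _ [k _ <-]; rewrite lee_fin.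
  + apply: filterS fF => x [h0 h1 ->]; split => //.
    apply: ereal_nondecreasing_cvgn; apply/nondecreasing_seqP => k.
    by rewrite lee_fin.
  + apply: (@le_lt_trans _ _ c%:E); last by rewrite ltry.
    by apply: ge_ereal_sup => _ [k _ <-]; rewrite lee_fin.
Qed.

Section Lattice.
Variable Z : fspace R n.
Hypothesis lZ : fatou_lattice Z.

Lemma xnormE f : Z f -> xnorm Z (fun x => (f x)%:E) = (fnorm Z f)%:E.
Proof.
move=> Zf; apply/eqP; rewrite eq_le; apply/andP; split.
  by apply: xnorm_le_mem => //; apply: aeW.
apply: le_ereal_inf_tmp => _ [g [Zg fg] <-]; rewrite lee_fin.
apply: (fl_lattice lZ Zg (fl_measurable lZ Zf) _).2.
by apply: filterS fg => x [->].
Qed.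

Lemma xnorm_rep F : (xnorm Z F < +oo)%E ->
  exists f, [/\ Z f, {ae lebesgue, forall x, F x = (f x)%:E} & xnorm Z F = (fnorm Z f)%:E].
Proof.
move=> /ereal_inf_lt[_ [f [Zf Ff] _] _]; exists f; split => //.
by rewrite -xnormE//; exact: xnorm_congr.
Qed.

Lemma xnorm_rep_le F (c : R) : (xnorm Z F <= c%:E)%E ->
  exists f, [/\ Z f, {ae lebesgue, forall x, F x = (f x)%:E} & fnorm Z f <= c].
Proof.
move=> Fc; have [|f [Zf Ff E]] := @xnorm_rep F; first by rewrite (le_lt_trans Fc)// ltry.
by exists f; split => //; rewrite -lee_fin -E.
Qed.

Lemma xnorm_ge0 F : (0 <= xnorm Z F)%E.
Proof.
apply: le_ereal_inf_tmp => _ [f [Zf _] <-]; rewrite lee_fin; exact: fl_ge0.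
Qed.

Lemma fl_norm0 : fnorm Z (cst 0) = 0.
Proof.
have -> : cst 0 = (fun x => 0 * (cst 0 : Rn R n -> R) x) by apply/funext => x; rewrite mul0r.
by rewrite (fl_normZ lZ _ (fl_zero lZ)) normr0 mul0r.
Qed.

(** Finiteness of the right side makes [F] finite a.e., hence represented by a real function. *)
Lemma xnorm_mono F G : measurable_fun setT F ->
  {ae lebesgue, forall x, 0 <= F x <= G x}%E -> (xnorm Z F <= xnorm Z G)%E.
Proof.
move=> mF FG; have [->|] := eqVneq (xnorm Z G) +oo%E; first exact: leey.
rewrite -ltey => /xnorm_rep[g [Zg Gg ->]].
pose f x := fine (F x).
have Ff : {ae lebesgue, forall x, F x = (f x)%:E /\ `|f x| <= `|g x|}.
  apply: filterS2 FG Gg => x /andP[F0 + E]; rewrite E => Fg.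
  have fF : F x \is a fin_num by rewrite ge0_fin_numE// (le_lt_trans Fg)// ltry.
  have FE : F x = (f x)%:E by rewrite /f fineK.
  move: F0 Fg; rewrite FE !lee_fin => f0 fg.
  by split => //; rewrite (ger0_norm f0) (le_trans fg)// ler_norm.
have mf : measurable_fun setT f by exact: measurableT_comp.
have [Zf fg] := fl_lattice lZ Zg mf (filterS (fun x => @proj2 _ _) Ff).
apply: (@le_trans _ _ (fnorm Z f)%:E); last by rewrite lee_fin.
by apply: xnorm_le_mem => //; apply: filterS Ff => x [].
Qed.

Lemma fl_abs f : Z f -> Z (fun x => `|f x|) /\ fnorm Z (fun x => `|f x|) = fnorm Z f.
Proof.
move=> Zf; have mf := fl_measurable lZ Zf.
have [Za h1] : Z (fun x => `|f x|) /\ fnorm Z (fun x => `|f x|) <= fnorm Z f.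
  by apply: (fl_lattice lZ Zf); [exact: measurable_absT|apply: aeW => x; rewrite normr_id].
split => //; apply/eqP; rewrite eq_le h1/=.
by apply: (fl_lattice lZ Za mf _).2; apply: aeW => x; rewrite normr_id.
Qed.

End Lattice.

Lemma poweR_inv (x : \bar R) (p : R) : 0 < p -> (0 <= x)%E -> ((x `^ p) `^ p^-1 = x)%E.
Proof. by move=> p0 x0; rewrite -poweRrM mulfV ?gt_eqF// poweRe1. Qed.

Lemma poweR_inv' (x : \bar R) (p : R) : 0 < p -> (0 <= x)%E -> ((x `^ p^-1) `^ p = x)%E.
Proof. by move=> p0 x0; rewrite -poweRrM mulVf ?gt_eqF// poweRe1. Qed.

Lemma le_poweR (x y : \bar R) (p : R) : 0 <= p -> (0 <= x)%E -> (x <= y)%E ->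
  (x `^ p <= y `^ p)%E.
Proof.
move=> p0 x0 xy; apply: gt0_ler_poweR => //; rewrite in_itv/= ?x0 ?leey//.
by rewrite (le_trans x0 xy).
Qed.

Lemma powR_inv (x p : R) : 0 < p -> 0 <= x -> (x `^ p) `^ p^-1 = x.
Proof. by move=> p0 x0; rewrite -powRrM mulfV ?gt_eqF// powRr1. Qed.

Lemma powR_inv' (x p : R) : 0 < p -> 0 <= x -> (x `^ p^-1) `^ p = x.
Proof. by move=> p0 x0; rewrite -powRrM mulVf ?gt_eqF// powRr1. Qed.

Lemma le_powR (x y p : R) : 0 <= p -> 0 <= x -> x <= y -> x `^ p <= y `^ p.
Proof.
by move=> p0 x0 xy; apply: ge0_ler_powR; rewrite ?nnegrE// (le_trans x0).
Qed.

(** The power p is an increasing bijection of [0, +oo] with inverse the power 1 / p. *)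
Lemma poweR_sup (I : Type) (u : I -> \bar R) (p : R) : 0 < p -> inhabited I ->
  (forall i, 0 <= u i)%E ->
  (ereal_sup (range u) `^ p = ereal_sup (range (fun i => u i `^ p)))%E.
Proof.
move=> p0 [i0] u0; have s0 : (0 <= ereal_sup (range u))%E.
  by apply: (le_trans (u0 i0)); apply: ereal_sup_ubound; exists i0.
set S := RHS; have S0 : (0 <= S)%E.
  by apply: (le_trans (poweR_ge0 (u i0) p)); apply: ereal_sup_ubound; exists i0.
apply/eqP; rewrite eq_le; apply/andP; split.
  rewrite -(poweR_inv' p0 S0); apply: le_poweR => //; first exact: ltW.
  apply: ge_ereal_sup => _ [i _ <-]; rewrite -(poweR_inv p0 (u0 i)).
  apply: le_poweR; [by rewrite invr_ge0 ltW|exact: poweR_ge0|].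
  by apply: ereal_sup_ubound; exists i.
apply: ge_ereal_sup => _ [i _ <-]; apply: le_poweR => //; first exact: ltW.
by apply: ereal_sup_ubound; exists i.
Qed.

Section Power.
Variables (Y : fspace R n) (r : R).
Hypotheses (lY : fatou_lattice Y) (r0 : 0 < r).
Let ri0 : 0 <= r^-1. Proof. by rewrite invr_ge0 ltW. Qed.

Lemma xnorm_fpow F : {ae lebesgue, forall x, 0 <= F x}%E ->
  xnorm (fpow Y r) F = (xnorm Y (fun x => F x `^ r^-1) `^ r)%E.
Proof.
move=> F0; apply/eqP; rewrite eq_le; apply/andP; split.
  have [->|] := eqVneq (xnorm Y (fun x => F x `^ r^-1)%E) +oo%E.
    by rewrite poweRyr ?gt_eqF// leey.
  rewrite -ltey => /(xnorm_rep lY)[g [Yg Fg ->]].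
  have [Ya aE] := fl_abs lY Yg.
  pose h x := `|g x| `^ r.
  have hE : (fun x => `|h x| `^ r^-1) = (fun x => `|g x|).
    by apply/funext => x; rewrite ger0_norm ?powR_ge0// powR_inv.
  have Xh : fpow Y r h.
    split; last by rewrite hE.
    exact: measurable_powT (measurable_absT (fl_measurable lY Yg)).
  rewrite poweR_EFin -aE -hE; apply: (xnorm_le_mem Xh).
  apply: filterS2 F0 Fg => x x0 E.
  rewrite -(poweR_inv' r0 x0) E poweR_EFin /h ger0_norm//.
  by rewrite -lee_fin -E poweR_ge0.
have [->|] := eqVneq (xnorm (fpow Y r) F) +oo%E; first exact: leey.
rewrite -ltey => /ereal_inf_lt[_ [h [[mh Yh] Fh] _] _].
have hF : {ae lebesgue, forall x, F x = `|h x|%:E}.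
  apply: filterS2 F0 Fh => x + E; rewrite E lee_fin => h0; by rewrite ger0_norm.
apply: le_ereal_inf_tmp => _ [h' [[mh' Yh'] Fh'] <-].
rewrite /fpow/= -poweR_EFin; apply: le_poweR; [exact: ltW|exact: xnorm_ge0|].
apply: (xnorm_le_mem Yh'); apply: filterS2 F0 Fh' => x + E; rewrite E lee_fin => h0.
by rewrite poweR_EFin ger0_norm.
Qed.

Lemma fatou_lattice_fpow : fatou_lattice (fpow Y r).
Proof.
split.
- by move=> f [].
- split; first exact: measurable_cst.
  have -> : (fun x : Rn R n => `|(cst 0 : Rn R n -> R) x| `^ r^-1) = cst (0 : R).
    by apply/funext => x /=; rewrite normr0 powR0// invr_eq0 gt_eqF.
  exact: fl_zero.
- by move=> f [mf Yf]; exact: powR_ge0.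
- move=> c f [mf Yf]; split; first exact: measurable_scaleT.
  have -> : (fun x => `|c * f x| `^ r^-1) = (fun x => `|c| `^ r^-1 * `|f x| `^ r^-1).
    by apply/funext => x; rewrite normrM powRM.
  exact: fl_scale.
- move=> c f [mf Yf]; rewrite /fpow/=.
  have -> : (fun x => `|c * f x| `^ r^-1) = (fun x => `|c| `^ r^-1 * `|f x| `^ r^-1).
    by apply/funext => x; rewrite normrM powRM.
  rewrite (fl_normZ lY _ Yf) (ger0_norm (powR_ge0 _ _)) powRM ?powR_ge0 ?(fl_ge0 lY)//.
  by rewrite powR_inv'.
- move=> f g [mf Yf] mg gf.
  have [Yg gn] : Y (fun x => `|g x| `^ r^-1) /\
      fnorm Y (fun x => `|g x| `^ r^-1) <= fnorm Y (fun x => `|f x| `^ r^-1).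
    apply: (fl_lattice lY Yf); first exact: measurable_powT (measurable_absT mg).
    apply: filterS gf => x gf; rewrite !(ger0_norm (powR_ge0 _ _)).
    exact: le_powR.
  split; first by split; [exact: mg|exact: Yg].
  by apply: (le_powR _ _ gn); [exact: ltW|exact: fl_ge0].
- move=> f_ F c Xf fc fF.
  have c0 : 0 <= c by apply: le_trans (fc 0%N); exact: powR_ge0.
  have F0 : {ae lebesgue, forall x, 0 <= F x}%E.
    apply: filterS fF => x [h0 _ ->]; apply: (@le_trans _ _ (f_ 0%N x)%:E); first by rewrite lee_fin.
    by apply: ereal_sup_ubound; exists 0%N.
  rewrite (xnorm_fpow F0) -(powR_inv' r0 c0) -poweR_EFin.
  apply: le_poweR; [exact: ltW|exact: xnorm_ge0|].
  apply: (fl_fatou lY (f_ := fun k x => `|f_ k x| `^ r^-1)) => [k|k|].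
  + exact: (Xf k).2.
  + rewrite -(powR_inv r0 (fl_ge0 lY (Xf k).2)).
    by apply: le_powR; [exact: ri0|exact: powR_ge0|exact: fc].
  apply: filterS fF => x [h0 h1 ->]; split => [k|k|].
  + exact: powR_ge0.
  + by rewrite !ger0_norm//; apply: le_powR.
  rewrite (@poweR_sup nat) ?invr_gt0//.
  by congr ereal_sup; apply: eq_imagel => k _; rewrite poweR_EFin ger0_norm.
Qed.

(** r-convexity of [Y] applied to |f|^(1/r) and |g|^(1/r). *)
Lemma triangle_fpow : rconvex1 Y r -> triangle (fpow Y r).
Proof.
move=> cv f g [mf Yf] [mg Yg].
have := cv _ _ Yf Yg.
have -> : (fun x => (((`|(`|f x| `^ r^-1)| `^ r + `|(`|g x| `^ r^-1)| `^ r) `^ r^-1)%:E)) =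
    (fun x => ((`|f x| + `|g x|) `^ r^-1)%:E).
  apply/funext => x; rewrite !(ger0_norm (powR_ge0 _ _)) -!powRrM mulVf ?gt_eqF//.
  by rewrite !powRr1.
move=> /(xnorm_rep_le lY)[u [Yu uE un]].
have [Yfg fgn] : Y (fun x => `|f x + g x| `^ r^-1) /\
      fnorm Y (fun x => `|f x + g x| `^ r^-1) <= fnorm Y u.
  apply: (fl_lattice lY Yu).
    exact: measurable_powT (measurable_absT (measurable_addT mf mg)).
  apply: filterS uE => x [<-]; rewrite !(ger0_norm (powR_ge0 _ _)).
  by apply: le_powR => //; exact: ler_normD.
split; first by split; [exact: measurable_addT mf mg|exact: Yfg].
rewrite /fpow/=; apply: (@le_trans _ _ (((fnorm Y (fun x => `|f x| `^ r^-1) `^ r +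
   fnorm Y (fun x => `|g x| `^ r^-1) `^ r) `^ r^-1) `^ r)).
  by apply: le_powR; [exact: ltW|exact: fl_ge0|exact: le_trans un].
by rewrite powR_inv'// addr_ge0// powR_ge0.
Qed.

End Power.
End LatticeSpace.

Section RunningMax.
Context d (T : measurableType d) (R : realType).
Implicit Types (g : nat -> T -> R) (x : T).

(** Turns a sequence that increases a.e. into one that increases everywhere, as monotone convergence
    is used here. *)
Fixpoint runmax g k x : R :=
  if k is j.+1 then Num.max (runmax g j x) `|g k x| else `|g 0%N x|.

Lemma runmax_attained g k x : exists2 i, (i <= k)%N & runmax g k x = `|g i x|.
Proof.
elim: k => [|k [i ik ih]]; first by exists 0%N.
rewrite /= ih; have [h|h] := leP `|g i x| `|g k.+1 x|; first by exists k.+1.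
by exists i => //; exact: leqW.
Qed.

Lemma runmax_ge g k x i : (i <= k)%N -> `|g i x| <= runmax g k x.
Proof.
elim: k => [|k ih]; first by rewrite leqn0 => /eqP ->.
by rewrite leq_eqVlt /= le_max => /predU1P[->|/ih ->//]; rewrite lexx orbT.
Qed.

Lemma runmax_le g k x (c : R) : (forall i, (i <= k)%N -> `|g i x| <= c) -> runmax g k x <= c.
Proof. by move=> H; have [i ik ->] := runmax_attained g k x; exact: H. Qed.

Lemma runmax_measurable g k : (forall i, measurable_fun setT (g i)) ->
  measurable_fun setT (runmax g k).
Proof.
move=> mg; elim: k => [|k ih]; first exact: measurable_absT (mg 0%N).
exact: measurable_maxr ih (measurable_absT (mg k.+1)).
Qed.

Lemma le_integral_nd_cvg (mu : {measure set T -> \bar R}) (u : nat -> T -> R)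
  (F : T -> \bar R) (c : \bar R) :
  (forall k, measurable_fun setT (u k)) -> (forall k x, 0 <= u k x) ->
  (forall k x, u k x <= u k.+1 x) -> (forall x, (fun k => (u k x)%:E) @ \oo --> F x) ->
  (forall k, \int[mu]_x (u k x)%:E <= c)%E -> (\int[mu]_x F x <= c)%E.
Proof.
move=> mu_ u0 uS uF uc.
have nd x : {homo (fun k => (u k x)%:E) : i j / (i <= j)%N >-> (i <= j)%E}.
  by apply/nondecreasing_seqP => k; rewrite lee_fin.
have E x : limn (fun k => (u k x)%:E) = F x by apply/cvg_lim.
rewrite -(eq_integral _ _ (fun x _ => E x)).
have -> : (\int[mu]_x limn (fun k => (u k x)%:E) = limn (fun k => \int[mu]_x (u k x)%:E))%E.
  apply: monotone_convergence.
  - exact: measurableT.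
  - by move=> k; exact: measurable_EFinT.
  - by move=> k x _; rewrite lee_fin.
  - by move=> x _ i j; exact: nd.
apply: lime_le; last by apply: nearW => k; exact: uc.
apply: ereal_nondecreasing_is_cvgn => i j ij.
by apply: le_integral_ge0 => x _; [rewrite lee_fin|exact: nd].
Qed.

End RunningMax.

(** * The Kothe associate space *)

Section Kothe.
Context {R : realType} {n : nat}.
Implicit Types (f g h : Rn R n -> R) (F G : Rn R n -> \bar R) (a : Rn R n).

Lemma seq_sup_measurable (F : nat -> Rn R n -> \bar R) :
  (forall j, measurable_fun setT (F j)) -> measurable_fun setT (seq_sup F).
Proof.
move=> mF; apply: emeasurable_ray => t.
have -> : [set x | (t%:E < seq_sup F x)%E] = \bigcup_j [set x | (t%:E < F j x)%E].
  apply/seteqP; split => [x /= /ereal_sup_gt[_ [j _ <-]] h|x [j _ /= h]]; first by exists j.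
  by apply: (lt_le_trans h); apply: ereal_sup_ubound; exists j.
apply: bigcup_measurable => j _.
have -> : [set x | (t%:E < F j x)%E] = F j @^-1` `]t%:E, +oo[%classic.
  by apply/seteqP; split => x /=; rewrite in_itv/= andbT.
rewrite -[X in measurable X]setTI.
by apply: (mF j) => //; exact: emeasurable_itv.
Qed.

(** The counterpart for cubes of the axiom on balls; pairing with these indicators makes functions
    of the associate space locally integrable. *)
Definition has_cubes (Z : fspace R n) := forall a l, 0 < l -> Z \1_(cube a l).

Lemma cube_sub_eball a l : 0 < l -> exists2 s, 0 < s & cube a l `<=` eball a s.
Proof.
move=> l0; exists ((n%:R + 1) * l); first by rewrite mulr_gt0// ltr_wpDl.
move=> y ya; rewrite /eball/=.
apply: (@le_lt_trans _ _ (\sum_(i < n) l ^+ 2)).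
  apply: ler_sum => i _; have := ya i => /andP[h1 h2].
  by apply: lerXn2r; rewrite ?nnegrE; move: l0 h1 h2; lra.
have -> : \sum_(i < n) l ^+ 2 = n%:R * l ^+ 2 by rewrite sumr_const card_ord mulr_natl.
rewrite exprMn ltr_pM2r ?exprn_gt0//.
have := @ler0n R n; nra.
Qed.

Lemma eball_sub_cube a s : 0 < s -> exists a' l, 0 < l /\ eball a s `<=` cube a' l.
Proof.
move=> s0; exists [tuple coord a i - s | i < n], (2 * s); split; first by rewrite mulr_gt0.
move=> y ya i; rewrite /coord tnth_mktuple -/(coord a i) -/(coord y i).
have H : (coord y i - coord a i) ^+ 2 < s ^+ 2.
  apply: le_lt_trans ya; rewrite (bigD1 i)//= lerDl.
  by apply: sumr_ge0 => j _; exact: sqr_ge0.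
have {}H : `|coord y i - coord a i| < s.
  by rewrite -(@ltr_pXn2r _ 2) ?nnegrE ?(ltW s0)// real_normK ?num_real.
by move: H; rewrite ltr_norml => /andP[h1 h2]; apply/andP; split; lra.
Qed.

Definition bcube j : set (Rn R n) := cube [tuple - j.+1%:R | i < n] (2 * j.+1%:R).

Lemma bcubeE j x : bcube j x <-> forall i, `|coord x i| < j.+1%:R.
Proof.
split=> H i; have := H i; rewrite /coord tnth_mktuple ltr_norml => /andP[h1 h2];
  apply/andP; split; move: h1 h2; lra.
Qed.

Lemma bcube_le j k : (j <= k)%N -> bcube j `<=` bcube k.
Proof.
move=> jk x /bcubeE xj; apply/bcubeE => i; apply: (lt_le_trans (xj i)).
by rewrite ler_nat.
Qed.

Lemma bcube_exists x : exists j, bcube j x.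
Proof.
exists (\max_i Num.bound `|coord x i|); apply/bcubeE => i.
apply: (lt_le_trans (archi_boundP (normr_ge0 _))).
by rewrite ler_nat ltnW// ltnS; exact: (leq_bigmax i).
Qed.

Lemma has_cubes_bqb (Y : fspace R n) : ball_quasi_banach Y -> has_cubes Y.
Proof.
move=> bY a l l0; have [s s0 sub] := cube_sub_eball a l0.
apply: (bqb_lattice bY (bqb_ball bY a s0) _ _).1.
  exact: measurable_funT_indic (cube_measurable a l).
apply: aeW => y; rewrite !indicE !ger0_norm ?ler0n// ler_nat.
case: (boolP (y \in cube a l)) => // /set_mem/sub ya.
by rewrite mem_set.
Qed.

Lemma powR_indic (A : set (Rn R n)) (p : R) y : 0 < p -> `|\1_A y| `^ p = \1_A y :> R.
Proof.
move=> p0; rewrite indicE; case: (_ \in _); rewrite ?normr1 ?powR1//.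
by rewrite normr0 powR0 ?gt_eqF.
Qed.

Lemma has_cubes_fpow (Y : fspace R n) r : 0 < r -> has_cubes Y -> has_cubes (fpow Y r).
Proof.
move=> r0 cY a l l0; split; first exact: measurable_funT_indic (cube_measurable a l).
have -> : (fun y => `|\1_(cube a l) y| `^ r^-1) = \1_(cube a l) :> (Rn R n -> R).
  by apply/funext => y; rewrite powR_indic// invr_gt0.
exact: cY.
Qed.

Variable X : fspace R n.
Hypotheses (lX : fatou_lattice X) (cX : has_cubes X).

Lemma kothe_norm_le g (c : \bar R) : (forall f, X f -> (forall x, 0 <= f x) -> fnorm X f <= 1 ->
    (\int[lebesgue]_x (f x * `|g x|)%:E <= c)%E) -> (kothe_norm X g <= c)%E.
Proof.
move=> H; apply: ge_ereal_sup => _ [f [Xf f1] <-].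
have [Xa E] := fl_abs lX Xf.
apply: le_trans (H _ Xa (fun x => normr_ge0 (f x)) _); last by rewrite E.
by apply: le_integral_ge0 => x _; rewrite ?abse_ge0//= normrM.
Qed.

Lemma kothe_norm_ge0 g : (0 <= kothe_norm X g)%E.
Proof.
apply: le_ereal_sup_tmp; exists (\int[lebesgue]_x `|((cst 0 : Rn R n -> R) x * g x)%:E|)%E.
  by exists (cst 0) => //; split; [exact: fl_zero|rewrite (fl_norm0 lX)].
by apply: integral_ge0 => x _; rewrite abse_ge0.
Qed.

Lemma kotheE g : kothe X g -> kothe_norm X g = (fnorm (kothe X) g)%:E.
Proof. by move=> [mg gy]; rewrite /kothe/= fineK// ge0_fin_numE// kothe_norm_ge0. Qed.

Lemma kothe_ge0 g : kothe X g -> 0 <= fnorm (kothe X) g.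
Proof. by move=> Xg; rewrite -lee_fin -kotheE// kothe_norm_ge0. Qed.

Lemma kothe_le g (c : R) : measurable_fun setT g -> (forall f, X f -> (forall x, 0 <= f x) ->
    fnorm X f <= 1 -> (\int[lebesgue]_x (f x * `|g x|)%:E <= c%:E)%E) ->
  kothe X g /\ fnorm (kothe X) g <= c.
Proof.
move=> mg /kothe_norm_le gc.
have Xg : kothe X g by split => //; rewrite (le_lt_trans gc)// ltry.
by split => //; rewrite -lee_fin -kotheE.
Qed.

(** [f] is divided by some c slightly above its norm, since the norm itself may vanish. *)
Lemma kothe_holder f g : X f -> kothe X g ->
  (\int[lebesgue]_x (`|f x| * `|g x|)%:E <= (fnorm X f * fnorm (kothe X) g)%:E)%E.
Proof.
move=> Xf Xg; have gE := kotheE Xg; have [mg _] := Xg.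
have mf := fl_measurable lX Xf.
have m0 : measurable_fun setT (fun x => `|f x| * `|g x|).
  exact: measurable_mulT (measurable_absT mf) (measurable_absT mg).
have g0 := kothe_ge0 Xg.
have H (c : R) : fnorm X f < c ->
    (\int[lebesgue]_x (`|f x| * `|g x|)%:E <= (c * fnorm (kothe X) g)%:E)%E.
  move=> fc; have c0 : 0 < c by apply: le_lt_trans fc; exact: fl_ge0.
  have ci0 : 0 <= c^-1 by rewrite invr_ge0 ltW.
  rewrite EFinM -lee_pdivrMl// -(integralZ lebesgue measurableT ci0 _ m0).
    rewrite -gE; apply: ereal_sup_ubound; exists (fun x => c^-1 * f x).
      split; first exact: fl_scale.
      by rewrite (fl_normZ lX _ Xf) ger0_norm// ler_pdivrMl// mulr1 ltW.
    apply: eq_integral => x _ /=.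
    by rewrite !normrM (ger0_norm ci0) mulrA.
  by move=> x; rewrite mulr_ge0.
apply/lee_addgt0Pr => e e0.
have d0 : 0 < e / (fnorm (kothe X) g + 1) by rewrite divr_gt0// ltr_wpDl.
apply: (le_trans (H (fnorm X f + e / (fnorm (kothe X) g + 1)) _)).
  by rewrite ltrDl.
rewrite -EFinD lee_fin mulrDl lerD2l mulrAC ler_pdivrMr ?ltr_wpDl//.
by rewrite ler_wpM2l ?(ltW e0)// lerDl.
Qed.

Lemma kothe_lattice f g : kothe X f -> measurable_fun setT g ->
  {ae lebesgue, forall x, `|g x| <= `|f x|} ->
  kothe X g /\ fnorm (kothe X) g <= fnorm (kothe X) f.
Proof.
move=> Xf mg gf; apply: kothe_le => // u Xu u0 u1; have mu_ := fl_measurable lX Xu.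
have [mf _] := Xf.
apply: (@le_trans _ _ (\int[lebesgue]_x (`|u x| * `|f x|)%:E)%E).
  apply: le_integral_ae.
  - exact: measurableT.
  - exact: measurable_mulT mu_ (measurable_absT mg).
  - exact: measurable_mulT (measurable_absT mu_) (measurable_absT mf).
  - by move=> x; rewrite mulr_ge0.
  - by move=> x; rewrite mulr_ge0.
  by apply: filterS gf => x h; rewrite (ger0_norm (u0 x)) ler_wpM2l.
apply: (le_trans (kothe_holder Xu Xf)); rewrite lee_fin.
by rewrite ler_piMl// kothe_ge0.
Qed.

Lemma kothe_scale_le (c : R) g : kothe X g ->
  kothe X (fun x => c * g x) /\ fnorm (kothe X) (fun x => c * g x) <= `|c| * fnorm (kothe X) g.
Proof.
move=> Xg; have [mg _] := Xg.
apply: kothe_le => [|u Xu u0 u1]; first exact: measurable_scaleT.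
have m0 : measurable_fun setT (fun x => `|u x| * `|g x|).
  exact: measurable_mulT (measurable_absT (fl_measurable lX Xu)) (measurable_absT mg).
apply: (@le_trans _ _ (`|c|%:E * \int[lebesgue]_x (`|u x| * `|g x|)%:E)%E).
  rewrite -(integralZ lebesgue measurableT (normr_ge0 c) _ m0); last by move=> x; rewrite mulr_ge0.
  apply: le_integral_ge0 => x _; rewrite lee_fin ?mulr_ge0//.
  by rewrite normrM (ger0_norm (u0 x)) mulrCA.
rewrite EFinM; apply: lee_wpmul2l; first by rewrite lee_fin.
apply: (le_trans (kothe_holder Xu Xg)); rewrite lee_fin.
by rewrite ler_piMl// kothe_ge0.
Qed.

Lemma kothe_integrable_cube g a l : 0 < l -> kothe X g ->
  (\int[lebesgue]_(x in cube a l) `|g x|%:E < +oo)%E.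
Proof.
move=> l0 Xg; apply: le_lt_trans (ltry (fnorm X \1_(cube a l) * fnorm (kothe X) g)).
apply: le_trans (kothe_holder (cX a l0) Xg).
rewrite integral_restr; apply: le_integral_ge0 => x _; rewrite lee_fin ?mulr_ge0// ?indicE ?ler0n//.
by rewrite mulrC (ger0_norm (ler0n R (x \in cube a l))).
Qed.

(** The Fatou property is monotone convergence in each pairing. The supremum [G] is finite a.e.
    because its pairing with a positive multiple of the indicator of any large cube is finite. *)
Lemma fatou_lattice_kothe : fatou_lattice (kothe X).
Proof.
have K0 : kothe X (cst 0).
  apply: (kothe_le (c := 0) _ _).1; first exact: measurable_cst.
  move=> f _ _ _; rewrite integral0_eq// => x _.
  by rewrite /= normr0 mulr0.
split.
- by move=> f [].
- exact: K0.
- exact: kothe_ge0.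
- by move=> c f Xf; exact: (kothe_scale_le c Xf).1.
- move=> c f Xf; apply/eqP; rewrite eq_le (kothe_scale_le c Xf).2/=.
  have [->|c0] := eqVneq c 0.
    by rewrite normr0 mul0r; exact: kothe_ge0 (kothe_scale_le 0 Xf).1.
  rewrite -ler_pdivlMl ?normr_gt0// -normfV.
  apply: le_trans (kothe_scale_le c^-1 (kothe_scale_le c Xf).1).2.
  apply: eq_ler; rewrite /kothe/=; congr (fine (kothe_norm X _)).
  by apply/funext => x; rewrite mulKf.
- exact: kothe_lattice.
move=> g_ F c Xg gc gF.
have mg k : measurable_fun setT (g_ k) by have [] := Xg k.
have c0 : 0 <= c := le_trans (kothe_ge0 (Xg 0%N)) (gc 0%N).
pose G x := ereal_sup (range (fun k => `|g_ k x|%:E)).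
have mG : measurable_fun setT G.
  by apply: seq_sup_measurable => k; exact: measurable_EFinT (measurable_absT (mg k)).
have mono : {ae lebesgue, forall x, forall k, `|g_ k x| <= `|g_ k.+1 x|}.
  by apply: filterS gF => x [h0 h1 _] k; rewrite !ger0_norm.
have key f : X f -> (forall x, 0 <= f x) -> fnorm X f <= 1 ->
    (\int[lebesgue]_x ((f x)%:E * G x) <= c%:E)%E.
  move=> Xf f0 f1; have mf := fl_measurable lX Xf.
  pose u := runmax g_.
  have ug k x i : (i <= k)%N -> `|g_ i x| <= u k x by exact: runmax_ge.
  have u0 k x : 0 <= u k x by apply: le_trans (normr_ge0 (g_ 0%N x)) (ug k x 0%N _).
  have uS x : {homo (fun k => u k x) : i j / (i <= j)%N >-> i <= j}.
    by move=> i j ij; apply: runmax_le => k ki; apply: ug; exact: leq_trans ij.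
  have mu_ k : measurable_fun setT (u k) by exact: runmax_measurable.
  have GE x : (fun k => (f x * u k x)%:E) @ \oo --> ((f x)%:E * G x)%E.
    under eq_fun do rewrite EFinM.
    apply: cvgeZl => //.
    have -> : G x = ereal_sup (range (fun k => (u k x)%:E)).
      apply/eqP; rewrite eq_le; apply/andP; split; apply: ge_ereal_sup => _ [k _ <-].
        apply: (@le_trans _ _ (u k x)%:E); first by rewrite lee_fin ug.
        by apply: ereal_sup_ubound; exists k.
      rewrite /u; have [i _ ->] := runmax_attained g_ k x.
      by apply: ereal_sup_ubound; exists i.
    by apply: ereal_nondecreasing_cvgn => i j ij; rewrite lee_fin uS.
  apply: (le_integral_nd_cvg _ _ _ GE) => [k|k x|k x|k].
  - exact: measurable_mulT mf (mu_ k).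
  - by rewrite mulr_ge0.
  - by rewrite ler_wpM2l// uS.
  apply: (@le_trans _ _ (\int[lebesgue]_x (`|f x| * `|g_ k x|)%:E)%E); last first.
    apply: (le_trans (kothe_holder Xf (Xg k))); rewrite lee_fin.
    apply: (@le_trans _ _ (fnorm (kothe X) (g_ k))); last exact: gc.
    exact: ler_piMl (kothe_ge0 (Xg k)) f1.
  apply: le_integral_ae.
  - exact: measurableT.
  - exact: measurable_mulT mf (mu_ k).
  - exact: measurable_mulT (measurable_absT mf) (measurable_absT (mg k)).
  - by move=> x; rewrite mulr_ge0.
  - by move=> x; rewrite mulr_ge0.
  apply: filterS mono => x hx; rewrite (ger0_norm (f0 x)) ler_wpM2l//.
  apply: runmax_le => i ik.
  have /nondecreasing_seqP H : forall k, (fun k => `|g_ k x|) k <= (fun k => `|g_ k x|) k.+1 by [].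
  exact: H.
have G0 x : (0 <= G x)%E.
  by apply: (@le_trans _ _ `|g_ 0%N x|%:E); [rewrite lee_fin|apply: ereal_sup_ubound; exists 0%N].
have Gfin : {ae lebesgue, forall x, G x < +oo}%E.
  have H j : {ae lebesgue, forall x, bcube j x -> (G x < +oo)%E}.
    have l0 : 0 < 2 * j.+1%:R :> R by rewrite mulr_gt0.
    have XQ : X \1_(bcube j) := cX _ l0.
    have N0 := fl_ge0 lX XQ.
    pose t := (fnorm X \1_(bcube j) + 1)^-1; have t0 : 0 < t by rewrite invr_gt0 ltr_wpDl.
    pose f x := t * \1_(bcube j) x.
    have Xf : X f by exact: fl_scale.
    have f0 x : 0 <= f x by rewrite mulr_ge0 ?(ltW t0)// indicE ler0n.
    have f1 : fnorm X f <= 1.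
      rewrite (fl_normZ lX _ XQ) (ger0_norm (ltW t0)) /t mulrC ler_pdivrMr ?ltr_wpDl// mul1r lerDl//.
    have I : lebesgue.-integrable setT (fun x => (f x)%:E * G x)%E.
      apply/integrableP; split.
        by apply: emeasurable_funM; [exact: measurable_EFinT (fl_measurable lX Xf)|exact: mG].
      apply: (@le_lt_trans _ _ c%:E); last exact: ltry.
      apply: le_trans (key f Xf f0 f1); apply: le_integral_ge0 => x _; first exact: abse_ge0.
      by rewrite gee0_abs// mule_ge0// lee_fin.
    have := integrable_ae measurableT I; apply: filterS => x /(_ Logic.I) + xQ.
    rewrite /f indicE mem_set// mulr1; case: (G x) (G0 x) => [s _ _|_|//]; first exact: ltry.
    by rewrite gt0_muley ?lte_fin.
  have := ae_foralln H; apply: filterS => x hx.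
  have [j hj] := bcube_exists x; exact: hx hj.
have FG : {ae lebesgue, forall x, F x = (fine (G x))%:E}.
  apply: filterS2 gF Gfin => x [h0 h1 ->] Gx; rewrite fineK ?ge0_fin_numE//.
  by congr ereal_sup; apply: eq_imagel => k _; rewrite ger0_norm.
have mfG : measurable_fun setT (fun x => fine (G x)) by exact: measurableT_comp.
rewrite (xnorm_congr _ FG).
have [XG Gc] : kothe X (fun x => fine (G x)) /\ fnorm (kothe X) (fun x => fine (G x)) <= c.
  apply: kothe_le => // f Xf f0 f1; apply: le_trans (key f Xf f0 f1).
  apply: le_integral_ge0 => x _; first by rewrite lee_fin mulr_ge0.
  rewrite EFinM; apply: lee_wpmul2l; first by rewrite lee_fin.
  by rewrite ger0_norm ?fine_ge0//; case: (G x) (G0 x) => //= _; rewrite leey.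
apply: (@le_trans _ _ (fnorm (kothe X) (fun x => fine (G x)))%:E); last by rewrite lee_fin.
by apply: xnorm_le_mem => //; exact: aeW.
Qed.

Lemma triangle_kothe : triangle (kothe X).
Proof.
move=> f g Xf Xg; have [mf _] := Xf; have [mg _] := Xg.
apply: kothe_le => [|u Xu u0 u1]; first exact: measurable_addT.
have mu_ := fl_measurable lX Xu.
apply: (@le_trans _ _ (\int[lebesgue]_x (`|u x| * `|f x| + `|u x| * `|g x|)%:E)%E).
  apply: le_integral_ge0 => x _; rewrite lee_fin ?mulr_ge0//.
  by rewrite (ger0_norm (u0 x)) -mulrDr ler_wpM2l// ler_normD.
have m0 h : measurable_fun setT h -> measurable_fun setT (fun x => `|u x| * `|h x|).
  by move=> mh; exact: measurable_mulT (measurable_absT mu_) (measurable_absT mh).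
have p0 h x : 0 <= `|u x| * `|h x| by rewrite mulr_ge0.
rewrite (integral_addT lebesgue measurableT (m0 f mf) (m0 g mg) (p0 f) (p0 g)) EFinD.
by apply: leeD; apply: (le_trans (kothe_holder Xu _)) => //; rewrite lee_fin ler_piMl// kothe_ge0.
Qed.

End Kothe.

(** * Change of scale and Rubio de Francia weights *)

Section BoundedMaximal.
Context {R : realType} {n : nat}.
Implicit Types (f g h u w : Rn R n -> R) (x a : Rn R n) (rho l : R).

Lemma nneseries_sup (u : nat -> R) : (forall k, 0 <= u k) ->
  (\sum_(0 <= k <oo) (u k)%:E)%E =
  ereal_sup (range (fun N => (\sum_(0 <= k < N.+1) u k)%:E)).
Proof.
move=> u0; apply/eqP; rewrite eq_le; apply/andP; split.
  apply: nneseries_le => [k|[|N]]; first by rewrite lee_fin.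
    rewrite big_geq//; apply: (@le_trans _ _ (\sum_(0 <= k < 1) u k)%:E).
      by rewrite lee_fin sumr_ge0.
    by apply: ereal_sup_ubound; exists 0%N.
  by rewrite sumEFin; apply: ereal_sup_ubound; exists N.
apply: ge_ereal_sup => _ [N _ <-]; rewrite -sumEFin.
by apply: nneseries_lim_ge => k _; rewrite lee_fin.
Qed.

Lemma Mloc_le_rho rho rho' f x : rho <= rho' -> (Mloc rho f x <= Mloc rho' f x)%E.
Proof.
move=> rr; apply: ge_ereal_sup => _ [a [l [l0 lr xa ->]]]; apply: ereal_sup_ubound.
by exists a, l; split => //; exact: le_trans rr.
Qed.

Lemma ae_cube_exists (P : Rn R n -> Prop) a l : 0 < l ->
  {ae lebesgue, forall x, P x} -> exists2 x, cube a l x & P x.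
Proof.
move=> l0 [N [mN N0 sub]]; apply/not_exists2P => H.
have : (lebesgue (cube a l) <= lebesgue N)%E.
  apply: le_measure; rewrite ?inE//; first exact: cube_measurable.
  by move=> x xa; apply: sub => /= Px; have [] := H x.
by rewrite lebesgue_cube ?(ltW l0)// N0 lee_fin leNgt exprn_gt0.
Qed.

Variable Z : fspace R n.
Hypothesis lZ : fatou_lattice Z.

Lemma bounded_on_rep rho : 0 < rho -> bounded_on Z (Mloc rho) ->
  exists2 C : R, 1 <= C & forall f, Z f -> exists g,
    [/\ Z g, forall x, 0 <= g x, {ae lebesgue, forall x, Mloc rho f x = (g x)%:E} &
        fnorm Z g <= C * fnorm Z f].
Proof.
move=> r0 [C HC]; exists (Num.max 1 C); first by rewrite le_max lexx.
move=> f Zf; have [g [Zg Fg gn]] := xnorm_rep_le lZ (HC f Zf).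
have [Za aE] := fl_abs lZ Zg; exists (fun x => `|g x|); split => //.
  apply: filterS Fg => x E; rewrite E ger0_norm// -lee_fin -E; exact: Mloc_ge0.
rewrite aE (le_trans gn)// ler_wpM2r ?(fl_ge0 lZ)// le_max lexx orbT//.
Qed.

Lemma bounded_enlarge rho : 0 < rho -> bounded_on Z (Mloc rho) ->
  bounded_on Z (Mloc (3 / 2 * rho)).
Proof.
move=> r0 /(bounded_on_rep r0)[C C1 HC]; exists (4 ^+ n * (C * C)) => f Zf.
have [g [Zg g0 Mg gn]] := HC f Zf.
have [h [Zh h0 Mh hn]] := HC g Zg.
have mf := fl_measurable lZ Zf; have mg := fl_measurable lZ Zg.
apply: (@le_trans _ _ (xnorm Z (fun x => (4 ^+ n * h x)%:E))).
  apply: (xnorm_mono lZ); first exact: Mloc_measurable.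
  apply: filterS Mh => x E; rewrite Mloc_ge0 ?mulr_gt0//= EFinM -E.
  apply: (Mloc_enlarge x r0 mf mg); apply: filterS Mg => y ->; exact: lexx.
rewrite xnormE//; last exact: fl_scale.
rewrite (fl_normZ lZ _ Zh) ger0_norm ?exprn_ge0// lee_fin -!mulrA ler_wpM2l ?exprn_ge0//.
by rewrite (le_trans hn)// ler_wpM2l// (le_trans ler01).
Qed.

(** Enlargements by 3/2 are iterated beyond the target scale, which is then reached by monotonicity
    in the scale. *)
Lemma bounded_rescale rho rho' : 0 < rho -> 0 < rho' -> bounded_on Z (Mloc rho) ->
  bounded_on Z (Mloc rho').
Proof.
move=> r0 r0' B.
have Bk k : bounded_on Z (Mloc ((3 / 2) ^+ k * rho)).
  elim: k => [|k ih]; first by rewrite expr0 mul1r.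
  by rewrite exprS -mulrA; apply: bounded_enlarge => //; rewrite mulr_gt0// exprn_gt0.
(* Two enlargements give 9/4 > 2, hence the factor 2. *)
pose k := (2 * Num.bound (rho' / rho))%N.
have hk : rho' <= (3 / 2) ^+ k * rho.
  rewrite -ler_pdivrMr//; apply: (@le_trans _ _ (2 ^+ Num.bound (rho' / rho))).
    apply: ltW; apply: (lt_le_trans (archi_boundP _)); first by rewrite divr_ge0// ltW.
    by rewrite -natrX ler_nat ltnW// ltn_expl.
  by rewrite /k exprM; apply: lerXn2r; rewrite ?nnegrE; lra.
have [C HC] := Bk k; exists C => f Zf; apply: le_trans (HC f Zf).
apply: (xnorm_mono lZ); first exact: Mloc_measurable.
by apply: aeW => x; rewrite Mloc_ge0//= Mloc_le_rho.
Qed.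

(** After rescaling, the maximal function at scale l is finite a.e., hence at some point of the cube
    of side l, where it bounds the integral over that cube. *)
Lemma bounded_lint rho f : 0 < rho -> bounded_on Z (Mloc rho) -> Z f -> lint f.
Proof.
move=> r0 B Zf; split; first exact: fl_measurable Zf.
move=> a l l0; have [C _ HC] := bounded_on_rep l0 (bounded_rescale r0 l0 B).
have [g [_ _ Mg _]] := HC f Zf.
have [x xa E] := ae_cube_exists a l0 Mg.
by apply: (le_lt_trans (Mloc_ge f l0 (lexx l) xa)); rewrite E -EFinM ltry.
Qed.

Hypothesis tZ : triangle Z.

Lemma fl_sum (u : nat -> Rn R n -> R) N : (forall k, Z (u k)) ->
  Z (fun x => \sum_(0 <= k < N) u k x) /\
  fnorm Z (fun x => \sum_(0 <= k < N) u k x) <= \sum_(0 <= k < N) fnorm Z (u k).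
Proof.
move=> Zu; elim: N => [|N [Zs sn]].
  rewrite (_ : (fun x => _) = cst 0); last by apply/funext => x; rewrite big_geq.
  split; first exact: fl_zero.
  rewrite big_geq//.
  by rewrite (fl_norm0 lZ).
rewrite (_ : (fun x => _) = (fun x => \sum_(0 <= k < N) u k x + u N x)); last first.
  by apply/funext => x; rewrite big_nat_recr.
have [Zs' sn'] := tZ Zs (Zu N); split => //.
by rewrite big_nat_recr//= (le_trans sn')// lerD2r.
Qed.

(* Rubio de Francia: w = sum_k (2 C)^-k M^k u. *)
Lemma rubio_de_francia rho : 0 < rho -> bounded_on Z (Mloc rho) ->
  exists2 A : R, 1 <= A & forall u, Z u -> (forall x, 0 <= u x) -> exists w,
    [/\ Z w, forall x, u x <= w x, fnorm Z w <= 2 * fnorm Z u &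
        {ae lebesgue, forall x, Mloc rho w x <= (A * w x)%:E}%E].
Proof.
move=> r0 /(bounded_on_rep r0)[C C1 HC]; have C0 : 0 < C by exact: lt_le_trans C1.
exists (2 * C); first by move: C1; lra.
move=> u Zu u0.
have /choice[m hm] f : exists g, Z f ->
    [/\ Z g, forall x, 0 <= g x, {ae lebesgue, forall x, Mloc rho f x = (g x)%:E} &
        fnorm Z g <= C * fnorm Z f].
  have [Zf|nZf] := pselect (Z f); last by exists f.
  by have [g hg] := HC f Zf; exists g.
pose u_ k := iter k m u.
have Zu_ k : Z (u_ k) by elim: k => // k /hm[].
have u_0 k x : 0 <= u_ k x.
  by case: k => [|k]; [exact: u0|have [_ h _ _] := hm _ (Zu_ k); exact: h].
have un k : fnorm Z (u_ k) <= C ^+ k * fnorm Z u.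
  elim: k => [|k ih]; first by rewrite expr0 mul1r.
  have [_ _ _ h] := hm _ (Zu_ k); rewrite exprS -mulrA; apply: (le_trans h).
  by rewrite ler_wpM2l// ltW.
have uM : {ae lebesgue, forall x, forall k, Mloc rho (u_ k) x = (u_ k.+1 x)%:E}.
  by apply: ae_foralln => k; have [_ _ h _] := hm _ (Zu_ k).
have d0 : 0 < (2 * C)^-1 by rewrite invr_gt0 mulr_gt0.
pose v k x := (2 * C)^-1 ^+ k * u_ k x.
have Zv k : Z (v k) by apply: fl_scale.
have v0 k x : 0 <= v k x by rewrite mulr_ge0// exprn_ge0// ltW.
have vn k : fnorm Z (v k) <= 2^-1 ^+ k * fnorm Z u.
  rewrite /v (fl_normZ lZ _ (Zu_ k)) ger0_norm ?exprn_ge0 ?(ltW d0)//.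
  rewrite invfM exprMn -mulrA ler_wpM2l ?exprn_ge0// exprVn ler_pdivrMl ?exprn_gt0//.
pose F x := (\sum_(0 <= k <oo) (v k x)%:E)%E.
have FE x : F x = ereal_sup (range (fun N => (\sum_(0 <= k < N.+1) v k x)%:E)).
  by apply: nneseries_sup.
have [w0 [Zw0 Fw0 w0n]] : exists f, [/\ Z f, {ae lebesgue, forall x, F x = (f x)%:E} &
    fnorm Z f <= 2 * fnorm Z u].
  apply: (xnorm_rep_le lZ).
  apply: (fl_fatou lZ (f_ := fun N x => \sum_(0 <= k < N.+1) v k x)) => [k|k|].
  - exact: (fl_sum _ Zv).1.
  - apply: (le_trans (fl_sum _ Zv).2).
    apply: (@le_trans _ _ (\sum_(0 <= i < k.+1) 2^-1 ^+ i * fnorm Z u)).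
      by apply: ler_sum => i _; exact: vn.
    rewrite -mulr_suml ler_wpM2r ?(fl_ge0 lZ)//.
    have : \sum_(0 <= i < k.+1) 2^-1 ^+ i = 2 - 2 * 2^-1 ^+ k.+1 :> R.
      elim: k.+1 => [|j ih]; first by rewrite big_geq// expr0; ring.
      by rewrite big_nat_recr//= ih exprS; field.
    by move=> ->; rewrite gerBl mulr_ge0// exprn_ge0.
  - apply: aeW => x; split => [k|k|]; last exact: FE.
      by apply: sumr_ge0.
    by rewrite [leRHS]big_nat_recr//= lerDl.
have mu_ := fl_measurable lZ Zu.
pose w x := Num.max (u x) (w0 x).
have ww0 : {ae lebesgue, forall x, w x = w0 x}.
  apply: filterS Fw0 => x E; apply/max_idPr; rewrite -lee_fin -E.
  apply: (@le_trans _ _ (v 0%N x)%:E); first by rewrite /v expr0 mul1r.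
  by apply: (@nneseries_ge_term _ (fun k => (v k x)%:E) 0%N) => k; rewrite lee_fin.
have mw : measurable_fun setT w by exact: measurable_maxr mu_ (fl_measurable lZ Zw0).
have [Zw wn] : Z w /\ fnorm Z w <= fnorm Z w0.
  by apply: (fl_lattice lZ Zw0 mw); apply: filterS ww0 => x ->.
have w_0 x : 0 <= w x by rewrite le_max u0.
exists w; split => //.
- by move=> x; rewrite le_max lexx.
- exact: le_trans w0n.
have wF : {ae lebesgue, forall x, (w x)%:E = F x} by apply: filterS2 ww0 Fw0 => x -> ->.
have Mw x : (Mloc rho w x <= \sum_(0 <= k <oo) Mloc rho (v k) x)%E.
  apply: (Mloc_series _ mw (fun k => fl_measurable lZ (Zv k)) _ r0).
  apply: filterS wF => y E; rewrite ger0_norm// E.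
  apply: lee_nneseries => [k _ _|k _]; first by rewrite lee_fin.
  by rewrite lee_fin ler_norm.
apply: filterS2 wF uM => x wE ux; apply: (le_trans (Mw x)).
rewrite EFinM wE -nneseriesZl//; last by move=> k _; rewrite lee_fin.
(* The maximal operator shifts the series by one index at the cost of 2 C. *)
apply: (@le_trans _ _ (\sum_(0 <= k <oo) (2 * C)%:E * (v k.+1 x)%:E)%E).
  apply: lee_nneseries => [k _ _|k _]; first exact: Mloc_ge0.
  apply: (le_trans (MlocZ _ _ (fl_measurable lZ (Zu_ k)) r0)).
  rewrite ger0_norm ?exprn_ge0 ?(ltW d0)// ux -!EFinM lee_fin.
  apply: eq_ler; rewrite /v exprS; field; lra.
have t0 k : (0 <= (2 * C)%:E * (v k x)%:E)%E by rewrite -EFinM lee_fin mulr_ge0// mulr_ge0// ltW.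
apply: nneseries_le => [k|N]; first exact: t0.
apply: le_trans (nneseries_lim_ge N.+1 _); last by move=> k _ _; exact: t0.
by rewrite big_nat_recl//= leeDr.
Qed.

End BoundedMaximal.

(** * The Lorentz-Luxemburg theorem *)

Section LorentzLuxemburg.
Context {R : realType} {n : nat}.
Implicit Types (f g h p u : Rn R n -> R) (x a : Rn R n).

(** Cauchy-Schwarz with the weights 2^(-i), whose sum is at most 2. *)
Lemma sqr_sum_abs_le (b : nat -> R) j :
  (\sum_(0 <= i < j) `|b i|) ^+ 2 <= 2 * \sum_(0 <= i < j) 2 ^+ i * b i ^+ 2.
Proof.
elim: j b => [|j ih] b; first by rewrite !big_geq// expr0n mulr0.
rewrite !big_nat_recl//= expr0 mul1r.
have := ih (fun i => b i.+1); set D := \sum_(0 <= i < j) `|b i.+1| => hD.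
have -> : \sum_(0 <= i < j) 2 ^+ i.+1 * b i.+1 ^+ 2 = 2 * \sum_(0 <= i < j) 2 ^+ i * b i.+1 ^+ 2.
  by rewrite mulr_sumr; apply: eq_bigr => i _; rewrite exprS mulrA.
have := sqr_ge0 (`|b 0%N| - D); rewrite -(real_normK (num_real (b 0%N))).
move: hD; set E := \sum_(_ <= _ < _) _; nra.
Qed.

Lemma expVn_le (a b : R) k : 0 < a -> a <= b -> b^-1 ^+ k <= a^-1 ^+ k.
Proof.
move=> a0 ab; have b0 := lt_le_trans a0 ab.
by apply: lerXn2r; rewrite ?nnegrE ?invr_ge0 ?lef_pV2 ?posrE// ltW.
Qed.

Lemma dist_le_add (a b A B : R) : 0 <= a -> a <= A -> 0 <= b <= B -> `|a - b| <= A + B.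
Proof. by move=> a0 aA /andP[b0 bB]; rewrite ler_norml; apply/andP; split; lra. Qed.

Lemma convex_sq_le (A c h f p t : R) : A <= (h - t * (f - p)) ^+ 2 -> (f - p) ^+ 2 <= c ->
  A + 2 * t * (h * f) <= h ^+ 2 + (2 * t * (h * p) + t ^+ 2 * c).
Proof. by move=> h1 h2; have := ler_wpM2l (sqr_ge0 t) h2; move: h1; lra. Qed.

(** First-order optimality: divide by 2 t and let t tend to 0; one small t suffices for a
    contradiction. *)
Lemma le_of_quadratic (W Q M : R) : 0 <= M ->
  (forall t, 0 < t -> t <= 1 -> 2 * t * W <= 2 * t * Q + t ^+ 2 * M) -> W <= Q.
Proof.
move=> M0 H; rewrite leNgt; apply/negP => QW.
have M10 : 0 < M + 1 by rewrite ltr_wpDl.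
pose t := Num.min 1 ((W - Q) / (M + 1)).
have t0 : 0 < t by rewrite lt_min ltr01 divr_gt0// subr_gt0.
have tW : t * (M + 1) <= W - Q by rewrite -ler_pdivlMr// ge_min lexx orbT.
have := H t t0; rewrite ge_min lexx => /(_ isT); rewrite -subr_ge0.
have -> : 2 * t * Q + t ^+ 2 * M - 2 * t * W = t * (2 * Q + t * M - 2 * W) by ring.
by rewrite pmulr_rge0//; move: tW; clearbody t; lra.
Qed.

(** For y = 2^(-k). The constant 128/7 is 16 / (1 - 1/8), from a series of ratio 1/8, and 34 is
    chosen generously. *)
Lemma perturbation_le (I y z w : R) : 0 <= I -> 0 < y -> y <= 1 -> w <= y -> z <= y ->
  0 <= z -> 0 <= w -> (1 + y) * (I + w) + 128 / 7 * z <= I + y * (I + 34).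
Proof. by nra. Qed.

Lemma ratio_le (y : R) : 1 <= y -> 8 * ((1 + y) / y) <= 16.
Proof.
move=> y1; have y0 : 0 < y by exact: lt_le_trans y1.
by rewrite mulrA ler_pdivrMr//; lra.
Qed.

Variable X : fspace R n.
Hypotheses (lX : fatou_lattice X) (tX : triangle X).

Section Bounded.
Variables (g : Rn R n -> R) (m K : R) (a0 : Rn R n) (l0 : R).
Hypotheses (l00 : 0 < l0) (K0 : 0 < K) (m0 : 0 <= m) (mg : measurable_fun setT g).
Let B := cube a0 l0.
Hypothesis g0 : forall x, 0 <= g x <= m * \1_B x.

Let IB x : (\1_B x : R) = 0 \/ (\1_B x : R) = 1.
Proof. by rewrite indicE; case: (_ \in _); [right|left]. Qed.

Let finB (c : R) u : 0 <= c -> measurable_fun setT u -> (forall x, 0 <= u x <= c * \1_B x) ->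
  (\int[lebesgue]_x (u x)%:E = (fine (\int[lebesgue]_x (u x)%:E))%:E)%E.
Proof.
move=> c0 mu_ uc; rewrite fineK// ge0_fin_numE.
  apply: (@le_lt_trans _ _ (c%:E * (l0 ^+ n)%:E)%E); last by rewrite -EFinM ltry.
  have mB := cube_measurable a0 l0.
  rewrite -(lebesgue_cube a0 (ltW l00)) -(integral_cst lebesgue mB).
  rewrite (_ : (fun _ => c%:E) = (fun x => ((cst c : Rn R n -> R) x)%:E))// [leRHS]integral_restr.
  by apply: le_integral_ge0 => x _; rewrite lee_fin; have /andP[] := uc x.
by apply: integral_ge0 => x _; rewrite lee_fin; have /andP[] := uc x.
Qed.

(** Admissible functions for the projection; [J] is the squared L^2 distance to [g]. The bound by
    [g], itself bounded with bounded support, keeps all these integrals finite. *)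
Let S p := [/\ X p, forall x, 0 <= p x <= g x & fnorm X p <= K].
Let J p := fine (\int[lebesgue]_x ((g x - p x) ^+ 2)%:E)%E.

Let measurable_sqrT u : measurable_fun setT u -> measurable_fun setT (fun x => u x ^+ 2).
Proof. by move=> hu; exact (measurable_mulT hu hu). Qed.

Let prodB u v : (forall x, 0 <= u x <= g x) -> (forall x, 0 <= v x <= g x) ->
  forall x, 0 <= u x * v x <= m ^+ 2 * \1_B x.
Proof.
move=> hu hv x; have := hu x; have := hv x; have := g0 x.
case: (IB x) => ->; rewrite ?mulr0 ?mulr1 => /andP[h1 h2] /andP[h3 h4] /andP[h5 h6].
  have -> : u x = 0 by lra.
  by rewrite mul0r lexx.
by rewrite mulr_ge0//= expr2 ler_pM//; lra.
Qed.

Let JE p : measurable_fun setT p -> (forall x, 0 <= p x <= g x) ->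
  (\int[lebesgue]_x ((g x - p x) ^+ 2)%:E = (J p)%:E)%E.
Proof.
move=> mp p0; apply: (finB (sqr_ge0 m)); first exact: measurable_sqrT (measurable_subT mg mp).
by apply: prodB => x; have := p0 x; lra.
Qed.

Let S_convex p q (t : R) : 0 <= t <= 1 -> S p -> X q -> (forall x, 0 <= q x) -> fnorm X q <= K ->
  X (fun x => (1 - t) * p x + t * q x) /\ fnorm X (fun x => (1 - t) * p x + t * q x) <= K.
Proof.
move=> /andP[t0 t1] [Xp p0 pK] Xq q0 qK.
have [Xs sn] := tX (fl_scale lX (1 - t) Xp) (fl_scale lX t Xq); split => //.
apply: (le_trans sn); rewrite !(fl_normZ lX)// !ger0_norm ?subr_ge0//.
have := fl_ge0 lX Xp; have := fl_ge0 lX Xq; nra.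
Qed.

Let I := inf [set J p | p in S].

Let J_ge0 p : 0 <= J p.
Proof. by apply: fine_ge0; apply: integral_ge0 => x _; rewrite lee_fin sqr_ge0. Qed.

Let S0 : S (cst 0).
Proof.
split; [exact: fl_zero| |].
  by move=> x; rewrite lexx/=; have /andP[] := g0 x.
by rewrite (fl_norm0 lX) ltW.
Qed.

Let I_le p : S p -> I <= J p.
Proof.
move=> Sp; apply: ge_inf; last by exists p.
by exists 0 => _ [q _ <-]; exact: J_ge0.
Qed.

Let exists_near (e : R) : 0 < e -> exists p, S p /\ J p < I + e.
Proof.
move=> e0; have := @inf_adherent _ [set J p | p in S] e e0.
case; first by split; [exists (J (cst 0)), (cst 0); [exact: S0|]|exists 0 => _ [q _ <-]; exact: J_ge0].
by move=> _ [p Sp <-] h; exists p.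
Qed.

(** Parallelogram identity: the midpoint is admissible, so two near-minimizers are close in L^2. *)
Let dist_le p q (e e' : R) : S p -> S q -> J p < I + e -> J q < I + e' ->
  (\int[lebesgue]_x ((p x - q x) ^+ 2)%:E <= (2 * e + 2 * e')%:E)%E.
Proof.
move=> Sp Sq hp hq; have [Xp p0 pK] := Sp; have [Xq q0 qK] := Sq.
have mp := fl_measurable lX Xp; have mq := fl_measurable lX Xq.
pose c x := (1 - 2^-1) * p x + 2^-1 * q x.
have q00 x : 0 <= q x by have /andP[] := q0 x.
have [Xc cK] : X c /\ fnorm X c <= K.
  by apply: S_convex => //; apply/andP; split; lra.
have mc := fl_measurable lX Xc.
have c0 x : 0 <= c x <= g x.
  by rewrite /c; have := p0 x; have := q0 x; move=> /andP[? ?] /andP[? ?]; apply/andP; split; lra.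
have Ic := I_le (And3 Xc c0 cK).
have H : (\int[lebesgue]_x ((p x - q x) ^+ 2 + 4 * (g x - c x) ^+ 2)%:E =
   \int[lebesgue]_x (2 * (g x - p x) ^+ 2 + 2 * (g x - q x) ^+ 2)%:E)%E.
  by apply: eq_integral => x _; congr EFin; rewrite /c; field.
have s0 u x : 0 <= u x ^+ 2 by exact: sqr_ge0.
have m1 := measurable_sqrT (measurable_subT mp mq).
have m2 := measurable_sqrT (measurable_subT mg mc).
have m3 := measurable_sqrT (measurable_subT mg mp).
have m4 := measurable_sqrT (measurable_subT mg mq).
have z1 x : 0 <= (p x - q x) ^+ 2 by exact: sqr_ge0.
have z2 x : 0 <= (g x - c x) ^+ 2 by exact: sqr_ge0.
have z3 x : 0 <= (g x - p x) ^+ 2 by exact: sqr_ge0.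
have z4 x : 0 <= (g x - q x) ^+ 2 by exact: sqr_ge0.
move: H.
rewrite (integral_addT lebesgue measurableT m1 (measurable_scaleT 4 m2) z1 (fun x => mulr_ge0 (ler0n R 4) (z2 x))).
rewrite (integral_addT lebesgue measurableT (measurable_scaleT 2 m3) (measurable_scaleT 2 m4)
  (fun x => mulr_ge0 (ler0n R 2) (z3 x)) (fun x => mulr_ge0 (ler0n R 2) (z4 x))).
rewrite (integralZ lebesgue measurableT (ler0n R 4) z2 m2).
rewrite (integralZ lebesgue measurableT (ler0n R 2) z3 m3).
rewrite (integralZ lebesgue measurableT (ler0n R 2) z4 m4).
rewrite !JE// -!EFinM -!EFinD.
case: (integral _ _ _) => [r| |] //=.
by move=> /eqP; rewrite -EFinD eqe => /eqP h; rewrite lee_fin; lra.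
Qed.

(** The lower limit [P] of a fast minimizing sequence is admissible by the lattice and Fatou
    properties. With q_k the infimum of the p_j for j >= k, g - q_k is the supremum of the b_j = g -
    p_j, hence at most b_k plus the sum of the later increments; so J(q_k) is close to the
    infimum. *)
Let exists_minimizer : exists2 p, S p & J p <= I.
Proof.
(* The rate 16^(-k) beats the factors 2^k and 2^i lost in estimating the supremum. *)
have e0 k : 0 < 16^-1 ^+ k :> R by rewrite exprn_gt0.
have /choice[p hp] k := exists_near (e0 k).
have Sp k : S (p k) by have [] := hp k.
have Jp k : J (p k) < I + 16^-1 ^+ k by have [] := hp k.
have mp k : measurable_fun setT (p k) by have [h _ _] := Sp k; exact: fl_measurable h.
have p0 k x : 0 <= p k x <= g x by have [_ h _] := Sp k; exact: h.
pose b k x := g x - p k x.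
have mb k : measurable_fun setT (b k) by exact: measurable_subT mg (mp k).
have b0 k x : 0 <= b k x <= g x by have := p0 k x; rewrite /b; lra.
pose A k x := ereal_sup (range (fun j => (b (k + j)%N x)%:E)).
have A_ge k j x : (k <= j)%N -> ((b j x)%:E <= A k x)%E.
  by move=> kj; apply: ereal_sup_ubound; exists (j - k)%N => //=; rewrite subnKC.
have A_le k x (c : R) : (forall j, (k <= j)%N -> b j x <= c) -> (A k x <= c%:E)%E.
  by move=> H; apply: ge_ereal_sup => _ [j _ <-]; rewrite lee_fin H// leq_addr.
have AE k x : A k x = (fine (A k x))%:E.
  rewrite fineK// ge0_fin_numE; last first.
    by apply: (le_trans _ (A_ge k k x (leqnn _))); rewrite lee_fin; have /andP[] := b0 k x.
  by apply: (@le_lt_trans _ _ (g x)%:E); [apply: A_le => j _; have /andP[] := b0 j x|exact: ltry].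
have fA_ge k j x : (k <= j)%N -> b j x <= fine (A k x).
  by move=> kj; rewrite -lee_fin -AE A_ge.
have fA_le k x c : (forall j, (k <= j)%N -> b j x <= c) -> fine (A k x) <= c.
  by move=> H; rewrite -lee_fin -AE A_le.
have mA k : measurable_fun setT (A k).
  by apply: seq_sup_measurable => j; exact: measurable_EFinT (mb _).
pose q k x := g x - fine (A k x).
have mfA k : measurable_fun setT (fun x => fine (A k x)).
  by apply: measurableT_comp; [exact: fine_measurable|exact: mA].
have mq k : measurable_fun setT (q k) by exact: measurable_subT mg (mfA k).
have q_le k x : q k x <= p k x by rewrite /q lerBlDr -lerBlDl; exact: (fA_ge k k x).
have q_ge0 k x : 0 <= q k x.
  by rewrite /q subr_ge0; apply: fA_le => j _; have /andP[] := b0 j x.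
have qS k x : q k x <= q k.+1 x.
  by rewrite /q lerD2l lerN2; apply: fA_le => j kj; apply: fA_ge; exact: ltnW.
pose F x := ereal_sup (range (fun k => (q k x)%:E)).
have F_ge k x : ((q k x)%:E <= F x)%E by apply: ereal_sup_ubound; exists k.
have F_le x : (F x <= (g x)%:E)%E.
  apply: ge_ereal_sup => _ [k _ <-]; rewrite lee_fin (le_trans (q_le k x))//.
  by have /andP[] := p0 k x.
pose P x := fine (F x).
have FE x : F x = (P x)%:E.
  rewrite fineK// ge0_fin_numE; last by apply: (le_trans _ (F_ge 0%N x)); rewrite lee_fin.
  by apply: (le_lt_trans (F_le x)); exact: ltry.
have qP k x : q k x <= P x by rewrite -lee_fin -FE.
have P0 x : 0 <= P x <= g x by rewrite (le_trans (q_ge0 0%N x) (qP _ _))/= -lee_fin -FE.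
have Xq k : X (q k) /\ fnorm X (q k) <= K.
  have [Xp pp pK] := Sp k.
  have [Xqk qn] : X (q k) /\ fnorm X (q k) <= fnorm X (p k).
    apply: (fl_lattice lX Xp (mq k)); apply: aeW => x.
    by rewrite !ger0_norm//; have /andP[] := pp x.
  by split => //; exact: le_trans pK.
have [P' [XP' FP' P'K]] : exists f, [/\ X f, {ae lebesgue, forall x, F x = (f x)%:E} & fnorm X f <= K].
  apply: (xnorm_rep_le lX); apply: (fl_fatou lX (f_ := q)) => [k|k|].
  - by have [] := Xq k.
  - by have [] := Xq k.
  - by apply: aeW => x; split.
have mF : measurable_fun setT F.
  by apply: seq_sup_measurable => k; exact: measurable_EFinT.
have mP : measurable_fun setT P by apply: measurableT_comp; [exact: fine_measurable|exact: mF].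
have [XP PK] : X P /\ fnorm X P <= fnorm X P'.
  by apply: (fl_lattice lX XP' mP); apply: filterS FP' => x; rewrite FE => -[->].
exists P; first by split => //; exact: le_trans P'K.
pose d k x := p k x - p k.+1 x.
have md k : measurable_fun setT (d k) by exact: measurable_subT (mp k) (mp k.+1).
have dint k : (\int[lebesgue]_x ((d k x) ^+ 2)%:E <= (4 * 16^-1 ^+ k)%:E)%E.
  apply: (le_trans (dist_le (Sp k) (Sp k.+1) (Jp k) (Jp k.+1))).
  rewrite lee_fin exprS; have := e0 k; lra.
suff H k : J P <= I + 2^-1 ^+ k * (I + 34).
  have I34 : 0 < I + 34.
    rewrite ltr_wpDl//; apply: lb_le_inf; first by exists (J (cst 0)), (cst 0); [exact: S0|].
    by move=> _ [u _ <-]; exact: J_ge0.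
  rewrite leNgt; apply/negP => IJ.
  pose k := Num.bound ((I + 34) / (J P - I)).
  have h1 : (I + 34) / (J P - I) < 2 ^+ k.
    apply: (lt_le_trans (archi_boundP _)); first by rewrite divr_ge0 ?subr_ge0 ?ltW.
    by rewrite -natrX ler_nat ltnW// ltn_expl.
  move: (H k); rewrite -lerBlDl exprVn ler_pdivlMl ?exprn_gt0//.
  by move: h1; rewrite ltr_pdivrMr ?subr_gt0// => h1; rewrite leNgt h1.
(* (b + D)^2 <= (1 + e) b^2 + (1 + 1/e) D^2 with e = 2^(-k), where D^2 is estimated by
   [sqr_sum_abs_le]. [G] lists the resulting terms: that of b_k, then those of the increments. *)
pose c := 1 + 2 ^+ k : R.
have c0 : 0 <= c by rewrite addr_ge0// exprn_ge0.
pose G i x := if i is j.+1 then (c * (2 * 2 ^+ j)) * d (k + j)%N x ^+ 2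
              else (1 + 2^-1 ^+ k) * b k x ^+ 2.
have z0 : 0 <= 1 + 2^-1 ^+ k :> R by rewrite addr_ge0// exprn_ge0.
have zc j : 0 <= c * (2 * 2 ^+ j) by rewrite mulr_ge0// mulr_ge0// exprn_ge0.
have mG i : measurable_fun setT (G i).
  case: i => [|j]; first exact: measurable_scaleT (measurable_sqrT (mb k)).
  exact: measurable_scaleT (measurable_sqrT (md (k + j)%N)).
have G0 i x : 0 <= G i x by case: i => [|j]; rewrite mulr_ge0// sqr_ge0.
have bound j x : b (k + j)%N x ^+ 2 <= \sum_(0 <= i < j.+1) G i x.
  have tele : b (k + j)%N x <= b k x + \sum_(0 <= i < j) `|d (k + i)%N x|.
    elim: j => [|j ih]; first by rewrite big_geq// addr0 addn0.
    rewrite big_nat_recr//= addrA -lerBlDr; apply: le_trans ih.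
    rewrite lerBlDr addnS -lerBlDl; apply: (@le_trans _ _ (d (k + j)%N x)); last exact: ler_norm.
    by apply: eq_ler; rewrite /b /d; ring.
  have := sqr_sum_abs_le (fun i => d (k + i)%N x) j.
  move: tele; set D := \sum_(0 <= i < j) `|d _ _|; set E := \sum_(0 <= i < j) _ => tele DE.
  rewrite big_nat_recl//=.
  have -> : \sum_(0 <= i < j) c * (2 * 2 ^+ i) * d (k + i)%N x ^+ 2 = c * (2 * E).
    by rewrite /E !mulr_sumr; apply: eq_bigr => i _; rewrite !mulrA.
  have D0 : 0 <= D by apply: sumr_ge0.
  have /andP[bj0 _] := b0 (k + j)%N x; have /andP[bk0 _] := b0 k x.
  apply: (@le_trans _ _ ((b k x + D) ^+ 2)); first by apply: lerXn2r; rewrite ?nnegrE// addr_ge0.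
  apply: (@le_trans _ _ ((1 + 2^-1 ^+ k) * b k x ^+ 2 + c * D ^+ 2)); last first.
    by rewrite lerD2l ler_wpM2l.
  have tk : 0 < 2 ^+ k :> R by rewrite exprn_gt0.
  rewrite /c exprVn.
  have := sqr_ge0 (b k x - 2 ^+ k * D).
  rewrite -subr_ge0 => H; rewrite -subr_ge0.
  have -> : (1 + (2 ^+ k)^-1) * b k x ^+ 2 + (1 + 2 ^+ k) * D ^+ 2 - (b k x + D) ^+ 2 =
     (2 ^+ k)^-1 * (b k x - 2 ^+ k * D) ^+ 2.
    by field; rewrite gt_eqF.
  by rewrite mulr_ge0 ?invr_ge0 ?(ltW tk)// sqr_ge0.
have sq0 u x : 0 <= u x ^+ 2 by exact: sqr_ge0.
have JPq : J P <= J (q k).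
  rewrite -lee_fin -!JE//; last by move=> x; rewrite q_ge0/= (le_trans (qP k x))//; have /andP[] := P0 x.
  apply: le_integral_ge0 => x _; rewrite lee_fin ?sqr_ge0//.
  have /andP[_ Pg] := P0 x.
  by apply: lerXn2r; rewrite ?nnegrE ?subr_ge0 ?lerD2l ?lerN2 ?qP// (le_trans (qP k x)).
apply: (le_trans JPq); rewrite -lee_fin -JE//; last first.
  by move=> x; rewrite q_ge0/= (le_trans (q_le k x))//; have /andP[] := p0 k x.
have lim : {ae lebesgue, forall x, (((g x - q k x) ^+ 2)%:E <= \sum_(0 <= i <oo) (G i x)%:E)%E}.
  apply: aeW => x; rewrite /q opprB addrC subrK.
  have GE0 : (0 <= \sum_(0 <= i <oo) (G i x)%:E)%E.
    by apply: nneseries_ge0 => i _ _; rewrite lee_fin.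
  have [->|SE] := eqVneq (\sum_(0 <= i <oo) (G i x)%:E)%E +oo%E; first exact: leey.
  have [s E] : exists s, (\sum_(0 <= i <oo) (G i x)%:E = s%:E)%E.
    by exists (fine (\sum_(0 <= i <oo) (G i x)%:E)%E); rewrite fineK// ge0_fin_numE// ltey.
  move: GE0; rewrite E !lee_fin => s0.
  have h : fine (A k x) <= Num.sqrt s.
    apply: fA_le => j kj; have /andP[bj0 _] := b0 j x.
    rewrite -(ler_pXn2r (n := 2)) ?nnegrE ?sqrtr_ge0// sqr_sqrtr//.
    rewrite -lee_fin -E -(subnKC kj).
    apply: (@le_trans _ _ (\sum_(0 <= i < (j - k).+1) G i x)%:E); first by rewrite lee_fin bound.
    rewrite -sumEFin; apply: nneseries_lim_ge => i _; by rewrite lee_fin.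
  rewrite -[leRHS]sqr_sqrtr//; apply: lerXn2r; rewrite ?nnegrE ?sqrtr_ge0//.
  by apply: le_trans (fA_ge k k x (leqnn _)); have /andP[] := b0 k x.
apply: (le_trans (le_integral_ae_series measurableT (measurable_sqrT (measurable_subT mg (mq k))) mG
  (fun x => sqr_ge0 _) G0 lim)).
have I0 : 0 <= I.
  apply: lb_le_inf; first by exists (J (cst 0)), (cst 0); [exact: S0|].
  by move=> _ [u _ <-]; exact: J_ge0.
have k0 : 0 < (2^-1 : R) ^+ k /\ (2^-1 : R) ^+ k <= 1.
  by split; [rewrite exprn_gt0|rewrite exprn_ile1 ?invr_ge0 ?invf_le1 ?ler1n ?ltr0n].
have k4 : 16^-1 ^+ k <= 2^-1 ^+ k :> R by apply: expVn_le; rewrite ?ltr0n ?ler_nat.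
apply: (@le_trans _ _ (((1 + 2^-1 ^+ k) * (I + 16^-1 ^+ k))%:E +
    \sum_(0 <= i <oo) (16 * 8^-1 ^+ k * 8^-1 ^+ i)%:E)%E); last first.
  have c16 : 0 <= 16 * 8^-1 ^+ k :> R by rewrite mulr_ge0// exprn_ge0.
  have z8 : 0 <= (8^-1 : R) < 1 by rewrite invr_ge0 ler0n invf_lt1 ?ltr1n ?ltr0n.
  apply: (le_trans (leeD (lexx _) (geometric_nneseries c16 z8))).
  rewrite -EFinD lee_fin.
  have k8 : 8^-1 ^+ k <= 2^-1 ^+ k :> R by apply: expVn_le; rewrite ?ltr0n ?ler_nat.
  have k80 : 0 <= 8^-1 ^+ k :> R by rewrite exprn_ge0.
  have k160 := ltW (e0 k).
  have -> : (16 * 8^-1 ^+ k / (1 - 8^-1) = 128 / 7 * 8^-1 ^+ k :> R) by field.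
  by case: k0 => k0 k1; exact: perturbation_le.
have GI0 i : (0 <= \int[lebesgue]_x (G i x)%:E)%E.
  by apply: integral_ge0 => x _; rewrite lee_fin.
apply: nneseries_le => // -[|N].
  by rewrite big_geq// adde_ge0 ?lee_fin ?mulr_ge0 ?addr_ge0 ?(ltW (e0 k))//
    nneseries_ge0// => i _ _; rewrite lee_fin !mulr_ge0 ?exprn_ge0.
rewrite big_nat_recl//=; apply: leeD.
  rewrite (integralZ lebesgue measurableT z0 (fun x => sqr_ge0 (b k x)) (measurable_sqrT (mb k))).
  by rewrite JE// -EFinM lee_fin ler_wpM2l// ltW.
apply: (@le_trans _ _ (\sum_(0 <= i < N) (16 * 8^-1 ^+ k * 8^-1 ^+ i)%:E)%E); last first.
  by apply: nneseries_lim_ge => i _; rewrite lee_fin !mulr_ge0 ?exprn_ge0.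
apply: lee_sum => i _.
rewrite (integralZ lebesgue measurableT (zc i) (fun x => sqr_ge0 (d (k + i)%N x)) (measurable_sqrT (md _))).
apply: (le_trans (lee_wpmul2l _ (dint (k + i)%N))); first by rewrite lee_fin.
rewrite -EFinM lee_fin /c exprD.
have -> : 16^-1 = 8^-1 * 2^-1 :> R by rewrite -invfM -natrM.
rewrite !exprMn !exprVn.
have t1 : 1 <= 2 ^+ k :> R by rewrite exprn_ege1// ler1n.
have t8 : 0 < 8 ^+ k :> R by rewrite exprn_gt0.
have t2 : 0 < 2 ^+ i :> R by rewrite exprn_gt0.
have t3 : 0 < 8 ^+ i :> R by rewrite exprn_gt0.
have tk0 : 0 < 2 ^+ k :> R by rewrite exprn_gt0.
have -> : (1 + 2 ^+ k) * (2 * 2 ^+ i) * (4 * ((8 ^+ k)^-1 / 2 ^+ k * ((8 ^+ i)^-1 / 2 ^+ i))) =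
   8 * ((1 + 2 ^+ k) / 2 ^+ k) / 8 ^+ k / 8 ^+ i :> R.
  by field; rewrite !gt_eqF.
rewrite ler_wpM2r ?invr_ge0 ?(ltW t3)// ler_wpM2r ?invr_ge0 ?(ltW t8)//.
exact: ratio_le.
Qed.

(** For the projection [p] and h = g - p, optimality gives int h f <= int h p = Q for nonnegative f
    in the ball, so the dual norm of h is at most Q / K. The hypothesis then yields int g h <= Q,
    whereas int g h = Q + int h^2; hence h = 0 a.e. *)
Lemma lorentz_luxemburg_bounded :
  (forall h, kothe X h -> (forall x, 0 <= h x) ->
    (\int[lebesgue]_x (g x * h x)%:E <= (K * fnorm (kothe X) h)%:E)%E) ->
  X g /\ fnorm X g <= K.
Proof.
move=> Hg; have [p Sp pI] := exists_minimizer.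
have [Xp p0 pK] := Sp; have mp := fl_measurable lX Xp.
pose h x := g x - p x.
have mh : measurable_fun setT h by exact: measurable_subT mg mp.
have h0 x : 0 <= h x <= g x by rewrite /h; have := p0 x; lra.
have h00 x : 0 <= h x by have /andP[] := h0 x.
have p00 x : 0 <= p x by have /andP[] := p0 x.
have mhp : measurable_fun setT (fun x => h x * p x) by exact: measurable_mulT mh mp.
have [Q QE] : exists Q : R, (\int[lebesgue]_x (h x * p x)%:E = Q%:E)%E.
  by eexists; apply: (finB (sqr_ge0 m) mhp); exact: prodB h0 p0.
have Q0 : 0 <= Q by rewrite -lee_fin -QE; apply: integral_ge0 => x _; rewrite lee_fin mulr_ge0.
(* Truncation at height N makes the quadratic term of the variation finite on the support of [g]. *)
have trunc f (N : nat) : X f -> (forall x, 0 <= f x) -> fnorm X f <= K ->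
    (\int[lebesgue]_x (h x * Num.min (f x) N%:R)%:E <= Q%:E)%E.
  move=> Xf f0 fK; have mf := fl_measurable lX Xf.
  pose fN x := Num.min (f x) N%:R.
  have mfN : measurable_fun setT fN by apply: measurable_minT; [exact: mf|exact: measurable_cst].
  have fN0 x : 0 <= fN x by rewrite le_min f0 ler0n.
  have [XfN fNK] : X fN /\ fnorm X fN <= fnorm X f.
    by apply: (fl_lattice lX Xf mfN); apply: aeW => x; rewrite !ger0_norm// ge_min lexx.
  have fNK' := le_trans fNK fK.
  have mhf : measurable_fun setT (fun x => h x * fN x) by exact: measurable_mulT mh mfN.
  have hf0 x : 0 <= h x * fN x by rewrite mulr_ge0.
  pose M := (N%:R + m) ^+ 2 * l0 ^+ n.
  have M0 : 0 <= M by rewrite mulr_ge0// ?sqr_ge0// exprn_ge0// ltW.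
  have [W WE] : exists W : R, (\int[lebesgue]_x (h x * fN x)%:E = W%:E)%E.
    eexists; apply: (finB (c := m * N%:R)) => //; first by rewrite mulr_ge0.
    move=> x; rewrite hf0/= mulrAC ler_pM//; first by have := h0 x; have := g0 x; lra.
    by rewrite ge_min lexx orbT.
  rewrite WE lee_fin.
  apply: (le_of_quadratic M0) => t t0 t1.
  pose v x := (1 - t) * p x + t * fN x.
  have [Xv vK] : X v /\ fnorm X v <= K by apply: S_convex => //; rewrite (ltW t0).
  have mv := fl_measurable lX Xv.
  have v0 x : 0 <= v x by rewrite addr_ge0// mulr_ge0// ?subr_ge0// ltW.
  (* Cutting by [g] restores admissibility and does not increase the distance to [g]. *)
  pose pt x := Num.min (v x) (g x).
  have mpt : measurable_fun setT pt by exact: measurable_minT mv mg.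
  have pt0 x : 0 <= pt x <= g x.
    by rewrite le_min v0 ge_min lexx orbT andbT/=; have /andP[h1 h2] := p0 x; exact: le_trans h1 h2.
  have Spt : S pt.
    have [Xpt ptn] : X pt /\ fnorm X pt <= fnorm X v.
      apply: (fl_lattice lX Xv mpt); apply: aeW => x; rewrite !ger0_norm//.
        by rewrite ge_min lexx.
      by have /andP[] := pt0 x.
    by split => //; exact: le_trans vK.
  have Ipt := I_le Spt.
  have m1 := measurable_sqrT (measurable_subT mg mpt).
  have m2 := measurable_sqrT mh.
  have mB : measurable_fun setT (\1_B : Rn R n -> R).
    exact: measurable_funT_indic (cube_measurable a0 l0).
  have t20 : 0 <= 2 * t by rewrite mulr_ge0// ltW.
  have tN0 : 0 <= t ^+ 2 * (N%:R + m) ^+ 2 by rewrite mulr_ge0// sqr_ge0.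
  have B0 x : 0 <= \1_B x :> R by case: (IB x) => ->.
  have : (\int[lebesgue]_x ((g x - pt x) ^+ 2 + 2 * t * (h x * fN x))%:E <=
    \int[lebesgue]_x (h x ^+ 2 + (2 * t * (h x * p x) + t ^+ 2 * (N%:R + m) ^+ 2 * \1_B x))%:E)%E.
    apply: le_integral_ge0 => x _; rewrite lee_fin; first by rewrite addr_ge0 ?sqr_ge0// mulr_ge0.
    have hx := h0 x; have gx := g0 x; have px := p0 x; have fx := fN0 x.
    have fNx : fN x <= N%:R by rewrite ge_min lexx orbT.
    case: (IB x) gx => ->; rewrite ?mulr0 ?mulr1 => gx.
      have gx0 : g x = 0 by apply: le_anti; rewrite andbC.
      have hx0 : h x = 0 by apply: le_anti; rewrite andbC -{2}gx0.
      have ptx0 : pt x = 0 by apply: le_anti; rewrite andbC -{2}gx0.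
      by rewrite gx0 hx0 ptx0 subrr !mul0r !mulr0 !addr0.
    have s1 : (g x - pt x) ^+ 2 <= (h x - t * (fN x - p x)) ^+ 2.
      rewrite /pt; have [vg|vg] := leP (v x) (g x).
        by apply: eq_ler; congr (_ ^+ 2); rewrite /v /h; ring.
      by rewrite subrr expr0n sqr_ge0.
    have s2 : (fN x - p x) ^+ 2 <= (N%:R + m) ^+ 2.
      rewrite -real_normK ?num_real//; apply: lerXn2r; rewrite ?nnegrE ?normr_ge0 ?addr_ge0//.
      by apply: dist_le_add => //; have /andP[p1 p2] := px; have /andP[g1 g2] := gx; rewrite p1 (le_trans p2).
    exact: convex_sq_le s1 s2.
  rewrite (integral_addT lebesgue measurableT m1 (measurable_scaleT (2 * t) mhf)
    (fun x => sqr_ge0 _) (fun x => mulr_ge0 t20 (hf0 x))).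
  have q0 x : 0 <= 2 * t * (h x * p x) + t ^+ 2 * (N%:R + m) ^+ 2 * \1_B x.
    by rewrite addr_ge0// mulr_ge0// mulr_ge0.
  rewrite (integral_addT lebesgue measurableT m2
    (measurable_addT (measurable_scaleT (2 * t) mhp) (measurable_scaleT (t ^+ 2 * (N%:R + m) ^+ 2) mB))
    (fun x => sqr_ge0 _) q0).
  have hp0 x : 0 <= h x * p x by rewrite mulr_ge0.
  rewrite (integral_addT lebesgue measurableT (measurable_scaleT (2 * t) mhp)
    (measurable_scaleT (t ^+ 2 * (N%:R + m) ^+ 2) mB)
    (fun x => mulr_ge0 t20 (hp0 x)) (fun x => mulr_ge0 tN0 (B0 x))).
  rewrite (integralZ lebesgue measurableT t20 hf0 mhf) (integralZ lebesgue measurableT t20 hp0 mhp).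
  rewrite (integralZ lebesgue measurableT tN0 B0 mB).
  have BE : (\int[lebesgue]_x ((\1_B : Rn R n -> R) x)%:E = (l0 ^+ n)%:E)%E.
    rewrite (integral_indic lebesgue measurableT (cube_measurable a0 l0)) setIT.
    exact: lebesgue_cube (ltW l00).
  rewrite BE.
  have -> : (\int[lebesgue]_x (h x ^+ 2)%:E = (J p)%:E)%E by exact: JE.
  rewrite JE// QE WE -!EFinM -!EFinD lee_fin => h1.
  have -> : t ^+ 2 * M = t ^+ 2 * (N%:R + m) ^+ 2 * l0 ^+ n by rewrite /M mulrA.
  rewrite -(lerD2l (J pt)); apply: (le_trans h1); rewrite lerD2r.
  exact: le_trans pI Ipt.
have full f : X f -> (forall x, 0 <= f x) -> fnorm X f <= K ->
    (\int[lebesgue]_x (h x * f x)%:E <= Q%:E)%E.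
  move=> Xf f0 fK; have mf := fl_measurable lX Xf.
  apply: (le_integral_nd_cvg (u := fun N x => h x * Num.min (f x) N%:R)) => [N|N x|N x|x|N].
  - by apply: measurable_mulT; [exact: mh|apply: measurable_minT; [exact: mf|exact: measurable_cst]].
  - by rewrite mulr_ge0// le_min f0 ler0n.
  - by rewrite ler_wpM2l// le_min !ge_min lexx/= ler_nat leqnSn orbT.
  - apply: cvg_near_cst.
    exists (Num.bound (f x)) => // N /= hN; congr (_ * _)%:E; apply/min_idPl.
    by apply: (le_trans (ltW (archi_boundP (f0 x)))); rewrite ler_nat.
  - exact: trunc.
have [Xh hn] : kothe X h /\ fnorm (kothe X) h <= Q / K.
  apply: kothe_le => // f Xf f0 f1.
  rewrite -(@lee_pmul2l _ K%:E) ?lte_fin// -EFinM mulrCA mulfV ?gt_eqF// mulr1.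
  have mf := fl_measurable lX Xf.
  rewrite -(integralZ lebesgue measurableT (ltW K0)); last 2 first.
  - by move=> x; rewrite mulr_ge0.
  - exact: measurable_mulT mf (measurable_absT mh).
  apply: le_trans (full _ (fl_scale lX K Xf) _ _); last 2 first.
  - by move=> x; rewrite mulr_ge0// ltW.
  - by rewrite (fl_normZ lX _ Xf) ger0_norm ?(ltW K0)// ler_piMr// ltW.
  apply: le_integral_ge0 => x _; rewrite lee_fin; first by rewrite !mulr_ge0// ltW.
  by rewrite (ger0_norm (h00 x)) mulrA mulrC.
have := Hg h Xh h00.
have -> : (\int[lebesgue]_x (g x * h x)%:E = (Q + J p)%:E)%E.
  have -> : (\int[lebesgue]_x (g x * h x)%:E = \int[lebesgue]_x (h x * p x + h x ^+ 2)%:E)%E.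
    by apply: eq_integral => x _; congr EFin; rewrite /h; ring.
  rewrite (integral_addT lebesgue measurableT mhp (measurable_sqrT mh)
    (fun x => mulr_ge0 (h00 x) (p00 x)) (fun x => sqr_ge0 _)).
  by rewrite QE EFinD -JE.
rewrite lee_fin => H.
have Jp0 : J p = 0.
  apply/eqP; rewrite eq_le J_ge0 andbT.
  have : K * fnorm (kothe X) h <= Q by rewrite mulrC -ler_pdivlMr.
  lra.
have hae : {ae lebesgue, forall x, g x = p x}.
  have E : (\int[lebesgue]_x `|(h x ^+ 2)%:E| = 0)%E.
    rewrite (_ : (fun x => `|_|%E) = (fun x => (h x ^+ 2)%:E)); last first.
      by apply/funext => x; rewrite gee0_abs// lee_fin sqr_ge0.
    by have := JE mp p0; rewrite Jp0.
  have := (ae_eq_integral_abs lebesgue measurableT (measurable_EFinT (measurable_sqrT mh))).1 E.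
  apply: filterS => x /(_ Logic.I) /= [] /eqP.
  by rewrite sqrf_eq0 subr_eq0 => /eqP.
have [Xg gp] : X g /\ fnorm X g <= fnorm X p.
  by apply: (fl_lattice lX Xp mg); apply: filterS hae => x ->.
by split => //; exact: le_trans pK.
Qed.

End Bounded.

(** Truncate [g] in height and in space, then pass to the limit by the Fatou property. *)
Theorem lorentz_luxemburg g (K : R) : measurable_fun setT g -> (forall x, 0 <= g x) -> 0 < K ->
  (forall h, kothe X h -> (forall x, 0 <= h x) ->
    (\int[lebesgue]_x (g x * h x)%:E <= (K * fnorm (kothe X) h)%:E)%E) ->
  (xnorm X (fun x => (g x)%:E) <= K%:E)%E.
Proof.
move=> mg g0 K0 Hg.
pose gm k x := Num.min (g x) k%:R * \1_(bcube k) x.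
have mb k : measurable (bcube k : set (Rn R n)) by exact: cube_measurable.
have l0 k : 0 < 2 * k.+1%:R :> R by rewrite mulr_gt0.
have m0 k x : 0 <= Num.min (g x) k%:R by rewrite le_min g0 ler0n.
have i0 k x : 0 <= \1_(bcube k) x :> R by rewrite indicE ler0n.
have i1 k x : \1_(bcube k) x <= 1 :> R by rewrite indicE lern1; case: (_ \in _).
have mgm k : measurable_fun setT (gm k).
  apply: measurable_mulT; last exact: measurable_funT_indic (mb k).
  by apply: measurable_minT; [exact: mg|exact: measurable_cst].
have gm0 k x : 0 <= gm k x by rewrite mulr_ge0.
have gmg k x : gm k x <= g x.
  apply: (@le_trans _ _ (Num.min (g x) k%:R)); first by rewrite ler_piMr.
  by rewrite ge_min lexx.
have Xgm k : X (gm k) /\ fnorm X (gm k) <= K.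
  apply: (@lorentz_luxemburg_bounded (gm k) k%:R K _ _ (l0 k) K0 (ler0n _ k) (mgm k)).
    move=> x; rewrite gm0/=; apply: ler_wpM2r => //.
    by rewrite ge_min lexx orbT.
  move=> h Xh h0; apply: le_trans (Hg h Xh h0).
  by apply: le_integral_ge0 => x _; rewrite lee_fin ?mulr_ge0// ler_wpM2r.
apply: (fl_fatou lX (f_ := gm)) => [k|k|].
- by have [] := Xgm k.
- by have [] := Xgm k.
apply: aeW => x; split => [k|k|].
- exact: gm0.
- apply: ler_pM => //.
    by rewrite le_min !ge_min lexx/= ler_nat leqnSn orbT.
  rewrite !indicE ler_nat; case: (boolP (x \in bcube k)) => // /set_mem xk.
  by rewrite mem_set//; exact: bcube_le xk.
apply/eqP; rewrite eq_le; apply/andP; split; last first.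
  by apply: ge_ereal_sup => _ [k _ <-]; rewrite lee_fin.
have [j xj] := bcube_exists x.
pose k := maxn j (Num.bound (g x)).
suff -> : g x = gm k x by apply: ereal_sup_ubound; exists k.
rewrite /gm indicE mem_set ?mulr1; last by apply: bcube_le xj; exact: leq_maxl.
symmetry; apply/min_idPl; apply: (le_trans (ltW (archi_boundP (g0 x)))).
by rewrite ler_nat leq_maxr.
Qed.

End LorentzLuxemburg.

(** * Vector-valued inequalities *)

Section VectorValued.
Context {R : realType} {n : nat}.
Implicit Types (f g h u v w : Rn R n -> R) (x a : Rn R n).

Lemma powR_sum_le (J : finType) (s : R) (a : J -> R) : 0 < s -> (forall j, 0 <= a j) ->
  (\sum_j a j) `^ s <= #|J|%:R `^ s * \sum_j a j `^ s.
Proof.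
move=> s0 a0; rewrite -(lsnorm_pow _ s0) -powRM ?lsnorm_ge0//.
apply: le_powR; [exact: ltW|exact: sumr_ge0|].
rewrite mulr_natl -sumr_const; apply: ler_sum => j _; exact: lsnorm_ge.
Qed.

(** Either G <= w, or G^(s-1) w^(1-s) >= 1. The last hypothesis excludes w = 0 < G, where the
    negative power of w is 0 by convention. *)
Lemma weight_split (s G w : R) : 1 < s -> 0 <= G -> 0 <= w -> (w = 0 -> G = 0) ->
  G <= G `^ s * w `^ (1 - s) + w.
Proof.
move=> s1 G0 w0 wG; have P0 : 0 <= G `^ s * w `^ (1 - s) by rewrite mulr_ge0 ?powR_ge0.
have [Gw|wltG] := leP G w; first by rewrite (le_trans Gw)// lerDr.
have wp : 0 < w.
  by rewrite lt_neqAle w0 andbT eq_sym; apply/eqP => w00; move: wltG; rewrite (wG w00) w00 ltxx.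
have Gp : 0 < G by exact: lt_trans wltG.
suff : G <= G `^ s * w `^ (1 - s) by move=> h; rewrite (le_trans h)// lerDl.
have -> : G `^ s = G * G `^ (s - 1).
  rewrite -[X in X * _](powRr1 G0) -powRD; last by rewrite (gt_eqF Gp) implybT.
  by rewrite addrC subrK.
rewrite -mulrA ler_peMr// -[leLHS](powR_opp_cancel s wp) [leLHS]mulrC ler_wpM2r ?powR_ge0//.
by apply: le_powR; rewrite ?subr_ge0 ?ltW.
Qed.

(** Sum of the dyadic bounds over the 2^n grids of top side L = 3 rho. The operator at scale L / 3 =
    rho is controlled by these grids, whose averages are controlled at scale 2 L = 6 rho: hence the
    scale of the A_1 hypotheses. *)
Lemma Mloc_weighted (rho s A0 A1 : R) : 0 < rho -> 1 < s -> 1 <= A0 -> 1 <= A1 ->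
  exists2 K : R, 0 <= K & forall w0 w1 h g, lint w0 -> lint w1 ->
    (forall x, 0 <= w0 x) -> (forall x, 0 <= w1 x) ->
    {ae lebesgue, forall x, Mloc (6 * rho) w0 x <= (A0 * w0 x)%:E}%E ->
    {ae lebesgue, forall x, Mloc (6 * rho) w1 x <= (A1 * w1 x)%:E}%E ->
    measurable_fun setT h -> (forall x, `|h x| <= w0 x) ->
    measurable_fun setT g -> (forall x, 0 <= g x) ->
    {ae lebesgue, forall x, Mloc rho h x = (g x)%:E} ->
    (\int[lebesgue]_x (g x `^ s * w0 x `^ (1 - s) * w1 x)%:E <=
     K%:E * \int[lebesgue]_x (`|h x| `^ s * w0 x `^ (1 - s) * w1 x)%:E)%E.
Proof.
move=> r0 s1 A01 A11; pose L := 3 * rho.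
have L0 : 0 < L by rewrite mulr_gt0.
have s0 : 0 < s by exact: lt_trans s1.
have e2 : 1 <= 2 ^+ n :> R by rewrite exprn_ege1// ler1n.
have A0' : 1 <= 2 ^+ n * A0 by rewrite (le_trans e2)// ler_peMr// (le_trans ler01).
have A1' : 0 <= 2 ^+ n * A1 by rewrite mulr_ge0 ?exprn_ge0// (le_trans ler01).
have H (al : {ffun 'I_n -> bool}) : exists K : R, 0 <= K /\ forall w0 w1 f g,
    locint lebesgue (gidx L al) w0 -> locint lebesgue (gidx L al) w1 ->
    dyadic_A1 lebesgue (gidx L al) (2 ^+ n * A0) w0 ->
    dyadic_A1 lebesgue (gidx L al) (2 ^+ n * A1) w1 ->
    measurable_fun setT f -> (forall x, 0 <= f x <= w0 x) ->
    measurable_fun setT g -> (forall x, 0 <= g x) -> le_dyadic_max lebesgue (gidx L al) f g ->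
    (\int[lebesgue]_x (g x `^ s * w0 x `^ (1 - s) * w1 x)%:E <=
     K%:E * \int[lebesgue]_x (f x `^ s * w0 x `^ (1 - s) * w1 x)%:E)%E.
  by have [K K0 HK] := dyadic_weighted_max (grid_filtration al L0) s1 A0' A1'; exists K; split.
have [K_ HK] := fin_all_exists H.
(* 6^n comes from the comparison with the grids, the cardinal from raising a sum over the grids to
   the power s. *)
pose c := (6 ^+ n) `^ s * #|{ffun 'I_n -> bool}|%:R `^ s : R.
have c0 : 0 <= c by rewrite mulr_ge0 ?powR_ge0.
have SK0 : 0 <= \sum_al K_ al by apply: sumr_ge0 => al _; have [] := HK al.
exists (c * \sum_al K_ al); first by rewrite mulr_ge0.
move=> w0 w1 h g lw0 lw1 w00 w10 Aw0 Aw1 mh hw mg g0 Mg.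
have [mw0 _] := lw0; have [mw1 _] := lw1.
have E0 : (fun x => `|w0 x|) = w0 by apply/funext => x; rewrite ger0_norm.
have E1 : (fun x => `|w1 x|) = w1 by apply/funext => x; rewrite ger0_norm.
have lh : lint h.
  split => // a l l0; apply: le_lt_trans (lw0.2 a l l0).
  by apply: le_integral_ge0 => x _; rewrite lee_fin// (le_trans (hw x))// ler_norm.
have A1w (A : R) w al : lint w -> (forall x, 0 <= w x) ->
    {ae lebesgue, forall x, Mloc (6 * rho) w x <= (A * w x)%:E}%E ->
    dyadic_A1 lebesgue (gidx L al) (2 ^+ n * A) w.
  move=> lw wp Aw; have E : (fun x => `|w x|) = w by apply/funext => x; rewrite ger0_norm.
  apply: filterS Aw => x Ax k; rewrite -lee_fin -{1}E.
  have L2 : 2 * L <= 6 * rho by rewrite /L mulrA; apply: eq_ler; congr (_ * _); ring.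
  apply: (le_trans (avg_le_Mloc al k x L0 L2 lw)).
  by rewrite -mulrA EFinM; apply: lee_wpmul2l; rewrite ?lee_fin ?exprn_ge0.
pose d al x := dymax lebesgue (gidx L al) (fun y => `|h y|) x.
have d0 al x : 0 <= d al x by exact: (dymax_ge0 (grid_filtration al L0)).
have md al : measurable_fun setT (d al) by exact: (dymax_measurable (grid_filtration al L0)).
have lah al := lint_locint al L0 lh.
have dK al : (\int[lebesgue]_x (d al x `^ s * w0 x `^ (1 - s) * w1 x)%:E <=
     (K_ al)%:E * \int[lebesgue]_x (`|h x| `^ s * w0 x `^ (1 - s) * w1 x)%:E)%E.
  have [_ Hal] := HK al; apply: Hal.
  - by have := lint_locint al L0 lw0; rewrite E0.
  - by have := lint_locint al L0 lw1; rewrite E1.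
  - exact: A1w.
  - exact: A1w.
  - exact: measurable_absT mh.
  - by move=> x; rewrite normr_ge0 hw.
  - exact: md.
  - exact: d0.
  - exact: le_dyadic_max_dymax.
have mom : measurable_fun setT (fun x => w0 x `^ (1 - s)) by exact: measurable_powT mw0.
have mI u : measurable_fun setT u -> measurable_fun setT (fun x => u x `^ s * w0 x `^ (1 - s) * w1 x).
  by move=> hu; apply: measurable_mulT; [apply: measurable_mulT; [exact: measurable_powT hu|exact: mom]|exact: mw1].
have I0 u x : 0 <= u x `^ s * w0 x `^ (1 - s) * w1 x by rewrite !mulr_ge0 ?powR_ge0.
have point : {ae lebesgue, forall x, g x `^ s * w0 x `^ (1 - s) * w1 x <=
    c * \sum_al d al x `^ s * w0 x `^ (1 - s) * w1 x}.
  have hav : {ae lebesgue, forall x, forall al : {ffun 'I_n -> bool}, forall k,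
      avg lebesgue (gidx L al) k (fun y => `|h y|) x <= d al x}.
    apply: filter_forall => al.
    exact: (avg_le_dymax_ae (grid_filtration al L0) (lah al)).
  apply: filterS2 hav Mg => x ha E.
  have L3 : L / 3 = rho by rewrite /L mulrAC divff ?mul1r.
  have := Mloc_le_dymax L0 lh ha; rewrite L3 E lee_fin => gx.
  rewrite -!mulr_suml !mulrA; apply: ler_wpM2r => //; apply: ler_wpM2r; first exact: powR_ge0.
  apply: (@le_trans _ _ ((6 ^+ n * \sum_al d al x) `^ s)).
    by apply: le_powR => //; exact: ltW.
  rewrite powRM ?exprn_ge0 ?sumr_ge0// /c -mulrA ler_wpM2l ?powR_ge0//.
  exact: powR_sum_le.
have S0 x : 0 <= \sum_al d al x `^ s * w0 x `^ (1 - s) * w1 x.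
  by apply: sumr_ge0 => al _; exact: I0.
have mS : measurable_fun setT (fun x => \sum_al d al x `^ s * w0 x `^ (1 - s) * w1 x).
  exact: measurable_sumT (fun al => mI _ (md al)).
clearbody c.
apply: (le_trans (le_integral_ae measurableT (mI g mg) (measurable_scaleT c mS) (I0 g)
  (fun x => mulr_ge0 c0 (S0 x)) point)).
rewrite (integralZ lebesgue measurableT c0 S0 mS) EFinM -muleA.
apply: lee_wpmul2l; first by rewrite lee_fin.
rewrite (integral_sumT lebesgue measurableT (fun al => mI _ (md al)) (fun al x => I0 (d al) x)).
rewrite -sumEFin ge0_sume_distrl; last by move=> al _; rewrite lee_fin; have [] := HK al.
by apply: lee_sum => al _; exact: dK.
Qed.

Lemma lq_sumE s N (u : 'I_N -> Rn R n -> R) x : lq_sum s (fun j y => (u j y)%:E) x =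
  (lsnorm s (fun j => u j x))%:E.
Proof.
rewrite /lq_sum /lsnorm -poweR_EFin -sumEFin; congr (_ `^ _)%E.
Qed.

Lemma lq_sum_eabs s N (u : 'I_N -> Rn R n -> R) : lq_sum s (fun j => eabs (u j)) =
  (fun x => (lsnorm s (fun j => `|u j x|))%:E).
Proof. by apply/funext => x; exact: (lq_sumE s (fun j y => `|u j y|) x). Qed.

Lemma xnorm_lty_mem (Z : fspace R n) f : fatou_lattice Z -> measurable_fun setT f ->
  (xnorm Z (fun x => (f x)%:E) < +oo)%E -> Z f.
Proof.
move=> lZ mf /(xnorm_rep lZ)[g [Zg fg _]].
by apply: (fl_lattice lZ Zg mf _).1; apply: filterS fg => x [->].
Qed.

Variables (X : fspace R n) (rho : R).
Hypotheses (lX : fatou_lattice X) (tX : triangle X) (cX : has_cubes X) (rho0 : 0 < rho).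

(* With w0 and w1 dominating F and v, the weighted bound and Young's inequality
   give int G v <= int G w1 <= int G^s w0^(1-s) w1 + int w0 w1 <~ int w0 w1. *)
Theorem bounded_vv_ineq_pow s : 1 < s ->
  bounded_on X (Mloc rho) -> bounded_on (kothe X) (Mloc rho) ->
  exists2 C : R, 0 < C & vv_ineq_pow X rho s C.
Proof.
move=> s1 BX BX'; have s0 : 0 < s by exact: lt_trans s1.
have lX' := fatou_lattice_kothe lX cX; have tX' := triangle_kothe lX.
have r6 : 0 < 6 * rho by rewrite mulr_gt0.
have B6 := bounded_rescale lX rho0 r6 BX; have B6' := bounded_rescale lX' rho0 r6 BX'.
have [A0 A01 H0] := rubio_de_francia lX tX r6 B6.
have [A1 A11 H1] := rubio_de_francia lX' tX' r6 B6'.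
have [K K0 HK] := Mloc_weighted rho0 s1 A01 A11.
(* The iterations at most double the norms of F and v, whence 4; K + 1 collects the two terms of
   [weight_split]. *)
exists (4 * (K + 1)); first by rewrite mulr_gt0// ltr_wpDl.
move=> N h mh; rewrite lq_sum_eabs; set F := fun x => lsnorm s (fun j => `|h j x|).
move=> Foo; have mF : measurable_fun setT F by apply: measurable_lsnorm => j; exact: measurable_absT.
have XF := xnorm_lty_mem lX mF Foo; rewrite (xnormE lX XF).
have F0 x : 0 <= F x by exact: lsnorm_ge0.
have hF j x : `|h j x| <= F x by apply: lsnorm_ge => // i; exact: normr_ge0.
have Xh j : X (h j).
  by apply: (fl_lattice lX XF (mh j) _).1; apply: aeW => x; rewrite [leRHS]ger0_norm.
have [C _ HC] := bounded_on_rep lX rho0 BX.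
have /fin_all_exists[g hg] j := HC (h j) (Xh j).
have Xg j : X (g j) by have [] := hg j.
have g0 j x : 0 <= g j x by have [_ hh _ _] := hg j; exact: hh.
have Mg : {ae lebesgue, forall x, forall j, Mloc rho (h j) x = (g j x)%:E}.
  by apply: filter_forall => j; have [_ _ hh _] := hg j.
pose G x := lsnorm s (fun j => g j x).
have mg j := fl_measurable lX (Xg j).
have mG : measurable_fun setT G by exact: measurable_lsnorm.
have G0 x : 0 <= G x by exact: lsnorm_ge0.
have -> : xnorm X (lq_sum s (fun j => Mloc rho (h j))) = xnorm X (fun x => (G x)%:E).
  apply: xnorm_congr; apply: filterS Mg => x E; rewrite -lq_sumE /lq_sum.
  by congr (_ `^ _)%E; apply: eq_bigr => j _; rewrite E.
have nF0 := fl_ge0 lX XF.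
have C40 : 0 <= 4 * (K + 1) by rewrite mulr_ge0// addr_ge0.
(* The margin e keeps the constant positive, as [lorentz_luxemburg] requires, even when F vanishes
   a.e. *)
apply/lee_addgt0Pr => e e0; rewrite -!EFinM -EFinD.
apply: (lorentz_luxemburg lX tX mG G0).
  by rewrite ltr_wpDl// mulr_ge0.
move=> v Xv v0.
apply: (@le_trans _ _ (4 * (K + 1) * fnorm X F * fnorm (kothe X) v)%:E); last first.
  by rewrite lee_fin ler_wpM2r ?(kothe_ge0 lX Xv)// lerDl ltW.
have [w0 [Xw0 Fw0 w0n Aw0]] := H0 F XF F0.
have [w1 [Xw1 vw1 w1n Aw1]] := H1 v Xv v0.
have w00 x : 0 <= w0 x by exact: le_trans (Fw0 x).
have w10 x : 0 <= w1 x by exact: le_trans (vw1 x).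
have lw0 := bounded_lint lX r6 B6 Xw0.
have lw1 := bounded_lint lX' r6 B6' Xw1.
have [mw0 _] := lw0; have [mw1 _] := lw1.
have [mv _] := Xv.
have hw j x : `|h j x| <= w0 x by exact: le_trans (Fw0 x).
have hm j : {ae lebesgue, forall x, Mloc rho (h j) x = (g j x)%:E} by have [_ _ hh _] := hg j.
have key j := HK w0 w1 (h j) (g j) lw0 lw1 w00 w10 Aw0 Aw1 (mh j) (hw j) (mg j) (g0 j) (hm j).
have mI u : measurable_fun setT u -> measurable_fun setT (fun x => u x `^ s * w0 x `^ (1 - s) * w1 x).
  by move=> hu; apply: measurable_mulT; [apply: measurable_mulT; [exact: measurable_powT hu|exact: measurable_powT mw0]|exact: mw1].
have I0 u x : 0 <= u x `^ s * w0 x `^ (1 - s) * w1 x by rewrite !mulr_ge0 ?powR_ge0.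
have sumI (u : 'I_N -> Rn R n -> R) : (forall j, measurable_fun setT (u j)) ->
    (\int[lebesgue]_x (lsnorm s (fun j => u j x) `^ s * w0 x `^ (1 - s) * w1 x)%:E =
    \sum_j \int[lebesgue]_x (u j x `^ s * w0 x `^ (1 - s) * w1 x)%:E)%E.
  move=> hu; rewrite -(integral_sumT lebesgue measurableT (fun j => mI _ (hu j)) (fun j => I0 (u j))).
  by apply: eq_integral => x _; rewrite lsnorm_pow// -!mulr_suml.
have GI : (\int[lebesgue]_x (G x `^ s * w0 x `^ (1 - s) * w1 x)%:E <=
    K%:E * \int[lebesgue]_x (`|w0 x| * `|w1 x|)%:E)%E.
  apply: (@le_trans _ _ (K%:E * \int[lebesgue]_x (F x `^ s * w0 x `^ (1 - s) * w1 x)%:E)%E); last first.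
    apply: lee_wpmul2l; first by rewrite lee_fin.
    apply: le_integral_ge0 => x _; rewrite lee_fin; first exact: I0.
    rewrite !ger0_norm// ler_wpM2r// (le_trans (powR_weight_le s1 _))// F0//=.
  have GE : (\int[lebesgue]_x (G x `^ s * w0 x `^ (1 - s) * w1 x)%:E =
      \sum_j \int[lebesgue]_x (g j x `^ s * w0 x `^ (1 - s) * w1 x)%:E)%E := sumI _ mg.
  have FE : (\int[lebesgue]_x (F x `^ s * w0 x `^ (1 - s) * w1 x)%:E =
      \sum_j \int[lebesgue]_x (`|h j x| `^ s * w0 x `^ (1 - s) * w1 x)%:E)%E.
    exact: (sumI (fun j x => `|h j x|) (fun j => measurable_absT (mh j))).
  have le_of_eq (p q : \bar R) : p = q -> (p <= q)%E by move=> ->.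
  have KE0 : (0 <= K%:E)%E by rewrite lee_fin.
  apply: (le_trans (le_of_eq _ _ GE)).
  apply: (le_trans _ (lee_wpmul2l KE0 (le_of_eq _ _ (esym FE)))).
  rewrite ge0_sume_distrr; last first.
    by move=> j _; apply: integral_ge0 => x _; rewrite lee_fin !mulr_ge0 ?powR_ge0.
  by apply: lee_sum => j _; exact: key.
have split_ae : {ae lebesgue, forall x, G x * v x <=
    G x `^ s * w0 x `^ (1 - s) * w1 x + `|w0 x| * `|w1 x|}.
  apply: filterS2 Mg Aw0 => x Mx Ax.
  rewrite (ger0_norm (w00 x)) (ger0_norm (w10 x)) -mulrDl; apply: ler_pM; [exact: G0|exact: v0| |exact: vw1].
  apply: (weight_split s1 (G0 x) (w00 x)) => w0x.
  (* Where w0 vanishes, M h_j <= M w0 <= A0 w0 = 0. *)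
  have gx j : g j x = 0.
    apply/eqP; rewrite eq_le g0 andbT -lee_fin -Mx.
    have r16 : rho <= 6 * rho by rewrite ler_peMl ?(ltW rho0)// ler1n.
    apply: (le_trans (Mloc_le_rho _ _ r16)).
    apply: (@le_trans _ _ (Mloc (6 * rho) w0 x)).
      apply: le_Mloc; [exact: mh|exact: mw0|].
      by apply: aeW => y; rewrite [leRHS]ger0_norm.
    by apply: (le_trans Ax); rewrite w0x mulr0.
  rewrite /G /lsnorm big1; first by rewrite powR0// invr_eq0 gt_eqF.
  by move=> j _; rewrite gx powR0// gt_eqF.
have mGI := mI G mG.
have mw01 : measurable_fun setT (fun x => `|w0 x| * `|w1 x|).
  exact: measurable_mulT (measurable_absT mw0) (measurable_absT mw1).
have w010 x : 0 <= `|w0 x| * `|w1 x| by rewrite mulr_ge0.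
apply: (le_trans (le_integral_ae measurableT (measurable_mulT mG mv) (measurable_addT mGI mw01)
  (fun x => mulr_ge0 (G0 x) (v0 x)) (fun x => addr_ge0 (I0 G x) (w010 x)) split_ae)).
rewrite (integral_addT lebesgue measurableT mGI mw01 (I0 G) w010).
apply: (le_trans (leeD GI (lexx _))).
have Iw1 := kothe_holder lX Xw0 Xw1.
set Iw := (\int[lebesgue]_x (`|w0 x| * `|w1 x|)%:E)%E in Iw1 *.
have Iw0 : (0 <= Iw)%E by apply: integral_ge0 => x _; rewrite lee_fin w010.
have [W IE] : exists W, Iw = W%:E.
  by exists (fine Iw); rewrite fineK// ge0_fin_numE// (le_lt_trans Iw1)// ltry.
move: Iw0 Iw1; rewrite IE !lee_fin => W0 HW.
have : W <= 4 * (fnorm X F * fnorm (kothe X) v).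
  have -> : 4 * (fnorm X F * fnorm (kothe X) v) = (2 * fnorm X F) * (2 * fnorm (kothe X) v) by ring.
  apply: (le_trans HW); exact: ler_pM (fl_ge0 lX Xw0) (kothe_ge0 lX Xw1) w0n w1n.
move=> WF; have -> : K * W + W = (K + 1) * W by ring.
have -> : 4 * (K + 1) * fnorm X F * fnorm (kothe X) v =
  (K + 1) * (4 * (fnorm X F * fnorm (kothe X) v)) by ring.
by rewrite ler_wpM2l// addr_ge0.
Qed.

End VectorValued.

(** * From the vector-valued bound to the associate space *)

Section Duality.
Context {R : realType} {n : nat}.
Implicit Types (f g h u v : Rn R n -> R) (x : Rn R n).
Variables (X : fspace R n) (rho : R).
Hypotheses (lX : fatou_lattice X) (tX : triangle X) (cX : has_cubes X) (rho0 : 0 < rho).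

Lemma norm_bound_fspace : norm_bound (fun u c => X u /\ fnorm X u <= c).
Proof.
split.
- move=> u v c c' [Xv vc] hu uv cc.
  have [Xu un] : X u /\ fnorm X u <= fnorm X v.
    apply: (fl_lattice lX Xv hu); apply: aeW => x; have /andP[u0 le_uv] := uv x.
    by rewrite !ger0_norm// (le_trans u0).
  by split => //; rewrite (le_trans un)// (le_trans vc).
- move=> u v c c' [Xu uc] [Xv vc]; have [Xs sn] := tX Xu Xv.
  by split => //; rewrite (le_trans sn)// lerD.
- move=> t u c t0 [Xu uc]; split; first exact: fl_scale.
  by rewrite (fl_normZ lX _ Xu) ger0_norm// ler_wpM2l.
Qed.

Lemma vv_ineq_pow_le s C C' : C <= C' -> vv_ineq_pow X rho s C -> vv_ineq_pow X rho s C'.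
Proof.
move=> CC H N h mh hy; apply: (le_trans (H N h mh hy)).
by apply: lee_wpmul2r; [exact: xnorm_ge0|rewrite lee_fin].
Qed.

Lemma vv_ineq_pow_bounded s C : 0 < s -> vv_ineq_pow X rho s C -> bounded_on X (Mloc rho).
Proof.
move=> s0 H; exists C => f Xf; have mf := fl_measurable lX Xf.
have one F : (forall x, 0 <= F x)%E -> lq_sum s (fun _ : 'I_1 => F) = F.
  by move=> F0; apply/funext => x; rewrite /lq_sum big_ord1 poweR_inv.
have := H 1%N (fun=> f) (fun=> mf).
rewrite (one (eabs f) (fun x => abse_ge0 _)) (one (Mloc rho f) (fun x => Mloc_ge0 _ _ rho0)).
have [Xa aE] := fl_abs lX Xf.
have -> : eabs f = (fun x => `|f x|%:E) by [].
by rewrite (xnormE lX Xa) aE EFinM => /(_ (ltry _)).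
Qed.

(** For grids of top side L = rho / 2 the dyadic maximal operators are below 2^n times the one at
    scale rho, so they inherit the vector-valued bound. The dual bounds, summed over the grids,
    control the operator on X' at scale L / 3, and a change of scale leads back to rho. *)
Theorem vv_ineq_pow_bounded_kothe s C : 1 < s -> vv_ineq_pow X rho s C ->
  bounded_on (kothe X) (Mloc rho).
Proof.
move=> s1 H0; have s0 : 0 < s by exact: lt_trans s1.
(* [dyadic_dual_bound] asks for a constant at least 1. *)
pose C1 := Num.max 1 C; have C11 : 1 <= C1 by rewrite le_max lexx.
have H : vv_ineq_pow X rho s C1 by apply: vv_ineq_pow_le H0; rewrite le_max lexx orbT.
have BX := vv_ineq_pow_bounded s0 H.
have lX' := fatou_lattice_kothe lX cX.
pose L := rho / 2; have L0 : 0 < L by rewrite divr_gt0.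
have e2 : 1 <= 2 ^+ n :> R by rewrite exprn_ege1// ler1n.
have Cn : 1 <= 2 ^+ n * C1 by rewrite (le_trans e2)// ler_peMr// (le_trans ler01).
pose Bd u c := X u /\ fnorm X u <= c.
have [D _ HD] := bounded_on_rep lX rho0 BX.
have vv al : vv_bound lebesgue (gidx L al) Bd s (2 ^+ n * C1).
  move=> J u v c lu mv v0 uv [XU Uc].
  have u0 j x : 0 <= u j x by have [_ hh _] := lu j; exact: hh.
  have mu_ j : measurable_fun setT (u j) by have [] := lu j.
  pose U x := lsnorm s (fun j => u j x).
  have uU j x : u j x <= U x by apply: (lsnorm_ge j s0) => i; exact: u0.
  have U0 x : 0 <= U x by exact: lsnorm_ge0.
  have Xu j : X (u j).
    apply: (fl_lattice lX XU (mu_ j) _).1; apply: aeW => x.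
    by rewrite (ger0_norm (u0 j x)) (ger0_norm (lsnorm_ge0 _ _)); exact: uU.
  have lintu j : lint (u j) := bounded_lint lX rho0 BX (Xu j).
  have /fin_all_exists[g hg] j := HD (u j) (Xu j).
  have Xg j : X (g j) by have [] := hg j.
  have g0 j x : 0 <= g j x by have [_ hh _ _] := hg j; exact: hh.
  have Mg : {ae lebesgue, forall x, forall j, Mloc rho (u j) x = (g j x)%:E}.
    by apply: filter_forall => j; have [_ _ hh _] := hg j.
  pose G x := lsnorm s (fun j => g j x).
  have mG : measurable_fun setT G by apply: measurable_lsnorm => j; exact: fl_measurable (Xg j).
  (* [vv_bound] allows any finite index type, which is enumerated to fit [vv_ineq_pow]. *)
  have reidx (a : J -> R) : lsnorm s (fun i : 'I_#|J| => a (enum_val i)) = lsnorm s a.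
    by rewrite /lsnorm [in RHS](reindex _ (onW_bij _ (@enum_val_bij J))).
  pose hh (i : 'I_#|J|) := u (enum_val i).
  have hE : lq_sum s (fun i => eabs (hh i)) = (fun x => (U x)%:E).
    rewrite lq_sum_eabs; apply/funext => x; congr EFin; rewrite -[RHS]reidx /lsnorm.
    by congr (_ `^ _); apply: eq_bigr => i _; rewrite ger0_norm//; exact: u0.
  have := H _ hh (fun i => mu_ _); rewrite hE (xnormE lX XU) => /(_ (ltry _)).
  have -> : xnorm X (lq_sum s (fun i => Mloc rho (hh i))) = xnorm X (fun x => (G x)%:E).
    apply: xnorm_congr; apply: filterS Mg => x E.
    rewrite /G -reidx -(lq_sumE s (fun i y => g (enum_val i) y)) /lq_sum.
    by congr (_ `^ _)%E; apply: eq_bigr => i _; rewrite E.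
  move=> Gn.
  have XG : X G by apply: (xnorm_lty_mem lX mG); apply: (le_lt_trans Gn); rewrite -EFinM ltry.
  move: Gn; rewrite (xnormE lX XG) -EFinM lee_fin => Gn.
  have vg : {ae lebesgue, forall x, forall j, v j x <= 2 ^+ n * g j x}.
    apply: filter_forall => j; have [_ _ Mj _] := hg j.
    apply: filterS2 (uv j) Mj => x hx E; apply: hx => k.
    have uE : (fun y => `|u j y|) = u j by apply/funext => y; rewrite ger0_norm//; exact: u0.
    have L2 : 2 * L <= rho by rewrite /L mulrC divfK.
    by have := avg_le_Mloc al k x L0 L2 (lintu j); rewrite uE E -EFinM lee_fin.
  have n0 : 0 <= 2 ^+ n :> R by rewrite exprn_ge0.
  have [XV Vn] : X (fun x => lsnorm s (fun j => v j x)) /\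
      fnorm X (fun x => lsnorm s (fun j => v j x)) <= fnorm X (fun x => 2 ^+ n * G x).
    apply: (fl_lattice lX (fl_scale lX (2 ^+ n) XG)); first exact: measurable_lsnorm.
    apply: filterS vg => x hx; rewrite [leLHS]ger0_norm ?lsnorm_ge0//.
    rewrite [leRHS]ger0_norm ?mulr_ge0 ?lsnorm_ge0//.
    rewrite -(lsnormZ s0 n0 (fun j => g0 j x)); apply: (le_lsnorm s0) => j.
    by rewrite v0 hx.
  split => //; apply: (le_trans Vn); rewrite (fl_normZ lX _ XG) ger0_norm// -mulrA.
  rewrite ler_wpM2l// (le_trans Gn)// ler_wpM2l// (le_trans ler01)//.
have H1 (al : {ffun 'I_n -> bool}) : exists K : R, 0 <= K /\
    forall f h v c (E : \bar R), locint lebesgue (gidx L al) f -> locint lebesgue (gidx L al) h ->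
    measurable_fun setT v -> (forall x, 0 <= v x) -> le_dyadic_max lebesgue (gidx L al) h v ->
    Bd f c -> 0 <= c ->
    (forall G : Rn R n -> R, measurable_fun setT G -> (forall x, 0 <= G x) -> Bd G (K * c) ->
      (\int[lebesgue]_x (h x * G x)%:E <= E)%E) ->
    (\int[lebesgue]_x (f x * v x)%:E <= (2 * 2 ^+ n)%:E * E)%E.
  have [K K0 HK] := dyadic_dual_bound (grid_filtration al L0) norm_bound_fspace s1 Cn (vv al).
  by exists K; split.
have [K_ HK] := fin_all_exists H1.
have SK0 : 0 <= \sum_al K_ al by apply: sumr_ge0 => al _; have [] := HK al.
apply: (bounded_rescale lX' (rho := L / 3)) => //; first by rewrite divr_gt0.
exists (6 ^+ n * (2 * 2 ^+ n) * \sum_al K_ al) => h Xh.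
have [mh _] := Xh.
have lh : lint h by split => // a l l0; exact: (kothe_integrable_cube lX cX).
pose d al x := dymax lebesgue (gidx L al) (fun y => `|h y|) x.
have d0 al x : 0 <= d al x by exact: (dymax_ge0 (grid_filtration al L0)).
have md al : measurable_fun setT (d al) by exact: (dymax_measurable (grid_filtration al L0)).
have lah al := lint_locint al L0 lh.
have hav : {ae lebesgue, forall x, forall al : {ffun 'I_n -> bool}, forall k,
    avg lebesgue (gidx L al) k (fun y => `|h y|) x <= d al x}.
  apply: filter_forall => al.
  exact: (avg_le_dymax_ae (grid_filtration al L0) (lah al)).
pose S x := 6 ^+ n * \sum_al d al x.
have n60 : 0 <= 6 ^+ n :> R by rewrite exprn_ge0.
have S0 x : 0 <= S x by rewrite mulr_ge0// sumr_ge0.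
have mS : measurable_fun setT S by apply: measurable_scaleT; exact: measurable_sumT.
have [XS Sn] : kothe X S /\ fnorm (kothe X) S <=
    6 ^+ n * (2 * 2 ^+ n) * (\sum_al K_ al) * fnorm (kothe X) h.
  apply: (kothe_le lX mS) => f Xf f0 f1; have mf := fl_measurable lX Xf.
  have lf al : locint lebesgue (gidx L al) f.
    have := lint_locint al L0 (bounded_lint lX rho0 BX Xf).
    by have -> : (fun x => `|f x|) = f by apply/funext => x; rewrite ger0_norm.
  have key al : (\int[lebesgue]_x (f x * d al x)%:E <=
      (2 * 2 ^+ n)%:E * (K_ al * fnorm (kothe X) h)%:E)%E.
    have [Ka0 Hal] := HK al.
    apply: (Hal f (fun x => `|h x|) (d al) 1 _ (lf al) (lah al) (md al) (d0 al)) => //.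
      exact: le_dyadic_max_dymax.
    move=> G mG G0 [XG Gn]; apply: (@le_trans _ _ (\int[lebesgue]_x (`|G x| * `|h x|)%:E)%E).
      by apply: le_integral_ge0 => x _; rewrite lee_fin ?mulr_ge0// mulrC (ger0_norm (G0 x)).
    apply: (le_trans (kothe_holder lX XG Xh)); rewrite lee_fin ler_wpM2r ?(kothe_ge0 lX Xh)//.
    by rewrite -[leRHS]mulr1.
  have mfd al : measurable_fun setT (fun x => f x * d al x) by exact: measurable_mulT mf (md al).
  have fd0 al x : 0 <= f x * d al x by rewrite mulr_ge0.
  have sfd0 x : 0 <= \sum_al f x * d al x by apply: sumr_ge0.
  have -> : (\int[lebesgue]_x (f x * `|S x|)%:E =
      \int[lebesgue]_x (6 ^+ n * \sum_al f x * d al x)%:E)%E.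
    apply: eq_integral => x _; congr EFin; rewrite (ger0_norm (S0 x)) /S mulrCA.
    by congr (_ * _); exact: mulr_sumr.
  rewrite (integralZ lebesgue measurableT n60 sfd0 (measurable_sumT mfd)).
  rewrite (integral_sumT lebesgue measurableT mfd fd0).
  rewrite -!mulrA EFinM; apply: lee_wpmul2l; first by rewrite lee_fin.
  apply: (@le_trans _ _ (\sum_al (2 * 2 ^+ n * (K_ al * fnorm (kothe X) h))%:E)%E).
    by apply: lee_sum => al _; rewrite EFinM; exact: key.
  by rewrite sumEFin lee_fin -mulr_sumr -mulr_suml -!mulrA.
rewrite -lee_fin -(xnormE lX' XS) in Sn; apply: le_trans Sn.
apply: (xnorm_mono lX'); first exact: Mloc_measurable.
apply: filterS hav => x hx; rewrite Mloc_ge0 ?divr_gt0//=.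
exact: Mloc_le_dymax.
Qed.

End Duality.

(** * Truncation, and passage between families, sequences and powers *)

Section Truncation.
Context {R : realType} {n : nat}.
Implicit Types (f g h : Rn R n -> R) (x a : Rn R n) (F G : Rn R n -> \bar R).

(** Bounded with bounded support, hence in [Lrloc] for measurable f, and increasing to |f|, which is
    attained at each point for large m. *)
Definition trunc (m : nat) f x : R := Num.min `|f x| m%:R * \1_(bcube m) x.

Lemma trunc_ge0 m f x : 0 <= trunc m f x.
Proof. by rewrite mulr_ge0 ?le_min ?normr_ge0 ?ler0n// indicE ler0n. Qed.

Lemma trunc_le_cst m f x : trunc m f x <= m%:R * \1_(bcube m) x.
Proof. by rewrite ler_wpM2r ?indicE ?ler0n// ge_min lexx orbT. Qed.

Lemma trunc_le m f x : trunc m f x <= `|f x|.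
Proof.
apply: (@le_trans _ _ (Num.min `|f x| m%:R)); last by rewrite ge_min lexx.
by rewrite ler_piMr ?le_min ?normr_ge0 ?ler0n// indicE lern1; case: (_ \in _).
Qed.

Lemma truncS m f x : trunc m f x <= trunc m.+1 f x.
Proof.
apply: ler_pM; rewrite ?le_min ?normr_ge0 ?ler0n ?indicE ?ler0n//.
  by rewrite !ge_min lexx/= ler_nat leqnSn orbT.
rewrite ler_nat; case: (boolP (x \in bcube m)) => // /set_mem xm.
by rewrite mem_set//; exact: bcube_le xm.
Qed.

Lemma trunc_measurable m f : measurable_fun setT f -> measurable_fun setT (trunc m f).
Proof.
move=> mf; apply: measurable_mulT.
  by apply: measurable_minT; [exact: measurable_absT mf|exact: measurable_cst].
exact: measurable_funT_indic (cube_measurable _ _).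
Qed.

Lemma trunc_eq f x : exists k, forall m, (k <= m)%N -> trunc m f x = `|f x|.
Proof.
have [j xj] := bcube_exists x.
exists (maxn j (Num.bound `|f x|)) => m; rewrite geq_max => /andP[jm fm].
rewrite /trunc indicE mem_set ?mulr1; last exact: bcube_le xj.
apply/min_idPl; apply: (le_trans (ltW (archi_boundP (normr_ge0 _)))).
by rewrite ler_nat.
Qed.

Lemma Lrloc_bounded r (c : R) a l f : 0 < r -> 0 < l -> measurable_fun setT f ->
  (forall x, `|f x| <= c * \1_(cube a l) x) -> Lrloc r f.
Proof.
move=> r0 l0 mf fc; split => // z t t0.
have c0 x : 0 <= c * \1_(cube a l) x by apply: le_trans (fc x).
have mQ := cube_measurable a l.
apply: (@le_lt_trans _ _ ((`|c| `^ r)%:E * (l ^+ n)%:E)%E); last by rewrite -EFinM ltry.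
  rewrite -(lebesgue_cube a (ltW l0)) -(integral_cst lebesgue mQ).
  rewrite integral_restr (integral_restr lebesgue (cube a l) (cst (`|c| `^ r))); apply: le_integral_ge0 => y _.
    by rewrite lee_fin mulr_ge0 ?powR_ge0// indicE ler0n.
  rewrite lee_fin; have := fc y; rewrite [in leRHS]indicE [X in _ -> _ <= _ * X]indicE.
  case: (y \in cube a l); rewrite ?mulr1 ?mulr0 => fy.
    apply: (@le_trans _ _ (`|f y| `^ r)); first by rewrite ler_piMr ?powR_ge0// indicE lern1; case: (_ \in _).
    by apply: le_powR; [exact: ltW|exact: normr_ge0|rewrite (le_trans fy)// ler_norm].
  have -> : `|f y| = 0 by apply/eqP; rewrite eq_le fy normr_ge0.
  by rewrite powR0 ?mul0r// gt_eqF.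
Qed.

(** Monotone convergence in each cube, then an exchange of the suprema over cubes and over m. *)
Lemma Mloc_trunc rho r f x : 0 < rho -> 0 < r -> measurable_fun setT f ->
  Mloc rho (fun y => `|f y| `^ r) x =
  ereal_sup (range (fun m => Mloc rho (fun y => `|trunc m f y| `^ r) x)).
Proof.
move=> r0 r1 mf; have r2 := ltW r1.
have mt m : measurable_fun setT (fun y => `|trunc m f y| `^ r).
  exact: measurable_powT (measurable_absT (trunc_measurable m mf)).
have mfr : measurable_fun setT (fun y => `|f y| `^ r) by exact: measurable_powT (measurable_absT mf).
apply/eqP; rewrite eq_le; apply/andP; split; last first.
  apply: ge_ereal_sup => _ [m _ <-]; apply: le_Mloc; [exact: mt|exact: mfr|].
  apply: aeW => y; rewrite !(ger0_norm (powR_ge0 _ _)); apply: le_powR => //.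
  by rewrite ger0_norm ?trunc_ge0 ?trunc_le.
apply: Mloc_le => a l l0 lr xa; rewrite integral_restr.
have i0 y : 0 <= \1_(cube a l) y :> R by rewrite indicE ler0n.
pose u m y := `|(`|trunc m f y| `^ r)| * \1_(cube a l) y.
apply: (le_integral_nd_cvg (u := u)) => [m|m y|m y|y|m].
- exact: measurable_restrT (cube_measurable a l) (measurable_absT (mt m)).
- by rewrite mulr_ge0.
- apply: ler_wpM2r => //; rewrite !(ger0_norm (powR_ge0 _ _)); apply: le_powR => //.
  by rewrite !ger0_norm ?trunc_ge0 ?truncS.
- apply: cvg_near_cst; have [k hk] := trunc_eq f y; exists k => // m /= km.
  by rewrite /u hk// normr_id.
have -> : (\int[lebesgue]_y (u m y)%:E =
    \int[lebesgue]_(y in cube a l) `|(`|trunc m f y| `^ r)|%:E)%E by rewrite [RHS]integral_restr.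
apply: (le_trans (Mloc_ge _ l0 lr xa)); apply: lee_wpmul2l; first by rewrite lee_fin exprn_ge0// ltW.
by apply: ereal_sup_ubound; exists m.
Qed.

Lemma xnorm_fatou (Z : fspace R n) (G_ : nat -> Rn R n -> \bar R) G (c : R) :
  fatou_lattice Z -> (forall m x, 0 <= G_ m x)%E -> (forall m x, G_ m x <= G_ m.+1 x)%E ->
  (forall x, G x = ereal_sup (range (fun m => G_ m x))) ->
  (forall m, xnorm Z (G_ m) <= c%:E)%E -> (xnorm Z G <= c%:E)%E.
Proof.
move=> lZ G0 GS GE Gc.
have /choice[g hg] m := xnorm_rep_le lZ (Gc m).
have gG : {ae lebesgue, forall x, forall m, G_ m x = (g m x)%:E}.
  by apply: ae_foralln => m; have [] := hg m.
apply: (fl_fatou lZ (f_ := g)) => [m|m|]; [by have [] := hg m|by have [] := hg m|].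
apply: filterS gG => x E; split => [m|m|].
- by rewrite -lee_fin -E.
- by rewrite -lee_fin -!E.
- by rewrite GE; congr ereal_sup; apply: eq_imagel => m _.
Qed.

Lemma nneseries_finite (u : nat -> \bar R) N : (forall j, 0 <= u j)%E ->
  (forall j, (N <= j)%N -> u j = 0%E) -> (\sum_(0 <= j <oo) u j = \sum_(0 <= j < N) u j)%E.
Proof.
move=> u0 uN; apply/eqP; rewrite eq_le; apply/andP; split; last first.
  by apply: nneseries_lim_ge => j _.
apply: nneseries_le => // m; have [mN|Nm] := leqP m N.
  by rewrite (big_cat_nat (leq0n m) mN)//= leeDl// sume_ge0.
rewrite (big_cat_nat (leq0n N) (ltnW Nm))//= [X in (_ + X)%E]big1_seq ?adde0//.
by move=> j /andP[_]; rewrite mem_index_iota => /andP[Nj _]; exact: uN.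
Qed.

(** Index and height are truncated by the same m, so that each stage is a finite sum. *)
Lemma sum_nat_sup (a : nat -> nat -> \bar R) (A : nat -> \bar R) :
  (forall m j, 0 <= a m j)%E -> (forall m j, a m j <= a m.+1 j)%E ->
  (forall j, A j = ereal_sup (range (fun m => a m j))) ->
  (\sum_(0 <= j <oo) A j = ereal_sup (range (fun m => \sum_(0 <= j < m) a m j)))%E.
Proof.
move=> a0 aS AE.
have aA m j : (a m j <= A j)%E by rewrite AE; apply: ereal_sup_ubound; exists m.
have A0 j : (0 <= A j)%E := le_trans (a0 0%N j) (aA 0%N j).
have mono j : {homo (fun m => a m j) : i k / (i <= k)%N >-> (i <= k)%E}.
  exact/nondecreasing_seqP.
apply/eqP; rewrite eq_le; apply/andP; split; last first.
  apply: ge_ereal_sup => _ [m _ <-].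
  apply: (@le_trans _ _ (\sum_(0 <= j < m) A j)%E); first by apply: lee_sum.
  by apply: nneseries_lim_ge => j _.
apply: nneseries_le => // N.
have cA : (fun m => \sum_(0 <= j < N) a m j)%E @ \oo --> (\sum_(0 <= j < N) A j)%E.
  apply: cvg_nnesum => j _; first by apply: nearW => m.
  by rewrite AE; exact: ereal_nondecreasing_cvgn.
rewrite -(cvg_lim _ cA)//; apply: lime_le; first by apply/cvg_ex; eexists; exact: cA.
exists N => // m /= Nm; apply: (@le_trans _ _ (\sum_(0 <= j < m) a m j)%E); last first.
  by apply: ereal_sup_ubound; exists m.
by rewrite [leRHS](big_cat_nat (leq0n N) Nm)//= leeDl// sume_ge0.
Qed.

Lemma eabsE f x : eabs f x = `|f x|%:E. Proof. by []. Qed.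

Lemma eq_lq_sum q N (A B : 'I_N -> Rn R n -> \bar R) x : (forall j, A j x = B j x) ->
  lq_sum q A x = lq_sum q B x.
Proof.
move=> AB; rewrite /lq_sum (eq_bigr (fun j => (B j x `^ q)%E))// => j _.
by rewrite AB.
Qed.

Section Extension.
Variables (Y : fspace R n) (rho r q C : R).
Hypotheses (lY : fatou_lattice Y) (rho0 : 0 < rho) (r0 : 0 < r) (q0 : 0 < q) (C0 : 0 < C).
Let ri0 : 0 < r^-1. Proof. by rewrite invr_gt0. Qed.
Let qi0 : 0 < q^-1. Proof. by rewrite invr_gt0. Qed.

(** The inequality applies to the truncations at stage m of the first m functions, which lie in
    [Lrloc]; the Fatou property lets m grow without changing C. *)
Theorem vv_ineq_seq_of_vv_ineq : vv_ineq Y rho r q C -> vv_ineq_seq Y rho r q C.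
Proof.
move=> H f mf Foo.
have [F [YF FE Fn]] := xnorm_rep lY Foo.
rewrite Fn -EFinM.
pose a m j x := (Mlocr rho r (trunc m (f j)) x `^ q)%E.
have a0 m j x : (0 <= a m j x)%E by exact: poweR_ge0.
have mt m j : measurable_fun setT (fun y => `|trunc m (f j) y| `^ r).
  exact: measurable_powT (measurable_absT (trunc_measurable m (mf j))).
have MS m j x : (Mloc rho (fun y => `|trunc m (f j) y| `^ r)%R x <=
    Mloc rho (fun y => `|trunc m.+1 (f j) y| `^ r)%R x)%E.
  apply: le_Mloc; [exact: mt|exact: mt|apply: aeW => y].
  rewrite !(ger0_norm (powR_ge0 _ _)); apply: le_powR => //; first exact: ltW.
  by rewrite !ger0_norm ?trunc_ge0 ?truncS.
have aS m j x : (a m j x <= a m.+1 j x)%E.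
  apply: le_poweR; [exact: ltW|exact: poweR_ge0|].
  by apply: le_poweR; [exact: ltW|exact: Mloc_ge0|exact: MS].
have aE j x : (Mlocr rho r (f j) x `^ q)%E = ereal_sup (range (fun m => a m j x)).
  rewrite /a /Mlocr (Mloc_trunc x rho0 r0 (mf j)).
  rewrite (poweR_sup ri0 (inhabits 0%N)); last by move=> m; exact: Mloc_ge0.
  by rewrite (poweR_sup q0 (inhabits 0%N))// => m; exact: poweR_ge0.
apply: (xnorm_fatou (G_ := fun m x => lq_sum q (fun j : 'I_m => Mlocr rho r (trunc m (f j))) x) lY) =>
  [m x|m x|x|m].
- exact: poweR_ge0.
- apply: le_poweR; [exact: ltW|by apply: sume_ge0 => j _; exact: poweR_ge0|].
  rewrite -!(big_mkord xpredT (fun j => Mlocr rho r (trunc _ (f j)) x `^ q)%E).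
  rewrite big_nat_recr//= -[leLHS]adde0; apply: leeD; last exact: poweR_ge0.
  by apply: lee_sum => j _; exact: aS.
- rewrite /lq_series (sum_nat_sup (fun m j => a0 m j x) (fun m j => aS m j x) (fun j => aE j x)).
  rewrite (poweR_sup qi0 (inhabits 0%N)); last by move=> m; apply: sume_ge0 => j _.
  by congr ereal_sup; apply: eq_imagel => m _; rewrite /lq_sum -(big_mkord xpredT (fun j => a m j x)).
have Lm (j : 'I_m) : Lrloc r (trunc m (f j)).
  apply: (Lrloc_bounded (c := m%:R) (a := [tuple - m.+1%:R | i < n]) (l := 2 * m.+1%:R) r0).
  - by rewrite mulr_gt0.
  - exact: trunc_measurable.
  - by move=> x; rewrite ger0_norm ?trunc_ge0//; exact: trunc_le_cst.
pose U x := lsnorm q (fun j : 'I_m => `|trunc m (f j) x|).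
have mU : measurable_fun setT U.
  by apply: measurable_lsnorm => j; exact: measurable_absT (trunc_measurable m (mf j)).
have UF : {ae lebesgue, forall x, 0 <= (U x)%:E <= lq_series q (fun j => eabs (f j)) x}%E.
  apply: aeW => x; rewrite lee_fin lsnorm_ge0/=.
  rewrite -(lq_sumE q (fun j y => `|trunc m (f j) y|)).
  apply: le_poweR; [exact: ltW|by apply: sume_ge0 => j _; exact: poweR_ge0|].
  rewrite -(big_mkord xpredT (fun j => (`|trunc m (f j) x|%:E `^ q)%E)).
  apply: (@le_trans _ _ (\sum_(0 <= j < m) (eabs (f j) x `^ q))%E); last first.
    by apply: nneseries_lim_ge => j _ _; exact: poweR_ge0.
  apply: lee_sum => j _; apply: le_poweR; [exact: ltW|by rewrite lee_fin|].
  by rewrite /eabs/= lee_fin ger0_norm ?trunc_ge0 ?trunc_le.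
have Un : (xnorm Y (fun x => (U x)%:E) <= (fnorm Y F)%:E)%E.
  by rewrite -Fn; exact: (xnorm_mono lY (measurable_EFinT mU) UF).
have := H m (fun j => trunc m (f j)) Lm; rewrite lq_sum_eabs -/U => Hm.
apply: (le_trans (Hm _)); first by apply: (le_lt_trans Un); exact: ltry.
by rewrite EFinM; apply: lee_wpmul2l; rewrite ?lee_fin ?(ltW C0).
Qed.

Lemma lq_sum_root N (A : 'I_N -> Rn R n -> \bar R) x : (forall j, 0 <= A j x)%E ->
  (lq_sum (q / r) A x `^ r^-1 = lq_sum q (fun j y => A j y `^ r^-1) x)%E.
Proof.
move=> A0; rewrite /lq_sum -poweRrM.
have -> : (q / r)^-1 / r = q^-1 by rewrite invfM invrK mulfK ?gt_eqF.
by congr (_ `^ _)%E; apply: eq_bigr => j _; rewrite -poweRrM mulrC.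
Qed.

Lemma Mloc_abs h x : Mloc rho (fun y => `|h y|) x = Mloc rho h x.
Proof.
have E Q : average (fun y => `|h y|) Q = average h Q.
  by rewrite /average; congr (_ * _)%E; apply: eq_integral => y _ /=; rewrite normr_id.
by congr ereal_sup; apply/seteqP; split => v [a [l [l0 lr xa ->]]]; exists a, l; rewrite E.
Qed.

Lemma Mloc0 x : Mloc rho (fun _ : Rn R n => 0) x = 0%E.
Proof.
apply/eqP; rewrite eq_le Mloc_ge0// andbT; apply: Mloc_le => a l l0 lr xa.
by rewrite mule0 integral0_eq// => y _; rewrite normr0.
Qed.

Lemma Mlocr_root h x : Mlocr rho r (fun y => `|h y| `^ r^-1) x = (Mloc rho h x `^ r^-1)%E.
Proof.
rewrite /Mlocr; have -> : (fun y => `|(`|h y| `^ r^-1)| `^ r) = (fun y => `|h y|).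
  by apply/funext => y; rewrite (ger0_norm (powR_ge0 _ _)) powR_inv'.
by rewrite Mloc_abs.
Qed.

(** Sequences are only asked to be measurable, as are the families in the power space; a finite
    family is padded with zeros. *)
Theorem vv_ineq_pow_of_seq : vv_ineq_seq Y rho r q C ->
  vv_ineq_pow (fpow Y r) rho (q / r) (C `^ r).
Proof.
move=> H N h mh; pose f j : Rn R n -> R :=
  if insub j is Some i then (fun x => `|h i x| `^ r^-1) else (fun=> 0).
have fE (j : 'I_N) : f j = (fun x => `|h j x| `^ r^-1) by rewrite /f valK.
have f0 j : (N <= j)%N -> f j = (fun=> 0) by move=> Nj; rewrite /f insubF// ltnNge Nj.
have mf j : measurable_fun setT (f j).
  rewrite /f; case: insubP => [i _ _|_]; last exact: measurable_cst.
  exact: measurable_powT (measurable_absT (mh i)).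
have qr0 : q != 0 by rewrite gt_eqF.
have series (T : (Rn R n -> R) -> Rn R n -> \bar R) x : (forall g, 0 <= T g x)%E ->
    T (fun=> 0) x = 0%E ->
    lq_series q (fun j => T (f j)) x = lq_sum q (fun j : 'I_N => T (fun y => `|h j y| `^ r^-1)) x.
  move=> T0 T00; rewrite /lq_series (@nneseries_finite _ N).
  - rewrite big_mkord /lq_sum; congr (_ `^ _)%E; apply: eq_bigr => j _; by rewrite fE.
  - by move=> j; exact: poweR_ge0.
  - by move=> j Nj; rewrite f0// T00 poweR0r.
have E1 : (fun x => lq_sum (q / r) (fun j => eabs (h j)) x `^ r^-1)%E =
    lq_series q (fun j => eabs (f j)).
  apply/funext => x; rewrite series.
  - rewrite lq_sum_root; last by move=> j; exact: abse_ge0.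
    by apply: eq_lq_sum => j; rewrite !eabsE poweR_EFin (ger0_norm (powR_ge0 _ _)).
  - by move=> g; exact: abse_ge0.
  - by rewrite eabsE normr0.
have E2 : (fun x => lq_sum (q / r) (fun j => Mloc rho (h j)) x `^ r^-1)%E =
    lq_series q (fun j => Mlocr rho r (f j)).
  apply/funext => x; rewrite series.
  - rewrite lq_sum_root; last by move=> j; exact: Mloc_ge0.
    by apply: eq_lq_sum => j; rewrite Mlocr_root.
  - by move=> g; exact: poweR_ge0.
  - rewrite /Mlocr; have -> : (fun _ : Rn R n => `|0 : R| `^ r) = (fun=> 0 : R).
      by apply/funext => y; rewrite normr0 powR0// gt_eqF.
    by rewrite Mloc0 poweR0r// invr_eq0 gt_eqF.
rewrite !(xnorm_fpow lY r0); [|by apply: aeW => x; exact: poweR_ge0..].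
rewrite E1 E2 => Foo.
have Y0 := xnorm_ge0 lY (lq_series q (fun j => eabs (f j))).
rewrite -poweR_EFin -poweRM//; last by rewrite lee_fin ltW.
apply: le_poweR; [exact: ltW|exact: xnorm_ge0|].
by apply: H => //; apply: (lty_poweRy _ Foo); rewrite gt_eqF.
Qed.

(** Closes the cycle through [vv_ineq_seq] and [vv_ineq_pow], so that the three inequalities are
    equivalent with matching constants. *)
Theorem vv_ineq_of_pow : vv_ineq_pow (fpow Y r) rho (q / r) (C `^ r) -> vv_ineq Y rho r q C.
Proof.
move=> H N f Lf; pose h j x := `|f j x| `^ r.
have mf j : measurable_fun setT (f j) by have [] := Lf j.
have mh j : measurable_fun setT (h j) by exact: measurable_powT (measurable_absT (mf j)).
have := H N h mh.
rewrite !(xnorm_fpow lY r0); [|by apply: aeW => x; exact: poweR_ge0..].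
have -> : (fun x => lq_sum (q / r) (fun j => eabs (h j)) x `^ r^-1)%E =
    lq_sum q (fun j => eabs (f j)).
  apply/funext => x; rewrite lq_sum_root; last by move=> j; exact: abse_ge0.
  by apply: eq_lq_sum => j; rewrite !eabsE poweR_EFin (ger0_norm (powR_ge0 _ _)) powR_inv.
have -> : (fun x => lq_sum (q / r) (fun j => Mloc rho (h j)) x `^ r^-1)%E =
    lq_sum q (fun j => Mlocr rho r (f j)).
  by apply/funext => x; rewrite lq_sum_root// => j; exact: Mloc_ge0.
move=> HN Foo; have {}HN := HN (poweR_lty _ Foo).
have Y0 := xnorm_ge0 lY (lq_sum q (fun j => eabs (f j))).
have Y1 := xnorm_ge0 lY (lq_sum q (fun j => Mlocr rho r (f j))).
have CE0 : (0 <= C%:E)%E by rewrite lee_fin ltW.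
rewrite -(poweR_inv r0 Y1) -(poweR_inv r0 (mule_ge0 CE0 Y0)).
apply: le_poweR; [exact: ltW|exact: poweR_ge0|].
by rewrite poweRM// poweR_EFin.
Qed.

End Extension.
End Truncation.

(** * Necessity of q > r *)

Section Exponent.
Context {R : realType} {n : nat}.
Implicit Types (f : Rn R n -> R) (x a : Rn R n).

(** The sum starts at 1/2 because the values that will occur are 1 / (i - j + 1) with j < i. *)
Lemma harmonic_unbounded (B : R) : exists K : nat, B <= \sum_(0 <= k < K) (k.+2%:R)^-1.
Proof.
apply: contrapT => /forallNP H; apply: (@dvg_harmonic R).
have HB K : \sum_(0 <= k < K) (k.+2%:R)^-1 <= B.
  by rewrite leNgt; apply/negP => /ltW h; exact: (H K).
apply: nondecreasing_is_cvgn.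
  by apply/nondecreasing_seqP => k; rewrite /series/= big_nat_recr//= lerDl harmonic_ge0.
exists (B + 1) => _ [k _ <-]; rewrite /series/=.
have B0 : 0 <= B by have := HB 0%N; rewrite big_geq.
case: k => [|k]; first by rewrite big_geq// addr_ge0.
rewrite big_nat_recl//= /harmonic invr1 addrC lerD2r.
exact: HB.
Qed.

Lemma half_itv_sub (rho c y : R) : 0 < rho -> 0 <= c <= rho / 2 -> c < y < c + rho / 2 ->
  - rho < y < rho.
Proof. by move=> r0 /andP[c0 c1] /andP[y1 y2]; apply/andP; split; lra. Qed.

Variables (i0 : 'I_n) (rho : R).
Hypothesis rho0 : 0 < rho.

Let D : set (Rn R n) := cube [tuple - (2 * rho) | i < n] (4 * rho).

Let D_mem x : (forall k, - (2 * rho) < coord x k < 2 * rho) -> D x.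
Proof.
move=> h k; have /andP[h1 h2] := h k.
by rewrite [coord [tuple _ | _ < n] k]tnth_mktuple; apply/andP; split; move: h1 h2; lra.
Qed.

(** Cut to the cube [D] to have bounded support; [D] is large enough to contain the averaging cubes
    used below. *)
Definition slab (d : R) (j : nat) : set (Rn R n) :=
  [set x | j%:R * d <= coord x i0 < j.+1%:R * d] `&` D.

Lemma slab_measurable d j : measurable (slab d j).
Proof.
apply: measurableI; last exact: cube_measurable.
have -> : [set x : Rn R n | j%:R * d <= coord x i0 < j.+1%:R * d] =
    [set x | `[j%:R * d, j.+1%:R * d[%classic (coord x i0)].
  by apply/seteqP; split => x /=; rewrite in_itv.
by apply: coord_measurable; exact: measurable_itv.
Qed.

Lemma sum_slab_le d m x : 0 < d -> \sum_(0 <= j < m) \1_(slab d j) x <= \1_D x :> R.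
Proof.
(* Strengthened for the induction: the first m slabs lie below height m d. *)
move=> d0; suff : \sum_(0 <= j < m) \1_(slab d j) x <= (coord x i0 < m%:R * d)%R%:R * \1_D x :> R.
  by move=> h; apply: (le_trans h); rewrite ler_piMl ?indicE ?ler0n// lern1; case: (_ < _).
have D0 : 0 <= \1_D x :> R by rewrite indicE ler0n.
elim: m => [|m ih]; first by rewrite big_geq// mulr_ge0.
rewrite big_nat_recr//=.
have mS : m%:R * d <= m.+1%:R * d by rewrite ler_pM2r// ler_nat.
have [xm|mx] := ltP (coord x i0) (m%:R * d).
  have -> : \1_(slab d m) x = 0 :> R.
    by rewrite indicE memNset// => -[/= /andP[h _] _]; move: xm; rewrite ltNge h.
  by rewrite addr0 (lt_le_trans xm mS); move: ih; rewrite xm.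
move: ih; rewrite ltNge mx/= mul0r => ih.
apply: (@le_trans _ _ (0 + \1_(slab d m) x)); first by rewrite lerD2r.
rewrite add0r indicE; case: (boolP (x \in _)) => [/set_mem[/= /andP[_ h] xD]|_]; last by rewrite mulr_ge0.
by rewrite h mul1r indicE mem_set.
Qed.

(** A cube of side (i - j + 1) d reaching from the bottom of slab j to the top of slab i contains x,
    and its lowest layer, of thickness d, belongs to slab j. *)
Lemma Mloc_slab_ge d i j x : 0 < d -> (j < i)%N -> i%:R * d <= coord x i0 < i.+1%:R * d ->
  i.+1%:R * d <= rho -> (forall k, - rho < coord x k < rho) ->
  (((i - j).+1%:R^-1)%:E <= Mloc rho (\1_(slab d j)) x)%E.
Proof.
move=> d0 ji /andP[ix xi] ir xr; pose l := (i - j).+1%:R * d.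
have l0 : 0 < l by rewrite mulr_gt0.
have jl : j%:R * d + l = i.+1%:R * d.
  by rewrite /l -mulrDl -natrD; congr (_%:R * _); rewrite addnS subnKC// ltnW.
have jd0 : 0 <= j%:R * d by rewrite mulr_ge0// ltW.
have lr : l <= rho by move: jl ir jd0; lra.
have jx : j%:R * d < coord x i0.
  by apply: lt_le_trans ix; rewrite ltr_pM2r// ltr_nat.
pose a : Rn R n := [tuple if k == i0 then j%:R * d else coord x k - l / 2 | k < n].
have aE k : coord a k = if k == i0 then j%:R * d else coord x k - l / 2.
  by rewrite /coord tnth_mktuple.
have xa : cube a l x.
  move=> k; rewrite aE; case: eqP => [->|_]; first by rewrite jx jl.
  by apply/andP; split; move: l0; lra.
pose e k := if k == i0 then d else l.
pose A k : set R := `]coord a k, coord a k + e k[%classic.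
have e0 k : 0 <= e k by rewrite /e; case: ifP => _; exact: ltW.
have dl : d <= l by rewrite /l ler_peMl ?(ltW d0)// ler1n.
have el k : e k <= l by rewrite /e; case: ifP.
have mA k : measurable (A k) by exact: measurable_itv.
have AE k : lebesgue_measure (A k) = (e k)%:E by exact: lebesgue_itvoo_fin.
have boxE : lebesgue (box A) = (\prod_(k < n) e k)%:E.
  rewrite lebesgue_box//; last by move=> k; rewrite AE ltry.
  by congr EFin; apply: eq_bigr => k _; rewrite AE.
have sub : box A `<=` cube a l `&` slab d j.
  move=> y yA; split=> [k|].
    have := yA k; rewrite /A/= in_itv/= => /andP[h1 h2]; rewrite h1/=.
    by apply: (lt_le_trans h2); rewrite lerD2l.
  split=> [|].
    have := yA i0; rewrite /A/= in_itv/= aE /e eqxx => /andP[h1 h2]; rewrite (ltW h1)/=.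
    by move: h2; rewrite -addn1 natrD; lra.
  apply: D_mem => k; have := yA k; rewrite /A/= in_itv/= aE /e; case: eqP => [->|_] /andP[h1 h2].
    by apply/andP; split; move: h1 h2 jd0 dl lr jl ir rho0; lra.
  by have /andP[x1 x2] := xr k; apply/andP; split; move: h1 h2 x1 x2 lr rho0; lra.
have ln0 : 0 < l ^+ n by rewrite exprn_gt0.
rewrite -(@lee_pmul2l _ (l ^+ n)%:E) ?lte_fin//.
apply: (le_trans _ (Mloc_ge _ l0 lr xa)).
apply: (@le_trans _ _ (lebesgue (box A))).
  rewrite boxE -EFinM lee_fin; apply: eq_ler.
  have -> : l ^+ n = \prod_(k < n) l by rewrite prodr_const card_ord.
  rewrite (bigD1 i0)//= [RHS](bigD1 i0)//= /e eqxx.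
  have -> : \prod_(k < n | k != i0) (if k == i0 then d else l) = \prod_(k < n | k != i0) l.
    by apply: eq_bigr => k /negbTE ->.
  set Q := \prod_(k < n | k != i0) l; clearbody Q; rewrite /l.
  have : (i - j).+1%:R != 0 :> R by rewrite pnatr_eq0.
  by move: (_.+1%:R) => N N0; field.
have mB : measurable (box A) by exact: box_measurable.
have -> : lebesgue (box A) = (\int[lebesgue]_y (\1_(box A) y)%:E)%E.
  by rewrite (integral_indic lebesgue measurableT mB) setIT.
rewrite [leRHS]integral_restr; apply: le_integral_ge0 => y _; rewrite lee_fin; first by rewrite indicE ler0n.
rewrite !indicE; case: (boolP (y \in box A)) => [/set_mem/sub[h1 h2]|_]; last by rewrite mulr_ge0// ler0n.
by rewrite !mem_set// normr1 mulr1.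
Qed.

Variables (Y : fspace R n) (r q C : R).
Hypotheses (bY : ball_quasi_banach Y) (r0 : 0 < r) (q0 : 0 < q) (C0 : 0 < C).

Theorem vv_ineq_exponent : vv_ineq Y rho r q C -> r < q.
Proof.
move=> H; rewrite ltNge; apply/negP => qr.
have lY := fatou_lattice_bqb bY; have cY := has_cubes_bqb bY.
(* On the cube [P] the coordinate [i0] exceeds rho / 2, so about half of the slabs lie below each of
   its points. *)
pose p : Rn R n := [tuple if k == i0 then rho / 2 else 0 | k < n].
have pE k : coord p k = if k == i0 then rho / 2 else 0 by rewrite /coord tnth_mktuple.
have h0 : 0 < rho / 2 by rewrite divr_gt0.
pose P : set (Rn R n) := cube p (rho / 2).
have YP : Y \1_P by exact: cY.
have D40 : 0 < 4 * rho by rewrite mulr_gt0.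
have YD : Y \1_D by exact: cY.
have NP0 : 0 < fnorm Y \1_P.
  rewrite lt_neqAle (fl_ge0 lY YP) andbT eq_sym; apply/eqP => /(bqb_norm_eq0 bY YP) N0.
  have [x xP] := ae_cube_exists p h0 N0.
  by rewrite indicE mem_set//; apply/eqP; exact: oner_neq0.
(* Chosen so that B times the norm of 1_P exceeds C times the norm of 1_D, which contradicts the
   inequality. *)
pose B := C * fnorm Y \1_D / fnorm Y \1_P + 1.
have B0 : 0 <= B.
  by rewrite addr_ge0// divr_ge0 ?(ltW NP0)// mulr_ge0 ?(ltW C0) ?(fl_ge0 lY YD).
have [K HK] := harmonic_unbounded (B `^ q).
(* The factor 2 leaves at least K slabs below every point of [P]. *)
pose m := (2 * K.+1)%N; pose d := rho / m%:R.
have m0 : 0 < m%:R :> R by rewrite ltr0n.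
have d0 : 0 < d by rewrite divr_gt0.
have md : m%:R * d = rho by rewrite /d mulrC divfK// gt_eqF.
pose f (j : 'I_m) : Rn R n -> R := \1_(slab d j).
have mf j : measurable_fun setT (f j) by apply: measurable_funT_indic; exact: slab_measurable.
have Lf j : Lrloc r (f j).
  apply: (@Lrloc_bounded _ _ r 1 [tuple - (2 * rho) | i < n] (4 * rho)) => //.
  move=> x; rewrite mul1r ger0_norm /f !indicE ?ler0n// ler_nat.
  by case: (boolP (x \in slab d j)) => // /set_mem[_ xD]; rewrite mem_set.
pose U x := lsnorm q (fun j => `|f j x|).
have mU : measurable_fun setT U by apply: measurable_lsnorm => j; exact: measurable_absT.
have U1 x : 0 <= U x <= \1_D x.
  have D0 : 0 <= \1_D x :> R by rewrite indicE ler0n.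
  rewrite lsnorm_ge0/=; apply: (lsnorm_le_pow q0 D0).
  have -> : (\1_D x : R) `^ q = \1_D x by rewrite -[in LHS](ger0_norm D0) powR_indic.
  rewrite (eq_bigr (fun j : 'I_m => \1_(slab d j) x)); last by move=> j _; rewrite powR_indic.
  by rewrite -(big_mkord xpredT (fun j => \1_(slab d j) x)); exact: sum_slab_le.
have [YU Un] : Y U /\ fnorm Y U <= fnorm Y \1_D.
  apply: (fl_lattice lY YD mU); apply: aeW => x; have /andP[u1 u2] := U1 x.
  by rewrite ger0_norm// (le_trans u2)// ler_norm.
have := H m f Lf; rewrite lq_sum_eabs -/U (xnormE lY YU) => /(_ (ltry _)) Hm.
pose S := \sum_(0 <= k < K) (k.+2%:R : R)^-1.
have S0 : 0 <= S by apply: sumr_ge0.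
have low x : P x -> (S%:E <= \sum_(j < m) Mlocr rho r (f j) x `^ q)%E.
  move=> xP; have := xP i0; rewrite pE eqxx => /andP[x1 x2].
  have x0 : 0 <= coord x i0 / d by rewrite divr_ge0// ltW// (lt_trans h0).
  pose i := Num.truncn (coord x i0 / d).
  have /andP[i1 i2] := truncn_itv x0; rewrite -/i in i1 i2.
  move: i1 i2; rewrite ler_pdivlMr// ltr_pdivrMr// => i1 i2.
  have im : (i < m)%N by rewrite -(ltr_nat R) -(ltr_pM2r d0) md; move: i1 x2; lra.
  have Ki : (K <= i)%N.
    have mK : m%:R = 2 * (K.+1)%:R :> R by rewrite natrM.
    rewrite -ltnS -(ltr_nat R) -(ltr_pM2r d0).
    by move: md; rewrite mK => md; move: x1 i2; lra.
  have ir : i.+1%:R * d <= rho by rewrite -md ler_pM2r// ler_nat.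
  have xr k : - rho < coord x k < rho.
    apply: (half_itv_sub rho0 _ (xP k)); rewrite pE.
    by case: ifP => _; rewrite ?lexx ?(ltW h0).
  rewrite -(big_mkord xpredT (fun j => Mlocr rho r (\1_(slab d j) : Rn R n -> R) x `^ q)%E).
  rewrite (big_cat_nat (leq0n i) (ltnW im))/=.
  apply: (@le_trans _ _ (\sum_(0 <= j < i) Mlocr rho r (\1_(slab d j) : Rn R n -> R) x `^ q)%E); last first.
    by rewrite leeDl// sume_ge0// => j _; exact: poweR_ge0.
  apply: (@le_trans _ _ (\sum_(0 <= j < i) ((i - j).+1%:R^-1)%:E)%E).
    rewrite sumEFin lee_fin big_nat_rev/= add0n.
    apply: (@le_trans _ _ (\sum_(0 <= k < i) (k.+2%:R : R)^-1)).
      by rewrite (big_cat_nat (leq0n K) Ki)/= lerDl sumr_ge0.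
    by apply: eq_ler; apply: eq_big_nat => k /andP[_ ki]; rewrite subKn.
  rewrite big_nat_cond [leRHS]big_nat_cond; apply: lee_sum => j /andP[/andP[_ ji] _].
  have i12 : i%:R * d <= coord x i0 < i.+1%:R * d by rewrite i1 i2.
  have := Mloc_slab_ge d0 ji i12 ir xr; set t := _^-1 => tM.
  have t0 : 0 < t by rewrite invr_gt0.
  have t1 : t <= 1 by rewrite invf_le1// ler1n.
  have -> : Mlocr rho r (\1_(slab d j) : Rn R n -> R) x = (Mloc rho (\1_(slab d j)) x `^ r^-1)%E.
    rewrite /Mlocr; have -> : (fun y => `|(\1_(slab d j) : Rn R n -> R) y| `^ r) = \1_(slab d j).
      by apply/funext => y; rewrite powR_indic.
    by [].
  rewrite -poweRrM; apply: (@le_trans _ _ (t%:E `^ (r^-1 * q))%E); last first.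
    by apply: le_poweR => //; [rewrite mulr_ge0 ?invr_ge0 ?(ltW r0) ?(ltW q0)|rewrite lee_fin ltW].
  rewrite poweR_EFin lee_fin.
  (* Here q <= r enters: for t <= 1 it gives t <= t^(q/r). *)
  have qr1 : 0 <= 1 - r^-1 * q by rewrite subr_ge0 ler_pdivrMl// mulr1.
  rewrite -[leLHS](powRr1 (ltW t0)) -[X in _ `^ X](subrK (r^-1 * q)) powRD; last by rewrite (gt_eqF t0) implybT.
  rewrite ler_piMl ?powR_ge0//; apply: (le_trans (le_powR qr1 (ltW t0) t1)).
  by rewrite powR1.
have : (xnorm Y (fun x => (S `^ q^-1 * \1_P x)%:E) <=
    xnorm Y (lq_sum q (fun j => Mlocr rho r (f j))))%E.
  have mP : measurable_fun setT (\1_P : Rn R n -> R) by exact: measurable_funT_indic (cube_measurable _ _).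
  apply: (xnorm_mono lY (measurable_EFinT (measurable_scaleT _ mP))).
  apply: aeW => x; rewrite lee_fin mulr_ge0 ?powR_ge0 ?indicE ?ler0n//=.
  rewrite [\1_P x]indicE.
  case: (boolP (x \in P)) => [/set_mem xP|_]; last by rewrite mulr0; exact: poweR_ge0.
  rewrite mulr1 -poweR_EFin; apply: le_poweR; [by rewrite invr_ge0 ltW|by rewrite lee_fin|exact: low].
rewrite (xnormE lY (fl_scale lY _ YP)) (fl_normZ lY _ YP) (ger0_norm (powR_ge0 _ _)) => hS.
have := le_trans hS Hm; rewrite -EFinM lee_fin => fin.
have SB : B <= S `^ q^-1 by apply: powR_le_root.
have : B * fnorm Y \1_P <= C * fnorm Y \1_D.
  apply: (@le_trans _ _ (S `^ q^-1 * fnorm Y \1_P)); first by rewrite ler_wpM2r// ltW.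
  by apply: (le_trans fin); rewrite ler_wpM2l// ltW.
rewrite /B mulrDl mul1r divfK ?gt_eqF// gerDl leNgt NP0//.
Qed.

End Exponent.

(** * Suprema and the scalar estimate *)

Section Suprema.
Context {R : realType} {n : nat}.
Implicit Types (f g : Rn R n -> R) (x : Rn R n).
Variables (Y : fspace R n) (rho r C : R).
Hypotheses (lY : fatou_lattice Y) (rho0 : 0 < rho) (r0 : 0 < r) (C0 : 0 < C).

Lemma Mlocr_measurable f : measurable_fun setT (Mlocr rho r f).
Proof.
apply: (measurableT_comp (measurable_poweR r^-1)).
exact: Mloc_measurable.
Qed.

Lemma le_Mlocr f g x : measurable_fun setT f -> measurable_fun setT g ->
  {ae lebesgue, forall y, `|f y| <= `|g y|} -> (Mlocr rho r f x <= Mlocr rho r g x)%E.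
Proof.
move=> mf mg fg; apply: le_poweR; [by rewrite invr_ge0 ltW|exact: Mloc_ge0|].
apply: le_Mloc; [exact: measurable_powT (measurable_absT mf)|exact: measurable_powT (measurable_absT mg)|].
apply: filterS fg => y fy; rewrite !(ger0_norm (powR_ge0 _ _)).
by apply: le_powR => //; exact: ltW.
Qed.

Lemma fin_max_measurable N (F : 'I_N -> Rn R n -> \bar R) :
  (forall j, measurable_fun setT (F j)) -> measurable_fun setT (fin_max F).
Proof.
move=> mF; have H (s : seq 'I_N) : measurable_fun setT (fun x => \big[maxe/0%E]_(j <- s) F j x).
  elim: s => [|j s ih].
    rewrite (_ : (fun x => _) = cst 0%E); first exact: measurable_cst.
    by apply/funext => x; rewrite big_nil.
  rewrite (_ : (fun x => _) = (fun x => maxe (F j x) (\big[maxe/0%E]_(j <- s) F j x))).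
    exact: measurable_maxe (mF j) ih.
  by apply/funext => x; rewrite big_cons.
exact: H.
Qed.

(* Both a finite maximum and a supremum of the f_j are dominated by the single
   representative g, and M f_j <= M g. *)
Lemma scalar_ineq_dominated F G : scalar_ineq Y rho r C -> measurable_fun setT G ->
  (xnorm Y F < +oo)%E ->
  (forall g, measurable_fun setT g -> {ae lebesgue, forall x, F x = (g x)%:E} ->
    forall x, 0 <= G x <= Mlocr rho r g x)%E ->
  (xnorm Y G <= C%:E * xnorm Y F)%E.
Proof.
move=> H mG Foo GF; have [g [Yg Fg ->]] := xnorm_rep lY Foo.
rewrite -EFinM; apply: le_trans (H g Yg).
apply: (xnorm_mono lY mG); apply: aeW => x.
exact: GF (fl_measurable lY Yg) Fg x.
Qed.

Lemma max_ineq_of_scalar : scalar_ineq Y rho r C -> max_ineq Y rho r C.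
Proof.
move=> H N f mf Foo; apply: (scalar_ineq_dominated H _ Foo).
  by apply: fin_max_measurable => j; exact: Mlocr_measurable.
move=> g mg Fg x; apply/andP; split; first exact: bigmax_ge_id.
apply: bigmax_le => [|j _]; first exact: poweR_ge0.
apply: le_Mlocr => //; apply: filterS Fg => y E.
rewrite -lee_fin (le_trans (_ : _ <= fin_max (fun j => eabs (f j)) y)%E)//.
  exact: (le_bigmax 0%E (fun j => eabs (f j) y) j).
by rewrite E lee_fin ler_norm.
Qed.

Lemma sup_ineq_of_scalar : scalar_ineq Y rho r C -> sup_ineq Y rho r C.
Proof.
move=> H f mf Foo; apply: (scalar_ineq_dominated H _ Foo).
  by apply: seq_sup_measurable => j; exact: Mlocr_measurable.
move=> g mg Fg x; apply/andP; split.
  by apply: (@le_trans _ _ (Mlocr rho r (f 0%N) x)); [exact: poweR_ge0|apply: ereal_sup_ubound; exists 0%N].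
apply: ge_ereal_sup => _ [j _ <-]; apply: le_Mlocr => //; apply: filterS Fg => y E.
rewrite -lee_fin (le_trans (_ : _ <= seq_sup (fun j => eabs (f j)) y)%E)//.
  by apply: ereal_sup_ubound; exists j.
by rewrite E lee_fin ler_norm.
Qed.

Lemma scalar_ineq_of_max : max_ineq Y rho r C -> scalar_ineq Y rho r C.
Proof.
move=> H f Yf; have mf := fl_measurable lY Yf.
have one F : (forall x, 0 <= F x)%E -> fin_max (fun _ : 'I_1 => F) = F.
  move=> F0; apply/funext => x; rewrite /fin_max big_ord_recl big_ord0.
  by apply/max_idPl; exact: F0.
have := H 1%N (fun=> f) (fun=> mf).
rewrite (one (eabs f) (fun x => abse_ge0 _)) (one (Mlocr rho r f) (fun x => poweR_ge0 _ _)).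
have [Ya aE] := fl_abs lY Yf; rewrite (xnormE lY Ya) aE EFinM; apply; exact: ltry.
Qed.

Lemma scalar_ineq_of_sup : sup_ineq Y rho r C -> scalar_ineq Y rho r C.
Proof.
move=> H f Yf; have mf := fl_measurable lY Yf.
have one F : seq_sup (fun=> F) = F.
  apply/funext => x; apply/eqP; rewrite eq_le; apply/andP; split.
    by apply: ge_ereal_sup => _ [j _ <-].
  by apply: ereal_sup_ubound; exists 0%N.
have := H (fun=> f) (fun=> mf); rewrite !one.
have [Ya aE] := fl_abs lY Yf; rewrite (xnormE lY Ya) aE EFinM; apply; exact: ltry.
Qed.

End Suprema.

Theorem theorem6p2 (R : realType) (n : nat) (rho r : R) (Y : fspace R n)
    (n_gt0 : (0 < n)%N) (rho_gt0 : 0 < rho) (r_gt0 : 0 < r)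
    (bqbY : ball_quasi_banach Y) (convY : rconvex1 Y r) :
  let X := fpow Y r in
  let bdd_X_X' := bounded_on X (Mloc rho) /\ bounded_on (kothe X) (Mloc rho) in
  let vv_some_q := exists q C : R, [/\ r < q, 0 < C & vv_ineq Y rho r q C] in
  let vv_all_q := forall q : R, r < q -> exists2 C : R, 0 < C & vv_ineq Y rho r q C in
  let scalar_est := scalar_ineq Y rho r in
  let max_est := max_ineq Y rho r in
  let sup_est := sup_ineq Y rho r in
  [/\ [/\ bdd_X_X' <-> vv_some_q, vv_some_q <-> vv_all_q,
          [/\ bdd_X_X' -> fmem Y `<=` Lrloc r, vv_some_q -> fmem Y `<=` Lrloc r
            & vv_all_q -> fmem Y `<=` Lrloc r]
        & forall q C : R, r < q -> 0 < C ->
            (vv_ineq Y rho r q C <-> vv_ineq_pow X rho (q / r) (C `^ r))],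
      (forall q : R, 0 < q -> (exists2 C : R, 0 < C & vv_ineq Y rho r q C) ->
         r < q /\ fmem Y `<=` Lrloc r) /\
      (forall q : R, 0 < q -> q <= r ->
         ~ (exists2 C : R, 0 < C & vv_ineq Y rho r q C)),
      forall q C : R, r < q -> 0 < C ->
        (vv_ineq Y rho r q C <-> vv_ineq_seq Y rho r q C)
    & fmem Y `<=` Lrloc r ->
      [/\ (exists2 C : R, 0 < C & scalar_est C) <-> (exists2 C : R, 0 < C & max_est C),
          (exists2 C : R, 0 < C & max_est C) <-> (exists2 C : R, 0 < C & sup_est C)
        & forall C : R, 0 < C -> (scalar_est C <-> max_est C) /\ (max_est C <-> sup_est C)]].
Proof.
move=> X bdd_X_X' vv_some_q vv_all_q scalar_est max_est sup_est.
have lY := fatou_lattice_bqb bqbY; have cY := has_cubes_bqb bqbY.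
have lX : fatou_lattice X by exact: fatou_lattice_fpow.
have tX : triangle X by exact: triangle_fpow.
have cX : has_cubes X by exact: has_cubes_fpow.
have seq_iff q C : 0 < q -> 0 < C -> vv_ineq Y rho r q C <-> vv_ineq_seq Y rho r q C.
  move=> q0 C0; split; first exact: vv_ineq_seq_of_vv_ineq.
  by move=> H; apply: vv_ineq_of_pow => //; exact: vv_ineq_pow_of_seq.
have pow_iff q C : 0 < q -> 0 < C ->
    vv_ineq Y rho r q C <-> vv_ineq_pow X rho (q / r) (C `^ r).
  move=> q0 C0; split; last exact: vv_ineq_of_pow.
  by move=> H; apply: vv_ineq_pow_of_seq => //; exact: vv_ineq_seq_of_vv_ineq.
(* |f|^r lies in X, where boundedness of the maximal operator forces local integrability. *)
have bounded_Lrloc : bounded_on X (Mloc rho) -> fmem Y `<=` Lrloc r.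
  move=> B f Yf; have mf := fl_measurable lY Yf; split => // x t t0.
  have Xf : X (fun y => `|f y| `^ r).
    split; first exact: measurable_powT (measurable_absT mf).
    rewrite (_ : (fun y => _) = (fun y => `|f y|)); first by have [] := fl_abs lY Yf.
    by apply/funext => y; rewrite (ger0_norm (powR_ge0 _ _)) powR_inv.
  have [_ fint] := bounded_lint lX rho_gt0 B Xf.
  have [a [l [l0 sub]]] := eball_sub_cube x t0.
  apply: le_lt_trans (fint a l l0).
  apply: (@le_trans _ _ (\int[lebesgue]_(y in cube a l) (`|f y| `^ r)%:E)%E).
    by apply: le_integral_sub => // y; rewrite lee_fin powR_ge0.
  by apply: le_integral_ge0 => y _; rewrite lee_fin ?powR_ge0// ler_norm.
have bdd_all : bdd_X_X' -> vv_all_q.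
  move=> [BX BX'] q rq; have q0 : 0 < q by exact: lt_trans rq.
  have s1 : 1 < q / r by rewrite ltr_pdivlMr// mul1r.
  have [K K0 HK] := bounded_vv_ineq_pow lX tX cX rho_gt0 s1 BX BX'.
  exists (K `^ r^-1); first exact: powR_gt0.
  by apply/pow_iff => //; [exact: powR_gt0|rewrite powR_inv'// ltW].
have all_some : vv_all_q -> vv_some_q.
  move=> H; have [|C C0 HC] := H (r + 1); first by rewrite ltrDl.
  by exists (r + 1), C; rewrite ltrDl.
have some_bdd : vv_some_q -> bdd_X_X'.
  move=> [q [C [rq C0 H]]]; have q0 : 0 < q by exact: lt_trans rq.
  have s1 : 1 < q / r by rewrite ltr_pdivlMr// mul1r.
  have {}H := (pow_iff q C q0 C0).1 H.
  split; last exact: vv_ineq_pow_bounded_kothe H.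
  exact: (vv_ineq_pow_bounded lX rho_gt0 (lt_trans ltr01 s1) H).
(* Positivity of n provides the axis along which the slabs are cut. *)
have vv_gt q C : 0 < q -> 0 < C -> vv_ineq Y rho r q C -> r < q.
  by move=> q0 C0; exact: (vv_ineq_exponent (Ordinal n_gt0) rho_gt0 bqbY r_gt0 q0 C0).
split.
- split.
  + by split => [/bdd_all/all_some|/some_bdd].
  + by split => [/some_bdd/bdd_all|/all_some].
  + by split => [[/bounded_Lrloc]|/some_bdd[/bounded_Lrloc]|/all_some/some_bdd[/bounded_Lrloc]].
  + by move=> q C rq C0; apply: pow_iff => //; exact: lt_trans rq.
- split=> [q q0 [C C0 H]|q q0 qr [C C0 H]].
    have rq := vv_gt q C q0 C0 H; split; first exact: rq.
    by have [/bounded_Lrloc] : bdd_X_X' by apply: some_bdd; exists q, C.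
  by have := vv_gt q C q0 C0 H; rewrite ltNge qr.
- by move=> q C rq C0; apply: seq_iff => //; exact: lt_trans rq.
move=> _; have iff C : 0 < C -> (scalar_est C <-> max_est C) /\ (max_est C <-> sup_est C).
  move=> C0; have sm : scalar_est C <-> max_est C.
    by split; [exact: max_ineq_of_scalar|exact: scalar_ineq_of_max].
  split => //; split; first by move=> /sm; exact: sup_ineq_of_scalar.
  by move=> H; apply/sm; exact: scalar_ineq_of_sup.
split => //.
- by split => -[C C0 HC]; exists C => //; apply/(iff C C0).1.
- by split => -[C C0 HC]; exists C => //; apply/(iff C C0).2.
Qed.
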